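(* Let $\theta\in(0,\frac{\pi}{2})$, and let $F\colon M\to\mathbb{S}^3(1)\times\mathbb{R}\subset\mathbb{E}^5$ be an immersion of a surface $M$. Then $M$ is a minimal and constant angle surface in $\mathbb{S}^3(1)\times\mathbb{R}$ with constant angle $\theta$ if and only if, locally (i.e. in suitable local coordinates $(x,y)$ around each point of $M$) and up to isometries of $\mathbb{S}^3(1)\times\mathbb{R}$, the immersion is given by $$F(x,y)=\big(c_1\cos(\mu_1x+\nu_2y),\ c_1\sin(\mu_1x+\nu_2y),\ c_2\cos(\mu_2x-\nu_1y),\ c_2\sin(\mu_2x-\nu_1y),\ x\sin\theta\big),$$ where $\nu_1\in[1,\sqrt{1+\cos^2\theta}]$ is a constant, and $\nu_2,\mu_1,\mu_2,c_1,c_2$ are the nonnegative constants given by $$\nu_2^2=\frac{1+\cos^2\theta-\nu_1^2}{1-\nu_1^2\sin^2\theta},\qquad \mu_1^2=\frac{\nu_1^2\cos^4\theta}{1-\nu_1^2\sin^2\theta},\qquad \mu_2^2=1+\cos^2\theta-\nu_1^2,$$ $$c_1^2=\frac{1-\nu_1^2\sin^2\theta}{1+\cos^2\theta-\nu_1^2\sin^2\theta},\qquad c_2^2=\frac{\cos^2\theta}{1+\cos^2\theta-\nu_1^2\sin^2\theta}.$$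
   Context: $\mathbb{S}^3(1)\times\mathbb{R}$ is the Riemannian product of the unit $3$-sphere and the real line, regarded as a hypersurface of Euclidean space $\mathbb{E}^5=\mathbb{R}^4\times\mathbb{R}$ (namely the points whose first four coordinates form a unit vector), so that $\partial_t$, the unit vector field tangent to the $\mathbb{R}$-direction, is $(0,0,0,0,1)$. A surface immersed in $\mathbb{S}^3(1)\times\mathbb{R}$ carries the induced metric. Along $M$ one decomposes $$\partial_t=\sin\theta\, T+\cos\theta\,\xi,$$ where $T$ is a unit vector tangent to $M$, $\xi$ is a unit vector normal to $M$ in $\mathbb{S}^3(1)\times\mathbb{R}$, and $\theta\in[0,\frac{\pi}{2}]$ is the angle between $\xi$ and $\partial_t$ (the angle between $\partial_t$ and the normal plane of $M$). $M$ is called a constant angle surface (with constant angle $\theta$) if the angle function $\theta$ is constant on $M$. $M$ is minimal if its mean curvature vector in $\mathbb{S}^3(1)\times\mathbb{R}$ vanishes. *)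

(* Defs.v *)
From HB Require Import structures.
From mathcomp Require Import all_boot all_order all_algebra.
From mathcomp Require Import all_classical all_reals all_analysis.

Set Implicit Arguments.
Unset Strict Implicit.
Unset Printing Implicit Defensive.

Import Order.TTheory GRing.Theory Num.Theory.
Import numFieldNormedType.Exports.

Local Open Scope classical_set_scope.
Local Open Scope ring_scope.

(** * Calculus on open subsets of R^m *)

Section Calculus.
Context {R : realType} {m : nat} {W : normedModType R}.
Implicit Types (f : 'rV[R]_m -> W) (x : 'rV[R]_m).

Definition partial (i : 'I_m) f : 'rV[R]_m -> W :=
  fun x => 'D_(delta_mx 0 i) f x.

Definition iter_partial (s : seq 'I_m) f : 'rV[R]_m -> W := foldr partial f s.

(** C^oo on [U], meant for [U] open: all iterated partial derivatives of [f]
    (the empty iteration being [f] itself) are differentiable on [U], hence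
    also continuous there. *)
Definition smooth_on (U : set 'rV[R]_m) f : Prop :=
  forall s x, U x -> differentiable (iter_partial s f) x.

End Calculus.

(** * Smooth surfaces *)

(** [cmap] and [cinv] are total functions; only their restrictions to [cdom]
    and [ccod] matter. *)
Record chart (R : realType) (M : topologicalType) := Chart {
  cdom : set M;
  ccod : set 'rV[R]_2;
  cmap :> M -> 'rV[R]_2;
  cinv : 'rV[R]_2 -> M;
  cdom_open : open cdom;
  ccod_open : open ccod;
  cmap_fun : forall p, cdom p -> ccod (cmap p);
  cinv_fun : forall x, ccod x -> cdom (cinv x);
  cmapK : forall p, cdom p -> cinv (cmap p) = p;
  cinvK : forall x, ccod x -> cmap (cinv x) = x;
  cmap_continuous : {within cdom, continuous cmap};
  cinv_continuous : {within ccod, continuous cinv} }.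

Definition smooth_transition (R : realType) (M : topologicalType)
    (c d : chart R M) : Prop :=
  smooth_on (ccod c `&` cinv c @^-1` cdom d) (d \o cinv c).

Definition compatible (R : realType) (M : topologicalType)
    (c d : chart R M) : Prop :=
  smooth_transition c d /\ smooth_transition d c.

Record surface (R : realType) := Surface {
  carrier :> topologicalType;
  atlas : set (chart R carrier);
  surface_hausdorff : hausdorff_space carrier;
  surface_second_countable : @second_countable carrier;
  atlas_cover : forall p, exists2 c, atlas c & cdom c p;
  atlas_compatible : forall c d, atlas c -> atlas d -> compatible c d }.

(** Membership in the maximal atlas. *)
Definition local_coordinates (R : realType) (M : surface R)
    (k : chart R M) : Prop :=
  forall c, atlas c -> compatible k c.

(** * The hypersurface S^3(1) x R of E^5 *)

Section Ambient.
Context {R : realType}.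
Implicit Types (p v w : 'rV[R]_5).

(** Euclidean inner product; the norm which the library puts on ['rV[R]_5] is
    the sup norm, and only its topology is used. *)
Definition inner v w : R := \sum_i v 0 i * w 0 i.

Definition dt : 'rV[R]_5 := delta_mx 0 ord_max.

(** The first four coordinates, that is (p_1, p_2, p_3, p_4, 0). At a point [p]
    of S^3 x R this is also the unit normal of S^3 x R in E^5. *)
Definition sphere_part p : 'rV[R]_5 := p - p 0 ord_max *: dt.

Definition S3R : set 'rV[R]_5 :=
  [set p | inner (sphere_part p) (sphere_part p) = 1].

Definition tangent_S3R p : set 'rV[R]_5 :=
  [set v | inner v (sphere_part p) = 0].

(** Orthogonal projection of E^5 onto the tangent space of S^3 x R at [p]. *)
Definition proj_S3R p v : 'rV[R]_5 :=
  v - inner v (sphere_part p) *: sphere_part p.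

(** A smooth map on S^3 x R is given through a smooth extension to some
    neighbourhood in E^5. *)
Definition smooth_near_S3R (phi : 'rV[R]_5 -> 'rV[R]_5) : Prop :=
  exists U, [/\ open U, S3R `<=` U & smooth_on U phi].

(** Riemannian isometries of S^3 x R: self-diffeomorphisms whose differential
    preserves the induced metric; for tangent [v] the value of ['d phi p v]
    depends only on the restriction of [phi] to S^3 x R. *)
Definition isometry_S3R (phi : 'rV[R]_5 -> 'rV[R]_5) : Prop :=
  (exists psi, [/\ smooth_near_S3R phi, smooth_near_S3R psi,
     forall p, S3R p -> S3R (phi p) /\ psi (phi p) = p &
     forall p, S3R p -> S3R (psi p) /\ phi (psi p) = p]) /\
  (forall p v w, S3R p -> tangent_S3R p v -> tangent_S3R p w ->
     inner ('d phi p v) ('d phi p w) = inner v w).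

End Ambient.

Arguments S3R R : clear implicits.
Arguments dt R : clear implicits.

(** * Extrinsic geometry of a local parametrisation [f] with values in S^3 x R *)

Section LocalGeometry.
Context {R : realType}.
Variable f : 'rV[R]_2 -> 'rV[R]_5.
Implicit Types (x : 'rV[R]_2) (v : 'rV[R]_5).

Definition tangent_plane x : set 'rV[R]_5 := range ('d f x).

Definition normal_plane x : set 'rV[R]_5 :=
  [set v | tangent_S3R (f x) v /\
           forall w, tangent_plane x w -> inner v w = 0].

(** The induced metric in the coordinates of [f]. *)
Definition metric x : 'M[R]_2 :=
  \matrix_(i, j) inner (partial i f x) (partial j f x).

(** Orthogonal projection onto the tangent plane. *)
Definition proj_tangent x v : 'rV[R]_5 :=
  \sum_i \sum_j
    (invmx (metric x) i j * inner v (partial i f x)) *: partial j f x.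

(** h(d_i, d_j): the component normal to the surface of the covariant
    derivative in S^3 x R, which is itself the component tangent to S^3 x R of
    the derivative in E^5. *)
Definition second_fundamental_form x (i j : 'I_2) : 'rV[R]_5 :=
  let cov := proj_S3R (f x) (partial i (partial j f) x) in
  cov - proj_tangent x cov.

(** H = (1/2) trace h. *)
Definition mean_curvature x : 'rV[R]_5 :=
  2^-1 *: \sum_i \sum_j invmx (metric x) i j *: second_fundamental_form x i j.

Definition has_angle x (theta : R) : Prop :=
  0 <= theta <= pi / 2 /\
  exists T xi, [/\ tangent_plane x T /\ inner T T = 1,
    normal_plane x xi /\ inner xi xi = 1 &
    dt R = sin theta *: T + cos theta *: xi].

End LocalGeometry.

(** * Surfaces in S^3(1) x R *)

Section Surfaces.
Context {R : realType} {M : surface R}.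
Variable F : M -> 'rV[R]_5.

Definition immersion_S3R : Prop :=
  (forall p, S3R R (F p)) /\
  forall c, atlas c ->
    smooth_on (ccod c) (F \o cinv c) /\
    forall x, ccod c x -> injective ('d (F \o cinv c) x).

Definition minimal : Prop :=
  forall c x, atlas c -> ccod c x -> mean_curvature (F \o cinv c) x = 0.

Definition constant_angle (theta : R) : Prop :=
  forall c x, atlas c -> ccod c x -> has_angle (F \o cinv c) x theta.

End Surfaces.

(** * The explicit immersions *)

Section Model.
Context {R : realType}.
Variables theta nu1 : R.

Definition nu2 : R := Num.sqrt
  ((1 + cos theta ^+ 2 - nu1 ^+ 2) / (1 - nu1 ^+ 2 * sin theta ^+ 2)).

Definition mu1 : R := Num.sqrt
  (nu1 ^+ 2 * cos theta ^+ 4 / (1 - nu1 ^+ 2 * sin theta ^+ 2)).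

Definition mu2 : R := Num.sqrt (1 + cos theta ^+ 2 - nu1 ^+ 2).

Definition c1 : R := Num.sqrt
  ((1 - nu1 ^+ 2 * sin theta ^+ 2) /
   (1 + cos theta ^+ 2 - nu1 ^+ 2 * sin theta ^+ 2)).

Definition c2 : R := Num.sqrt
  (cos theta ^+ 2 / (1 + cos theta ^+ 2 - nu1 ^+ 2 * sin theta ^+ 2)).

Definition model (x y : R) : 'rV[R]_5 :=
  \row_(i < 5) [:: c1 * cos (mu1 * x + nu2 * y);
                   c1 * sin (mu1 * x + nu2 * y);
                   c2 * cos (mu2 * x - nu1 * y);
                   c2 * sin (mu2 * x - nu1 * y);
                   x * sin theta]`_i.

End Model.

(** The parameter [nu1] is constant on the components of the surface, which is
    not assumed connected: it is a single constant when the surface is. *)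
Definition locally_model (R : realType) (M : surface R) (F : M -> 'rV[R]_5)
    (theta : R) : Prop :=
  exists nu1 : M -> R,
    (forall p, \forall q \near p, nu1 q = nu1 p) /\
    (forall p, 1 <= nu1 p <= Num.sqrt (1 + cos theta ^+ 2)) /\
    (forall p, exists (k : chart R M) (phi : 'rV[R]_5 -> 'rV[R]_5),
      [/\ local_coordinates k, cdom k p, isometry_S3R phi &
       forall q, cdom k q ->
         F q = phi (model theta (nu1 p) (k q 0 0) (k q 0 1))]).

(* Main.v *)
Require Import Defs.
From HB Require Import structures.
From mathcomp Require Import all_boot all_order all_algebra.
From mathcomp Require Import all_classical all_reals all_analysis.
From mathcomp Require Import ring lra.

Set Implicit Arguments.
Unset Strict Implicit.
Unset Printing Implicit Defensive.

Import Order.TTheory GRing.Theory Num.Theory.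
Import numFieldNormedType.Exports.
Local Open Scope classical_set_scope.
Local Open Scope ring_scope.


(** A surface is studied through the local parametrizations [F \o cinv c].

    The models have the two properties. Each is the sum of two vectors that turn
    in orthogonal planes by linear angles, and of a linear height. The relations
    between the constants say that the coordinate vectors are orthonormal, that
    the Laplacian is [- (1 + cos theta ^ 2)] times the unit normal of S^3 x R,
    and that the height has gradient [sin theta] times the first coordinate
    vector. Minimality and the angle follow, and pass to any reparametrization
    ([reparametrized_minimal], [reparametrized_angle]). The isometries are
    controlled by [isometry_affine]: each of them is the restriction of an affine
    map whose linear part is orthogonal and sends [dt] to [dt] or [- dt]. Indeed
    an isometry preserves the covariant acceleration of curves, by Koszul's
    formula, hence geodesics. The height of a geodesic is affine, and horizontal
    geodesics are closed; thus horizontal vectors are sent to horizontal ones and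
    [dt] to [dt] or [- dt]. Every point lies on a geodesic through a fixed point,
    along which the image is known explicitly.

    Conversely, let [T] be the normalised tangential part of [dt], so that
    [T = cos theta U + sin theta dt] with [U] a horizontal unit vector, and let
    [e] be the unit tangent vector orthogonal to [T], [N] the unit normal of
    S^3 x R, [eta] the remaining member of an orthonormal frame [N, eta, U, e, dt].
    With [tau], [rho] the coframe dual to [T], [e], minimality reduces the
    derivatives of the frame to two functions [a], [b] ([structure_U],
    [structure_e], [structure_eta]). The symmetry of second derivatives then
    gives that [tau] and [rho] are closed, that [a ^ 2 + b ^ 2 = cos theta ^ 2],
    and that [a] and [b] are constant ([structure_constants]). After a choice of
    signs there is a [nu1] for which [a] and [b] are the coefficients of the
    model ([model_parameterP]). The orthonormal pairs
    [(c1 N - c2 eta, sig U + kap e)] and [(c2 N + c1 eta, kap U - sig e)], where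
    [kap] and [sig] are suitable constants, turn in their planes with the speeds
    [mu1 tau + nu2 rho] and [mu2 tau - nu1 rho]; in coordinates [X], [Y] with
    differentials [tau], [rho] they are therefore explicit, and [N] is a
    combination of them ([structure_local_model]). The inverse function theorem
    makes a chart of [X], [Y]. Finally [a ^ 2], hence [nu1], is determined by the
    length of the derivative of [U] along [T], which is independent of
    coordinates ([axis_speed_reparametrization]): this makes [nu1] a locally
    constant function on the surface. *)

(** * Smooth functions of several variables *)

Section FrechetDerivative.
Context {R : realType} {V W : normedModType R}.
Implicit Types (f g : V -> W) (x : V).

Lemma is_diff_epsilon f (df : {linear V -> W}) x : continuous df ->
  (forall e, 0 < e ->
    \forall h \near 0, `|f (h + x) - f x - df h| <= e * `|h|) ->
  is_diff x f df.
Proof.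
move=> cdf fdf.
have fE : f \o shift x = cst (f x) + df +o_ 0 id.
  apply/eqaddoP => e e0; have := fdf e e0; apply: filterS => h.
  by rewrite /= !fctE opprD addrA.
have dfE := diff_unique cdf fE.
by apply: DiffDef => //; apply/diff_locallyP; rewrite dfE.
Qed.

Lemma diff_epsilon f x e : differentiable f x -> 0 < e ->
  \forall h \near 0, `|f (h + x) - f x - 'd f x h| <= e * `|h|.
Proof.
move=> /diff_locally /eqaddoP fE e0; have := fE e e0.
by apply: filterS => h; rewrite /= !fctE opprD addrA.
Qed.

Lemma near_is_diff f g x : (\near x, f x = g x) ->
  differentiable f x -> is_diff x g ('d f x).
Proof.
move=> fg df; apply: is_diff_epsilon; first exact: diff_continuous.
have fgx := nbhs_singleton fg.
move=> e e0; near=> h.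
have <- : f (h + x) = g (h + x).
  by near: h; move: fg; rewrite (near_shift 0) subr0.
by rewrite -fgx; near: h; exact: diff_epsilon.
Unshelve. all: by end_near. Qed.

Lemma near_differentiable f g x : (\near x, f x = g x) ->
  differentiable f x -> differentiable g x.
Proof. by move=> fg df; have [] := near_is_diff fg df. Qed.

End FrechetDerivative.

Lemma near_open (T : topologicalType) (U : set T) (P : T -> Prop) x :
  open U -> U x -> (forall y, U y -> P y) -> \near x, P x.
Proof. by move=> oU Ux UP; apply: filterS UP _; exact: open_nbhs_nbhs. Qed.

Section Partial.
Context {R : realType} {m : nat}.
Implicit Types (x : 'rV[R]_m) (U : set 'rV[R]_m).

Section NormedModule.
Context {W : normedModType R}.
Implicit Types f g : 'rV[R]_m -> W.

Lemma partialE i f x : differentiable f x ->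
  partial i f x = 'd f x (delta_mx 0 i).
Proof. exact: deriveE. Qed.

Lemma eq_partial U i f g x : open U -> U x -> (forall y, U y -> f y = g y) ->
  partial i f x = partial i g x.
Proof. by move=> oU Ux fg; apply: near_eq_derive; exact: near_open fg. Qed.

Lemma diff_partial f x v : differentiable f x ->
  'd f x v = \sum_i v 0 i *: partial i f x.
Proof.
move=> df; rewrite {1}[v]row_sum_delta linear_sum.
by apply: eq_bigr => i _; rewrite linearZ partialE.
Qed.

Lemma partial_cst i (a : W) x : partial i (fun=> a) x = 0.
Proof. exact: derive_cst. Qed.

Lemma partialD i f g x : differentiable f x -> differentiable g x ->
  partial i (fun y => f y + g y) x = partial i f x + partial i g x.
Proof. by move=> df dg; apply: deriveD; exact: diff_derivable. Qed.

Lemma partialN i f x : differentiable f x ->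
  partial i (fun y => - f y) x = - partial i f x.
Proof. by move=> df; apply: deriveN; exact: diff_derivable. Qed.

Lemma partialB i f g x : differentiable f x -> differentiable g x ->
  partial i (fun y => f y - g y) x = partial i f x - partial i g x.
Proof. by move=> df dg; apply: deriveB; exact: diff_derivable. Qed.

Lemma partialZ i (a : R) f x : differentiable f x ->
  partial i (fun y => a *: f y) x = a *: partial i f x.
Proof. by move=> df; apply: deriveZ; exact: diff_derivable. Qed.

End NormedModule.

Section Scalar.
Implicit Types f g : 'rV[R]_m -> R.

Lemma partialM i f g x : differentiable f x -> differentiable g x ->
  partial i (fun y => f y * g y) x = f x * partial i g x + g x * partial i f x.
Proof. by move=> df dg; apply: deriveM; exact: diff_derivable. Qed.

Lemma partialV i f x : f x != 0 -> differentiable f x ->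
  partial i (fun y => (f y)^-1) x = - (f x) ^- 2 * partial i f x.
Proof. by move=> f0 df; apply: deriveV => //; exact: diff_derivable. Qed.

End Scalar.


Section Coordinates.
Variable n : nat.
Implicit Types f g : 'rV[R]_m -> 'rV[R]_n.

Lemma differentiable_rowP f x :
  differentiable f x <-> forall j, differentiable (fun y => f y 0 j) x.
Proof.
split=> [df j|df].
  apply: (@differentiable_comp _ _ _ _ f (fun v : 'rV[R]_n => v 0 j)) => //.
  exact: differentiable_coord.
have -> : f = fun y => \sum_j f y 0 j *: (delta_mx 0 j : 'rV[R]_n).
  by apply/funext => y; exact: row_sum_delta.
rewrite -(@fct_sumE _ _ _ _ _ (fun j y => f y 0 j *: (delta_mx 0 j : 'rV[R]_n))).
by apply: differentiable_sum => j; exact: differentiableZl.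
Qed.

Lemma partial_coord i f x j : differentiable f x ->
  partial i f x 0 j = partial i (fun y => f y 0 j) x.
Proof. by move=> df; rewrite /partial derive_mx ?mxE//; exact: diff_derivable. Qed.

Lemma differentiable_scale (a : 'rV[R]_m -> R) f x :
  differentiable a x -> differentiable f x ->
  differentiable (fun y => a y *: f y) x.
Proof.
move=> da df; apply/differentiable_rowP => j; under eq_fun do rewrite mxE.
by apply: differentiableM => //; move: j; apply/differentiable_rowP.
Qed.

Lemma partial_scale i (a : 'rV[R]_m -> R) f x :
  differentiable a x -> differentiable f x ->
  partial i (fun y => a y *: f y) x =
  partial i a x *: f x + a x *: partial i f x.
Proof.
move=> da df; have dfj := (differentiable_rowP f x).1 df.
apply/rowP => j; rewrite partial_coord; last exact: differentiable_scale.
transitivity (partial i (fun y => a y * f y 0 j) x).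
  by congr (partial i _ x); apply/funext => y; rewrite mxE.
rewrite partialM; [|exact: da|exact: dfj].
by rewrite !mxE partial_coord// addrC; congr (_ + _); exact: mulrC.
Qed.

End Coordinates.

(** * Functions of class C^k *)

Section Ck.
Context {W : normedModType R}.

(** Class C^(k+1), but with differentiability in place of continuity of the
    last derivatives: the form in which the induction on [smooth_on] runs. *)
Fixpoint Ck (k : nat) (U : set 'rV[R]_m) (f : 'rV[R]_m -> W) : Prop :=
  (forall x, U x -> differentiable f x) /\
  (if k is k'.+1 then forall i, Ck k' U (partial i f) else True).

Lemma Ck_differentiable k U f x : Ck k U f -> U x -> differentiable f x.
Proof. by case: k => [|k] [df _] Ux; exact: df. Qed.

Lemma Ck_partial k U f i : Ck k.+1 U f -> Ck k U (partial i f).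
Proof. by move=> [_]; exact. Qed.

Lemma Ck_pred k U f : Ck k.+1 U f -> Ck k U f.
Proof.
elim: k f => [|k IH] f [df dpf]; split => // i.
by apply: IH; exact: dpf.
Qed.

Lemma eq_Ck k U f g : open U -> (forall x, U x -> f x = g x) ->
  Ck k U f -> Ck k U g.
Proof.
move=> oU; elim: k f g => [|k IH] f g fg Cf.
  split=> // x Ux; apply: near_differentiable (Ck_differentiable Cf Ux).
  exact: near_open fg.
split=> [x Ux|i].
  apply: near_differentiable (Ck_differentiable Cf Ux).
  exact: near_open fg.
apply: IH (Ck_partial i Cf) => x Ux; exact: eq_partial fg.
Qed.

Lemma sub_Ck k U V f : V `<=` U -> Ck k U f -> Ck k V f.
Proof.
move=> VU; elim: k f => [|k IH] f [df dpf].
  by split=> // x /VU; exact: df.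
by split=> [x /VU|i]; [exact: df|exact/IH/dpf].
Qed.

(** The two definitions peel the iterated derivatives off at opposite ends. *)
Lemma smooth_onP U f : smooth_on U f <-> forall k, Ck k U f.
Proof.
split=> [Sf k|Cf s].
  elim: k f Sf => [|k IH] f Sf.
    by split=> // x Ux; exact: (Sf [::]).
  split=> [x Ux|i]; first exact: (Sf [::]).
  apply: IH => s x Ux; have := Sf (rcons s i) x Ux.
  have -> // : iter_partial (rcons s i) f = iter_partial s (partial i f).
  exact: foldr_rcons.
elim/last_ind: s f Cf => [|s i IH] f Cf x Ux.
  by have [df _] := Cf 0%N; exact: df.
have -> : iter_partial (rcons s i) f = iter_partial s (partial i f).
  exact: foldr_rcons.
by apply: IH => // k; exact: Ck_partial.
Qed.

Lemma Ck_cst k U (a : W) : Ck k U (fun=> a).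
Proof.
elim: k a => [|k IH] a; split=> // i.
have -> : partial i (fun=> a) = (fun=> 0 : W).
  by apply/funext => x; exact: partial_cst.
exact: IH.
Qed.

Lemma CkD k U f g : open U -> Ck k U f -> Ck k U g ->
  Ck k U (fun x => f x + g x).
Proof.
move=> oU; elim: k f g => [|k IH] f g Cf Cg.
  by split=> // x Ux; apply: differentiableD; apply: (Ck_differentiable _ Ux); eassumption.
split=> [x Ux|i]; first by apply: differentiableD; apply: (Ck_differentiable _ Ux); eassumption.
apply: eq_Ck (IH _ _ (Ck_partial i Cf) (Ck_partial i Cg)) => // x Ux.
by rewrite partialD//; apply: (Ck_differentiable _ Ux); eassumption.
Qed.

Lemma CkN k U f : open U -> Ck k U f -> Ck k U (fun x => - f x).
Proof.
move=> oU; elim: k f => [|k IH] f Cf.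
  by split=> // x Ux; apply: differentiableN; apply: (Ck_differentiable _ Ux); eassumption.
split=> [x Ux|i]; first by apply: differentiableN; apply: (Ck_differentiable _ Ux); eassumption.
apply: eq_Ck (IH _ (Ck_partial i Cf)) => // x Ux.
by rewrite partialN//; apply: (Ck_differentiable _ Ux); eassumption.
Qed.

Lemma CkB k U f g : open U -> Ck k U f -> Ck k U g ->
  Ck k U (fun x => f x - g x).
Proof. by move=> oU Cf Cg; apply: CkD => //; exact: CkN. Qed.

Lemma Ck_sum k U (I : Type) (r : seq I) (P : pred I) (F : I -> 'rV[R]_m -> W) :
  open U -> (forall i, P i -> Ck k U (F i)) ->
  Ck k U (fun x => \sum_(i <- r | P i) F i x).
Proof.
move=> oU CF; elim: r => [|i r IH].
  by apply: (eq_Ck oU) (Ck_cst k U 0) => x _; rewrite big_nil.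
case: (boolP (P i)) => Pi.
  apply: (eq_Ck oU) (CkD oU (CF i Pi) IH) => x _.
  by rewrite big_cons Pi.
by apply: (eq_Ck oU) IH => x _; rewrite big_cons (negbTE Pi).
Qed.

End Ck.

Section CkScalar.
Implicit Types f g : 'rV[R]_m -> R.

Lemma CkM k U f g : open U -> Ck k U f -> Ck k U g ->
  Ck k U (fun x => f x * g x).
Proof.
move=> oU; elim: k f g => [|k IH] f g Cf Cg.
  by split=> // x Ux; apply: differentiableM; apply: (Ck_differentiable _ Ux); eassumption.
split=> [x Ux|i]; first by apply: differentiableM; apply: (Ck_differentiable _ Ux); eassumption.
have Cfg : Ck k U (fun x => f x * partial i g x + g x * partial i f x).
  by apply: CkD => //; apply: IH; try exact: Ck_partial; exact: Ck_pred.
apply: eq_Ck Cfg => // x Ux.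
by rewrite partialM//; apply: (Ck_differentiable _ Ux); eassumption.
Qed.

Lemma Ck_prod k U (I : Type) (r : seq I) (P : pred I) (F : I -> 'rV[R]_m -> R) :
  open U -> (forall i, P i -> Ck k U (F i)) ->
  Ck k U (fun x => \prod_(i <- r | P i) F i x).
Proof.
move=> oU CF; elim: r => [|i r IH].
  by apply: (eq_Ck oU) (Ck_cst k U (1 : R)) => x _; rewrite big_nil.
case: (boolP (P i)) => Pi.
  apply: (eq_Ck oU) (CkM oU (CF i Pi) IH) => x _.
  by rewrite big_cons Pi.
by apply: (eq_Ck oU) IH => x _; rewrite big_cons (negbTE Pi).
Qed.

Lemma CkV k U f : open U -> (forall x, U x -> f x != 0) -> Ck k U f ->
  Ck k U (fun x => (f x)^-1).
Proof.
move=> oU f0; elim: k f f0 => [|k IH] f f0 Cf.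
  by split=> // x Ux; apply: differentiableV; [apply: (Ck_differentiable _ Ux); eassumption|exact: f0].
split=> [x Ux|i].
  by apply: differentiableV; [apply: (Ck_differentiable _ Ux); eassumption|exact: f0].
have CV : Ck k U (fun x => (f x)^-1) by apply: IH => //; exact: Ck_pred.
have CVf : Ck k U (fun x => - ((f x)^-1 * (f x)^-1 * partial i f x)).
  by apply: CkN => //; apply: CkM => //; [exact: CkM|exact: Ck_partial].
apply: eq_Ck CVf => // x Ux.
rewrite partialV ?f0//; last by apply: (Ck_differentiable _ Ux); eassumption.
by rewrite mulNr expr2 invfM.
Qed.

Lemma Ck_coordinate k U i : open U -> Ck k U (fun x : 'rV[R]_m => x 0 i).
Proof.
have d x : differentiable (fun x : 'rV[R]_m => x 0 i) x by exact: differentiable_coord.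
move=> oU; case: k => [|k]; split=> // j.
have -> : partial j (fun x : 'rV[R]_m => x 0 i : R) =
    fun=> (delta_mx 0 j : 'rV[R]_m) 0 i.
  by apply/funext => x; rewrite -(partial_coord _ _ (f := id))// /partial derive_id.
exact: Ck_cst.
Qed.
End CkScalar.
End Partial.

(** * Compositions *)

Section Composition.
Context {R : realType} {m : nat}.
Implicit Types (x : 'rV[R]_m) (U : set 'rV[R]_m).

Lemma differentiable_bigsum {W : normedModType R} n (F : 'I_n -> 'rV[R]_m -> W) x :
  (forall j, differentiable (F j) x) ->
  differentiable (fun y => \sum_j F j y) x.
Proof.
move=> dF; suff -> : (fun y => \sum_j F j y) = \sum_j F j.
  exact: differentiable_sum.
by apply/funext => y; rewrite fct_sumE.
Qed.

Lemma partial_bigsum {W : normedModType R} n (F : 'I_n -> 'rV[R]_m -> W) i x :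
  (forall j, differentiable (F j) x) ->
  partial i (fun y => \sum_j F j y) x = \sum_j partial i (F j) x.
Proof.
move=> dF; suff -> : (fun y => \sum_j F j y) = \sum_j F j.
  by apply: derive_sum => j; exact: diff_derivable.
by apply/funext => y; rewrite fct_sumE.
Qed.

Lemma partial_comp {W : normedModType R} n (g : 'rV[R]_m -> 'rV[R]_n)
    (f : 'rV[R]_n -> W) i x :
  differentiable g x -> differentiable f (g x) ->
  partial i (f \o g) x = \sum_j partial i g x 0 j *: partial j f (g x).
Proof.
move=> dg df; rewrite partialE; last exact: differentiable_comp.
by rewrite diff_comp//= -partialE// diff_partial.
Qed.

Lemma partial_comp1 (g : 'rV[R]_m -> R) (h : R -> R) i x dh :
  differentiable g x -> is_derive (g x) 1 h dh ->
  partial i (fun y => h (g y)) x = dh * partial i g x.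
Proof.
move=> dg [/derivable1_diffP dh1 dhE].
rewrite partialE; last exact: (differentiable_comp (f := g)).
rewrite (diff_comp (f := g))//= -partialE//.
by rewrite -[X in 'd h _ X]mulr1 [LHS]linearZ/= -deriveE// dhE mulrC.
Qed.

Lemma differentiable_comp1 (g : 'rV[R]_m -> R) (h : R -> R) x dh :
  differentiable g x -> is_derive (g x) 1 h dh ->
  differentiable (fun y => h (g y)) x.
Proof.
by move=> dg [/derivable1_diffP dh1 _]; exact: (differentiable_comp (f := g)).
Qed.

Lemma Ck_rowP k n U (f : 'rV[R]_m -> 'rV[R]_n) : open U ->
  Ck k U f <-> (forall j, Ck k U (fun x => f x 0 j)).
Proof.
move=> oU; split.
  elim: k f => [|k IH] f Cf j.
    split=> // x Ux; apply: (differentiable_rowP _ _).1.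
    by apply: (Ck_differentiable _ Ux); eassumption.
  split=> [x Ux|i].
    apply: (differentiable_rowP _ _).1.
    by apply: (Ck_differentiable _ Ux); eassumption.
  apply: (eq_Ck oU) (IH _ (Ck_partial i Cf) j) => x Ux.
  by rewrite partial_coord//; apply: (Ck_differentiable _ Ux); eassumption.
elim: k f => [|k IH] f Cf.
  by split=> // x Ux; apply/differentiable_rowP => j; exact: Ck_differentiable (Cf j) _.
have df x : U x -> differentiable f x.
  by move=> Ux; apply/differentiable_rowP => j; exact: Ck_differentiable (Cf j) _.
split=> // i; apply: IH => j.
apply: (eq_Ck oU) (Ck_partial i (Cf j)) => x Ux.
by rewrite partial_coord//; exact: df.
Qed.

Lemma Ck_scale k n U (a : 'rV[R]_m -> R) (f : 'rV[R]_m -> 'rV[R]_n) : open U ->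
  Ck k U a -> Ck k U f -> Ck k U (fun x => a x *: f x).
Proof.
move=> oU Ca Cf; apply/Ck_rowP => // j.
apply: (eq_Ck oU) (CkM oU Ca ((Ck_rowP _ _ oU).1 Cf j)) => x _.
by rewrite mxE.
Qed.

(** Each of the two functions occurs in the derivative of the other one. *)
Lemma Ck_cos_sin k U (f : 'rV[R]_m -> R) : open U -> Ck k U f ->
  Ck k U (fun x => cos (f x)) /\ Ck k U (fun x => sin (f x)).
Proof.
move=> oU; elim: k => [|k IH] Cf.
  split; split=> // x Ux; have dfx := Ck_differentiable Cf Ux.
    exact: differentiable_comp1 (is_derive_cos _).
  exact: differentiable_comp1 (is_derive_sin _).
have [Cc Cs] := IH (Ck_pred Cf).
split; split=> [x Ux|i].
- exact: differentiable_comp1 (Ck_differentiable Cf Ux) (is_derive_cos _).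
- apply: (eq_Ck oU) (CkM oU (CkN oU Cs) (Ck_partial i Cf)) => x Ux.
  by rewrite (partial_comp1 _ (Ck_differentiable Cf Ux) (is_derive_cos _)).
- exact: differentiable_comp1 (Ck_differentiable Cf Ux) (is_derive_sin _).
- apply: (eq_Ck oU) (CkM oU Cc (Ck_partial i Cf)) => x Ux.
  by rewrite (partial_comp1 _ (Ck_differentiable Cf Ux) (is_derive_sin _)).
Qed.

Lemma Ck_sqrt k U (f : 'rV[R]_m -> R) : open U -> (forall x, U x -> 0 < f x) ->
  Ck k U f -> Ck k U (fun x => Num.sqrt (f x)).
Proof.
move=> oU f0; elim: k => [|k IH] Cf.
  split=> // x Ux.
  exact: differentiable_comp1 (Ck_differentiable Cf Ux) (is_derive1_sqrt (f0 _ Ux)).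
split=> [x Ux|i].
  exact: differentiable_comp1 (Ck_differentiable Cf Ux) (is_derive1_sqrt (f0 _ Ux)).
have C2 : Ck k U (fun x => 2 * Num.sqrt (f x)).
  by apply: CkM => //; [exact: Ck_cst|exact/IH/Ck_pred].
have C3 : Ck k U (fun x => (2 * Num.sqrt (f x))^-1).
  by apply: CkV => // x Ux; rewrite mulf_neq0// gt_eqF// sqrtr_gt0 f0.
apply: (eq_Ck oU) (CkM oU C3 (Ck_partial i Cf)) => x Ux.
by rewrite (partial_comp1 _ (Ck_differentiable Cf Ux) (is_derive1_sqrt (f0 _ Ux))).
Qed.

End Composition.

Lemma Ck_comp {R : realType} k m n U (V : set 'rV[R]_n)
    (g : 'rV[R]_m -> 'rV[R]_n) (f : 'rV[R]_n -> R) : open U ->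
  (forall x, U x -> V (g x)) -> Ck k U g -> Ck k V f -> Ck k U (f \o g).
Proof.
move=> oU gV; elim: k f => [|k IH] f Cg Cf.
  split=> // x Ux; apply: differentiable_comp; first exact: Ck_differentiable Cg Ux.
  by apply: Ck_differentiable Cf _; exact: gV.
split=> [x Ux|i].
  apply: differentiable_comp; first exact: Ck_differentiable Cg Ux.
  by apply: Ck_differentiable Cf _; exact: gV.
have C1 : Ck k U (fun x => \sum_j partial i g x 0 j * partial j f (g x)).
  apply: Ck_sum => // j _; apply: CkM => //.
    exact: (Ck_rowP _ _ oU).1 (Ck_partial i Cg) j.
  exact: (IH _ (Ck_pred Cg) (Ck_partial j Cf)).
apply: (eq_Ck oU) C1 => x Ux; rewrite [RHS]partial_comp; [by []|exact: Ck_differentiable Cg Ux|].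
by apply: Ck_differentiable Cf _; exact: gV.
Qed.

Lemma smooth_comp {R : realType} m n p U (V : set 'rV[R]_n)
    (g : 'rV[R]_m -> 'rV[R]_n) (f : 'rV[R]_n -> 'rV[R]_p) : open U -> open V ->
  (forall x, U x -> V (g x)) -> smooth_on U g -> smooth_on V f ->
  smooth_on U (f \o g).
Proof.
move=> oU oV gV /smooth_onP Sg /smooth_onP Sf; apply/smooth_onP => k.
apply/Ck_rowP => // j; apply: (Ck_comp oU gV (Sg k)) ((Ck_rowP _ _ oV).1 (Sf k) j).
Qed.

Section SmoothOn.
Context {R : realType} {m : nat} {W : normedModType R}.
Implicit Types (U : set 'rV[R]_m) (f : 'rV[R]_m -> W).

Lemma smooth_differentiable U f x : smooth_on U f -> U x -> differentiable f x.
Proof. by move=> Sf; exact: (Sf [::]). Qed.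

Lemma smooth_partial U f i : smooth_on U f -> smooth_on U (partial i f).
Proof. by move=> /smooth_onP Sf; apply/smooth_onP => k; exact: Ck_partial. Qed.

Lemma sub_smooth U V f : V `<=` U -> smooth_on U f -> smooth_on V f.
Proof. by move=> VU Sf s x /VU; exact: Sf. Qed.

End SmoothOn.

(** * The Euclidean inner product *)

Section Inner.
Context {R : realType}.
Implicit Types u v w : 'rV[R]_5.

Lemma innerC u v : inner u v = inner v u.
Proof. by apply: eq_bigr => i _; rewrite mulrC. Qed.

Lemma innerDl u v w : inner (u + v) w = inner u w + inner v w.
Proof. by rewrite /inner -big_split; apply: eq_bigr => i _; rewrite mxE mulrDl. Qed.

Lemma innerZl a u w : inner (a *: u) w = a * inner u w.
Proof. by rewrite /inner mulr_sumr; apply: eq_bigr => i _; rewrite mxE mulrA. Qed.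

Lemma innerNl u w : inner (- u) w = - inner u w.
Proof. by rewrite -scaleN1r innerZl mulN1r. Qed.

Lemma innerBl u v w : inner (u - v) w = inner u w - inner v w.
Proof. by rewrite innerDl innerNl. Qed.

Lemma inner0l w : inner 0 w = 0.
Proof. by rewrite -(scale0r 0) innerZl mul0r. Qed.

Lemma innerDr u v w : inner w (u + v) = inner w u + inner w v.
Proof. by rewrite innerC innerDl !(innerC w). Qed.

Lemma innerZr a u w : inner w (a *: u) = a * inner w u.
Proof. by rewrite innerC innerZl innerC. Qed.

Lemma innerNr u w : inner w (- u) = - inner w u.
Proof. by rewrite innerC innerNl innerC. Qed.

Lemma innerBr u v w : inner w (u - v) = inner w u - inner w v.
Proof. by rewrite innerDr innerNr. Qed.

Lemma inner0r w : inner w 0 = 0.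
Proof. by rewrite innerC inner0l. Qed.

Lemma inner_suml (I : Type) (r : seq I) (P : pred I) (F : I -> 'rV[R]_5) w :
  inner (\sum_(i <- r | P i) F i) w = \sum_(i <- r | P i) inner (F i) w.
Proof.
by elim/big_rec2: _ => [|i y x _ <-]; [exact: inner0l|rewrite innerDl].
Qed.

Lemma inner_ge0 u : 0 <= inner u u.
Proof. by apply: sumr_ge0 => i _; rewrite -expr2 sqr_ge0. Qed.

Lemma inner_eq0 u : inner u u = 0 -> u = 0.
Proof.
move=> u0; apply/rowP => i; rewrite mxE; apply/eqP; rewrite -sqrf_eq0 expr2.
apply/eqP; apply: (psumr_eq0P _ u0) => // j _; by rewrite -expr2 sqr_ge0.
Qed.

Lemma inner_gt0 u : u != 0 -> 0 < inner u u.
Proof.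
move=> u0; rewrite lt_def inner_ge0 andbT; apply: contra_neq u0; exact: inner_eq0.
Qed.

Definition inner_linear := (innerDl, innerDr, innerBl, innerBr, innerNl, innerNr,
  innerZl, innerZr, inner0l, inner0r).

Lemma inner_mulmx u v : u *m v^T = (inner u v)%:M.
Proof.
apply/matrixP => i j; rewrite !ord1 mxE [RHS]mxE eqxx mulr1n.
by apply: eq_bigr => k _; rewrite [v^T _ _]mxE.
Qed.

Context {m : nat}.
Implicit Types f g : 'rV[R]_m -> 'rV[R]_5.

Lemma differentiable_inner f g x : differentiable f x -> differentiable g x ->
  differentiable (fun y => inner (f y) (g y)) x.
Proof.
move=> /differentiable_rowP df /differentiable_rowP dg.
apply: (differentiable_bigsum (F := fun i y => f y 0 i * g y 0 i)) => i.
exact: differentiableM.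
Qed.

Lemma partial_inner i f g x : differentiable f x -> differentiable g x ->
  partial i (fun y => inner (f y) (g y)) x =
  inner (partial i f x) (g x) + inner (f x) (partial i g x).
Proof.
move=> df dg; have dfj := (differentiable_rowP _ _).1 df.
have dgj := (differentiable_rowP _ _).1 dg.
rewrite (partial_bigsum (F := fun j y => f y 0 j * g y 0 j)); last first.
  by move=> j; exact: differentiableM.
rewrite -big_split; apply: eq_bigr => j _ /=.
rewrite partialM; [|exact: dfj|exact: dgj].
by rewrite !partial_coord// addrC; congr (_ + _); exact: mulrC.
Qed.

Lemma Ck_inner k U f g : open U -> Ck k U f -> Ck k U g ->
  Ck k U (fun y => inner (f y) (g y)).
Proof.
move=> oU Cf Cg; apply: Ck_sum => // i _.
by apply: CkM => //; move: i; apply/Ck_rowP.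
Qed.

End Inner.

(** * Mean values *)

Section MeanValue.
Context {R : realType} {m : nat}.
Implicit Types (x y z : 'rV[R]_m).

Lemma norm_rowP n (v : 'rV[R]_n) (e : R) : 0 <= e ->
  (forall j, `|v 0 j| <= e) -> `|v| <= e.
Proof.
move=> e0 ve; rewrite [leLHS]/Num.Def.normr/= mx_normrE.
by apply: bigmax_le => // -[i j] _ /=; rewrite ord1.
Qed.

Lemma norm_coord n (v : 'rV[R]_n) j : `|v 0 j| <= `|v|.
Proof.
rewrite [leRHS]/Num.Def.normr/= mx_normrE.
exact: (le_bigmax _ (fun ij : 'I_1 * 'I_n => `|v ij.1 ij.2|) (0, j)).
Qed.

Lemma norm_delta (i : 'I_m) : `|delta_mx 0 i : 'rV[R]_m| <= 1.
Proof.
apply: norm_rowP => // j; rewrite mxE eqxx/=.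
by case: eqP; rewrite ?normr1 ?normr0.
Qed.

Lemma ball_segment z (r : R) x y (t : R) : ball z r x -> ball z r y ->
  0 <= t <= 1 -> ball z r (x + t *: (y - x)).
Proof.
rewrite -!ball_normE/= => xz yz /andP[t0 t1].
have -> : z - (x + t *: (y - x)) = (1 - t) *: (z - x) + t *: (z - y).
  by apply/rowP => i; rewrite !mxE; ring.
apply: le_lt_trans (ler_normD _ _) _; rewrite !normrZ.
rewrite (ger0_norm t0) ger0_norm ?subr_ge0//.
have [->|tn0] := eqVneq t 0; first by rewrite subr0 mul1r mul0r addr0.
have t0' : 0 < t by rewrite lt_def tn0.
have -> : r = (1 - t) * r + t * r by ring.
apply: ler_ltD; first by rewrite ler_wpM2l ?subr_ge0// ltW.
by rewrite ltr_pM2l.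
Qed.

(** The one-variable theorem on the segment from [x] to [y]. *)
Lemma mean_value (f : 'rV[R]_m -> R) z r x y :
  (forall w, ball z r w -> differentiable f w) -> ball z r x -> ball z r y ->
  exists2 w, ball z r w & f y - f x = \sum_i (y - x) 0 i * partial i f w.
Proof.
move=> df zx zy.
pose p : R -> 'rV[R]_m := cst x + ( *:%R^~ (y - x)).
have pE (t : R) : p t = x + t *: (y - x) by [].
have dp (t : R) : is_diff t p (0 + ( *:%R^~ (y - x))) by exact: is_diffD.
have zp (t : R) : 0 <= t <= 1 -> ball z r (p t) by rewrite pE; exact: ball_segment.
have dg (t : R) : 0 <= t <= 1 -> is_derive t 1 (f \o p) ('d f (p t) (y - x)).
  move=> t01; have dfp := df _ (zp _ t01).
  have dpt : differentiable p t by have [] := dp t.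
  have dfpt : differentiable (f \o p) t by exact: differentiable_comp.
  apply: DeriveDef; first exact: diff_derivable.
  rewrite deriveE// diff_comp//=; congr ('d f _ _).
  by have [_ ->] := dp t; rewrite fctE add0r scale1r.
have [|||t] := @MVT_segment R (f \o p) (fun t => 'd f (p t) (y - x)) 0 1.
- exact: ler01.
- by move=> t; rewrite in_itv/= => /andP[t0 t1]; apply: dg; rewrite (ltW t0) (ltW t1).
- apply: continuous_in_subspaceT => t; rewrite inE/= in_itv/= => t01.
  apply: differentiable_continuous; apply/derivable1_diffP.
  by have [] := dg t t01.
rewrite in_itv/= => t01; rewrite /= !pE scale1r scale0r addr0 [x + _]addrC subrK subr0 mulr1.
move=> fE; exists (p t); first exact: zp.
by rewrite fE diff_partial//; exact/df/zp.
Qed.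

Lemma constant_on_ball n (f : 'rV[R]_m -> 'rV[R]_n) z r x :
  (forall w, ball z r w -> differentiable f w) ->
  (forall w i, ball z r w -> partial i f w = 0) ->
  0 < r -> ball z r x -> f x = f z.
Proof.
move=> df pf r0 zx; apply/rowP => j; apply/eqP; rewrite -subr_eq0; apply/eqP.
have dfj w : ball z r w -> differentiable (fun y => f y 0 j) w.
  by move=> zw; apply: (differentiable_rowP _ _).1; exact: df.
have [w zw ->] := mean_value dfj (ballxx _ r0) zx.
by rewrite big1// => i _; rewrite -partial_coord ?pf ?mxE ?mulr0//; exact: df.
Qed.

Lemma constant_on_ball1 (f : 'rV[R]_m -> R) z r x :
  (forall w, ball z r w -> differentiable f w) ->
  (forall w i, ball z r w -> partial i f w = 0) ->
  0 < r -> ball z r x -> f x = f z.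
Proof.
move=> df pf r0 zx; apply/eqP; rewrite -subr_eq0; apply/eqP.
have [w zw ->] := mean_value df (ballxx _ r0) zx.
by rewrite big1// => i _; rewrite pf// mulr0.
Qed.

Lemma lipschitz_on_ball n (f : 'rV[R]_m -> 'rV[R]_n) z r (K : R) x y :
  (forall w, ball z r w -> differentiable f w) ->
  (forall w i, ball z r w -> `|partial i f w| <= K) ->
  ball z r x -> ball z r y -> `|f y - f x| <= m%:R * K * `|y - x|.
Proof.
move=> df pf zx zy.
have K0 : 0 <= m%:R * K * `|y - x|.
  case: (m) x y f z zx zy df pf => [|k] x y f z zx zy df pf; first by rewrite !mul0r.
  by rewrite !mulr_ge0//; apply: le_trans (pf x ord0 zx).
apply: norm_rowP => // j; rewrite !mxE.
have dfj w : ball z r w -> differentiable (fun y => f y 0 j) w.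
  by move=> zw; apply: (differentiable_rowP _ _).1; exact: df.
have [w zw ->] := mean_value dfj zx zy.
apply: le_trans (ler_norm_sum _ _ _) _.
have -> : m%:R * K * `|y - x| = \sum_(i < m) K * `|y - x|.
  by rewrite sumr_const card_ord -mulrA mulr_natl.
apply: ler_sum => i _.
rewrite normrM mulrC -partial_coord; last exact: df.
apply: ler_pM => //; first exact: le_trans (norm_coord _ _) (pf _ _ zw).
exact: norm_coord.
Qed.

End MeanValue.

(** * Symmetry of second derivatives *)

Section Shift.
Context {R : realType} {m : nat}.
Implicit Types (x : 'rV[R]_m) (f : 'rV[R]_m -> R).

Lemma differentiable_shift f a x : differentiable f (x + a) ->
  differentiable (fun y => f (y + a)) x.
Proof.
by move=> df; exact: (differentiable_comp (f := fun y => y + a) (g := f)).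
Qed.

Lemma partial_shift i f a x : partial i (fun y => f (y + a)) x = partial i f (x + a).
Proof.
pose e : 'rV[R]_m := delta_mx 0 i.
suff E : (fun h : R => h^-1 *: (((fun y => f (y + a)) \o shift x) (h *: e)
      - f (x + a))) =
    (fun h : R => h^-1 *: ((f \o shift (x + a)) (h *: e) - f (x + a))).
  by rewrite /partial /derive -E.
by apply/funext => h /=; rewrite addrA.
Qed.

End Shift.

#[local] Opaque partial.

Section SymmetricDerivatives.
Context {R : realType} {m : nat}.
Implicit Types (x : 'rV[R]_m) (f : 'rV[R]_m -> R).

(** Both sides are the same second difference of [f], computed by applying the
    mean value theorem to the two increments in either order. *)
Lemma second_difference f x (r h : R) i j : 0 < h -> h + h < r ->
  (forall w, ball x r w -> differentiable f w) ->
  (forall w k, ball x r w -> differentiable (partial k f) w) ->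
  exists w, ball x r w /\
    f (x + h *: delta_mx 0 i + h *: delta_mx 0 j) - f (x + h *: delta_mx 0 i)
      - (f (x + h *: delta_mx 0 j) - f x) =
    h * h * partial j (partial i f) w.
Proof.
move=> h0 hr df dpf; set ei := h *: delta_mx 0 i; set ej := h *: delta_mx 0 j.
have norm_e k : `|h *: delta_mx 0 k : 'rV[R]_m| <= h.
  by rewrite normrZ gtr0_norm// ler_piMr// ?norm_delta// ltW.
have ballD w k s : ball x s w -> ball x (s + h) (w + h *: delta_mx 0 k).
  rewrite -!ball_normE/= opprD addrA => xw.
  by apply: le_lt_trans (ler_normB _ _) _; rewrite ltr_leD// norm_e.
have rh : 0 < r - h by rewrite subr_gt0 (lt_trans _ hr)// ltrDl.
have sub_ball w : ball x (r - h) w -> ball x r w.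
  by apply: le_ball; rewrite gerBl ltW.
have xe k : ball x (r - h) (x + h *: delta_mx 0 k).
  rewrite -ball_normE/= opprD addrA subrr sub0r normrN.
  by apply: le_lt_trans (norm_e k) _; rewrite ltrBrDr.
have sumE k (F : 'I_m -> R) : \sum_l (h *: delta_mx 0 k : 'rV[R]_m) 0 l * F l = h * F k.
  rewrite (bigD1 k)//= big1 ?addr0 => [|l lk]; rewrite !mxE eqxx/=; first by rewrite eqxx mulr1.
  by rewrite (negbTE lk) mulr0 mul0r.
pose psi y := f (y + ej) - f y.
have dpsi w : ball x (r - h) w -> differentiable psi w.
  move=> xw; apply: differentiableB; last exact/df/sub_ball.
  by apply/differentiable_shift/df; rewrite -[r](subrK h); exact: ballD.
have [w xw E] := mean_value dpsi (ballxx _ rh) (xe i).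
have xwej : ball x r (w + ej) by rewrite -[r](subrK h); exact: ballD.
have [w' xw' E'] := mean_value (dpf^~ i) (sub_ball _ xw) xwej.
exists w'; split=> //; rewrite -[LHS]/(psi (x + ei) - psi x) E.
rewrite [x + _]addrC addrK sumE partialB; last 2 first.
  exact/differentiable_shift/df.
  exact/df/sub_ball.
by rewrite partial_shift E' [w + _]addrC addrK sumE mulrA.
Qed.

Lemma triangle_half (a b c d e : R) : d = c ->
  `|a - c| < e / 2 -> `|b - d| < e / 2 -> `|a - b| <= e.
Proof.
move=> -> ac bc; have -> : a - b = (a - c) - (b - c) by ring.
apply: le_trans (ler_normB _ _) _; rewrite [leRHS]splitr.
by apply: lerD; exact: ltW.
Qed.

(** The second differences of [second_difference] for both orders coincide, and the
    second derivatives are continuous. *)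
Lemma partial_symmetric U f x i j : open U -> U x -> Ck 2 U f ->
  partial i (partial j f) x = partial j (partial i f) x.
Proof.
move=> oU Ux Cf; have := open_nbhs_nbhs (conj oU Ux) => /nbhs_ballP[r0 /= r00 xU].
have cont k l : {for x, continuous (partial k (partial l f))}.
  apply: differentiable_continuous.
  exact: Ck_differentiable (Ck_partial k (Ck_partial l Cf)) Ux.
apply/eqP; rewrite -subr_eq0 -normr_le0; apply/ler_addgt0Pl => e e0.
rewrite addr0; have e20 : 0 < e / 2 by rewrite divr_gt0.
have near2 k l : exists2 s, 0 < s & forall w, ball x s w ->
    `|partial k (partial l f) x - partial k (partial l f) w| < e / 2.
  have /cvgrPdist_lt/(_ _ e20) := cont k l.
  by move=> /nbhs_ballP[s /= s0 xs]; exists s.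
have [s1 s10 xs1] := near2 i j; have [s2 s20 xs2] := near2 j i.
pose r := Order.min r0 (Order.min s1 s2).
have r_gt0 : 0 < r by rewrite !lt_min r00 s10 s20.
have [rr0 rs1 rs2] : [/\ r <= r0, r <= s1 & r <= s2].
  by rewrite /r; split; rewrite !ge_min lexx ?orbT.
have h0 : 0 < r / 4 by rewrite divr_gt0.
have hr : r / 4 + r / 4 < r by lra.
have df w : ball x r w -> differentiable f w.
  by move=> xw; apply: (Ck_differentiable Cf); apply/xU/(le_ball rr0).
have dpf w k : ball x r w -> differentiable (partial k f) w.
  move=> xw; apply: (Ck_differentiable (Ck_partial k Cf)); apply/xU/(le_ball rr0).
  exact: xw.
have [w [xw Ew]] := second_difference i j h0 hr df dpf.
have [w' [xw' Ew']] := second_difference j i h0 hr df dpf.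
have E : partial j (partial i f) w = partial i (partial j f) w'.
  have hh : r / 4 * (r / 4) != 0 by rewrite mulf_neq0 ?gt_eqF.
  have cancel (a b u v : R) : u = r / 4 * (r / 4) * a ->
    v = r / 4 * (r / 4) * b -> u = v -> a = b by move=> -> -> /(mulfI hh).
  by apply: cancel Ew Ew' _; rewrite [x + _ + _]addrAC; ring.
have /(_ _ (le_ball rs1 xw')) l1 := xs1.
have /(_ _ (le_ball rs2 xw)) l2 := xs2.
exact: triangle_half E l1 l2.
Qed.

Lemma partial_symmetric_row n U (f : 'rV[R]_m -> 'rV[R]_n) x i j :
  open U -> U x -> smooth_on U f ->
  partial i (partial j f) x = partial j (partial i f) x.
Proof.
move=> oU Ux Sf; apply/rowP => k.
have dpf l y : U y -> differentiable (partial l f) y.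
  by move=> Uy; exact: (smooth_differentiable (smooth_partial l Sf)).
have E a b : partial a (partial b f) x 0 k =
    partial a (partial b (fun y => f y 0 k)) x.
  rewrite partial_coord; last exact: dpf.
  apply: (eq_partial _ oU Ux) => y Uy; rewrite partial_coord//.
  exact: smooth_differentiable Sf Uy.
apply: etrans (E i j) (etrans _ (esym (E j i))).
apply: (partial_symmetric _ _ oU Ux).
by move/smooth_onP: Sf => Sf; exact: (Ck_rowP _ _ oU).1 (Sf 2%N) k.
Qed.

End SymmetricDerivatives.

(** * The inverse function theorem *)

Section Determinant.
Context {R : realType} {m : nat}.

Lemma Ck_det k n (U : set 'rV[R]_m) (M : 'rV[R]_m -> 'M[R]_n) : open U ->
  (forall i j, Ck k U (fun x => M x i j)) -> Ck k U (fun x => \det (M x)).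
Proof.
move=> oU CM; apply: Ck_sum => // s _; apply: CkM => //; first exact: Ck_cst.
exact: Ck_prod.
Qed.

Lemma Ck_invmx k n (U : set 'rV[R]_m) (M : 'rV[R]_m -> 'M[R]_n) i j : open U ->
  (forall i j, Ck k U (fun x => M x i j)) ->
  (forall x, U x -> M x \in unitmx) -> Ck k U (fun x => invmx (M x) i j).
Proof.
move=> oU CM uM.
have Cdet : Ck k U (fun x => (\det (M x))^-1).
  apply: CkV => //; last exact: Ck_det.
  by move=> x /uM; rewrite unitmxE unitfE.
have Ccof : Ck k U (fun x => cofactor (M x) j i).
  apply: CkM => //; first exact: Ck_cst.
  apply: Ck_det => // a b.
  apply: (eq_Ck oU) (CM (lift j a) (lift i b)) => x _.
  by rewrite !mxE.
apply: (eq_Ck oU) (CkM oU Cdet Ccof) => x Ux.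
by rewrite /invmx uM// !mxE.
Qed.

End Determinant.

Section Jacobian.
Context {R : realType} {m n : nat}.
Implicit Types (f : 'rV[R]_m -> 'rV[R]_n) (x : 'rV[R]_m).

Lemma jacobianE f x i j : differentiable f x ->
  jacobian f x i j = partial i f x 0 j.
Proof. by move=> df; rewrite partialE// /jacobian /lin1_mx mxE. Qed.

Lemma diff_jacobian f x v : 'd f x v = v *m jacobian f x.
Proof. by rewrite /jacobian mul_rV_lin1. Qed.

End Jacobian.

(** Row vectors with both their norm and their completeness, as the contraction
    principle requires. *)
Definition complete_row (R : realType) (n : nat) : completeNormedModType R :=
  HB.pack 'rV[R]_n (Uniform_isComplete.Build 'rV[R]_n cauchy_cvg).

Section InverseFunction.
Context {R : realType} {n : nat}.
Implicit Types (f g : 'rV[R]_n -> 'rV[R]_n) (x y : 'rV[R]_n) (A : 'M[R]_n).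

Lemma norm_mulmx A : exists2 C : R, 0 < C & forall v : 'rV[R]_n, `|v *m A| <= C * `|v|.
Proof.
have S0 : 0 <= \sum_i \sum_j `|A i j| by apply: sumr_ge0 => i _; exact: sumr_ge0.
exists (\sum_i \sum_j `|A i j| + 1); first by rewrite ltr_wpDl.
move=> v; apply: norm_rowP => [|j]; first by rewrite mulr_ge0// addr_ge0.
rewrite mxE; apply: le_trans (ler_norm_sum _ _ _) _.
apply: (@le_trans _ _ (\sum_i `|A i j| * `|v|)).
  by apply: ler_sum => i _; rewrite normrM mulrC ler_wpM2l// norm_coord.
rewrite -mulr_suml ler_wpM2r// -[leLHS]addr0 lerD//.
by apply: ler_sum => i _; rewrite (bigD1 j)//= lerDl sumr_ge0.
Qed.

Section NearIdentity.
Variables (g : 'rV[R]_n -> 'rV[R]_n) (x0 : 'rV[R]_n) (r : R).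
Hypothesis r0 : 0 < r.
Hypothesis g_near_id : forall x y, ball x0 r x -> ball x0 r y ->
  `|(x - g x) - (y - g y)| <= 2^-1 * `|x - y|.

(** The difference [x - g x] is a contraction, so [g] cannot shrink distances by
    more than a half. *)
Lemma near_id_expanding x y : ball x0 r x -> ball x0 r y ->
  `|x - y| <= 2 * `|g x - g y|.
Proof.
move=> bx by_; have le := g_near_id bx by_.
have : `|x - y| <= `|(x - g x) - (y - g y)| + `|g x - g y|.
  apply: le_trans _ (ler_normD _ _); rewrite le_eqVlt; apply/orP; left; apply/eqP.
  by congr (`|_|); apply/rowP => i; rewrite !mxE; ring.
by lra.
Qed.

(** The solution of [g x = y] is the fixed point of the contraction
    [x |-> x - g x + y]. *)
Lemma near_id_surjective y : ball (g x0) (r / 4) y ->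
  exists2 x, ball x0 r x & g x = y.
Proof.
rewrite -{1}ball_normE/= => gy; pose C := closed_ball x0 (r / 2).
have r20 : 0 < r / 2 by rewrite divr_gt0.
have CE x : C x <-> `|x0 - x| <= r / 2 by rewrite /C closed_ballE.
have Cball x : C x -> ball x0 r x.
  by move=> /CE xC; rewrite -ball_normE/=; apply: le_lt_trans xC _; lra.
pose G x := x - g x + y.
have GC : {homo G : x / C x >-> C x}.
  move=> x Cx; apply/CE; have le := g_near_id (Cball _ Cx) (ballxx _ r0).
  have -> : x0 - G x = (g x0 - y) - ((x - g x) - (x0 - g x0)).
    by apply/rowP => i; rewrite !mxE; ring.
  apply: le_trans (ler_normB _ _) _.
  by move/CE: Cx; rewrite distrC => Cx; lra.
have [|||x Cx Gx] := @banach_fixed_point R (complete_row R n) C (mkfun GC).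
- exists (2^-1)%:nng; split=> /=; first by lra.
  move=> [x x'] [/= Cx Cx']; have := g_near_id (Cball _ Cx) (Cball _ Cx').
  by apply: le_trans; rewrite /mkfun /G opprD addrACA subrr addr0.
- exact: closed_ball_closed.
- by exists x0; apply/CE; rewrite subrr normr0 ltW.
exists x; first exact: (Cball x Cx).
have : x = x - g x + y := Gx.
by move=> /(congr1 (fun z => z - x + g x)); rewrite subrr add0r => ->; apply/rowP => i; rewrite !mxE; ring.
Qed.

End NearIdentity.

End InverseFunction.

Section InverseFunctionTheorem.
Context {R : realType} {n : nat}.
Implicit Types (f g : 'rV[R]_n -> 'rV[R]_n) (x y : 'rV[R]_n) (A : 'M[R]_n).

Lemma differentiable_mulmx p (A : 'M[R]_(n, p)) x :
  differentiable (fun v : 'rV[R]_n => v *m A) x.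
Proof.
apply/differentiable_rowP => j.
have -> : (fun v : 'rV[R]_n => (v *m A) 0 j) = fun v => \sum_i v 0 i * A i j.
  by apply/funext => v; rewrite mxE.
apply: differentiable_bigsum => i; apply: differentiableM => //.
exact: differentiable_coord.
Qed.

Lemma mulmx_continuous p (A : 'M[R]_(n, p)) : continuous (fun v : 'rV[R]_n => v *m A).
Proof. by move=> v; exact/differentiable_continuous/differentiable_mulmx. Qed.

Lemma is_diff_mulmx p (A : 'M[R]_(n, p)) x :
  is_diff x (fun v : 'rV[R]_n => v *m A) (fun v => v *m A).
Proof.
apply: DiffDef; first exact: differentiable_mulmx.
by apply: (@diff_lin _ _ _ (@mulmxr R 1 n p A)); exact: mulmx_continuous.
Qed.

(** If [k] is the increment of [theta] for the increment [h] and [J] the derivative of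
    [f], then [k - h J^-1 = - (h - k J) J^-1], where [h - k J] is small compared to
    [k], and [k] is bounded by [L h]. *)
Lemma is_diff_inverse (f theta : 'rV[R]_n -> 'rV[R]_n) (V W : set 'rV[R]_n) y (L : R) :
  open V -> open W -> W y -> 0 < L ->
  (forall z, W z -> V (theta z) /\ f (theta z) = z) ->
  (forall x x', V x -> V x' -> `|x - x'| <= L * `|f x - f x'|) ->
  differentiable f (theta y) -> jacobian f (theta y) \in unitmx ->
  is_diff y theta (fun h => h *m invmx (jacobian f (theta y))).
Proof.
move=> oV oW Wy L0 thetaK fL df uJ; set J := jacobian f (theta y).
have [C C0 JC] := norm_mulmx (invmx J).
apply: (@is_diff_epsilon _ _ _ _ (@mulmxr R 1 n n (invmx J))).
  exact: mulmx_continuous.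
move=> e e0; have e'0 : 0 < e / (C * L) by rewrite divr_gt0// mulr_gt0.
have /nbhs_normP[d /= d0 dP] := diff_epsilon df e'0.
have Wy0 : \forall h \near (0 : 'rV[R]_n), W (h + y).
  have : \forall z \near y, W z by exact: open_nbhs_nbhs.
  by rewrite (near_shift 0) subr0.
have hd : \forall h \near (0 : 'rV[R]_n), `|h| < L^-1 * d.
  apply/(nbhs_normP (0 : 'rV[R]_n)); exists (L^-1 * d) => /= [|h].
    by rewrite mulr_gt0// invr_gt0.
  by rewrite /= sub0r normrN.
near=> h; have Wh : W (h + y) by near: h.
have [Vy fy] := thetaK _ Wy; have [Vh fh] := thetaK _ Wh.
set k := theta (h + y) - theta y.
have kL : `|k| <= L * `|h|.
  by apply: le_trans (fL _ _ Vh Vy) _; rewrite fy fh addrK.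
have kd : `|k| < d.
  apply: le_lt_trans kL _; rewrite -ltr_pdivlMl//.
  by near: h.
have /dP/= : ball_ Num.norm 0 d k by rewrite /= sub0r normrN.
rewrite diff_jacobian -/J subrK fh fy addrK => kJ.
have -> : k - h *m invmx J = - ((h - k *m J) *m invmx J).
  by rewrite mulmxBl mulmxK// opprB.
rewrite normrN; apply: le_trans (JC _) _.
apply: (@le_trans _ _ (C * (e / (C * L) * (L * `|h|)))).
  rewrite ler_pM2l//; apply: le_trans kJ _.
  by rewrite ler_pM2l.
have -> // : C * (e / (C * L) * (L * `|h|)) = e * `|h|.
by field; rewrite !gt_eqF.
Unshelve. all: by end_near. Qed.

Lemma Ck_jacobian k U f i j : open U -> Ck k.+1 U f ->
  Ck k U (fun x => jacobian f x i j).
Proof.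
move=> oU Cf; apply: (eq_Ck oU) ((Ck_rowP _ _ oU).1 (Ck_partial i Cf) j) => x Ux.
by rewrite jacobianE//; exact: Ck_differentiable Cf Ux.
Qed.

(** By [is_diff_inverse] the derivative of the inverse is an expression of
    class C^k in the inverse itself, so its smoothness follows by induction. *)
Lemma smooth_inverse (f theta : 'rV[R]_n -> 'rV[R]_n) (V W : set 'rV[R]_n) (L : R) :
  open V -> open W -> 0 < L ->
  (forall z, W z -> V (theta z) /\ f (theta z) = z) ->
  (forall x x', V x -> V x' -> `|x - x'| <= L * `|f x - f x'|) ->
  smooth_on V f -> (forall x, V x -> jacobian f x \in unitmx) ->
  smooth_on W theta.
Proof.
move=> oV oW L0 thetaK fL Sf uJ.
have dtheta y (Wy : W y) : is_diff y theta (fun h => h *m invmx (jacobian f (theta y))).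
  have [Vy _] := thetaK _ Wy.
  apply: (is_diff_inverse oV oW Wy L0) => //; last exact: uJ.
  exact: smooth_differentiable Sf Vy.
have diff_theta y : W y -> differentiable theta y by move=> /dtheta [].
apply/smooth_onP; elim=> [|k IH]; first by split.
split=> // i; apply/Ck_rowP => // j.
have CJ : Ck k V (fun x => invmx (jacobian f x) i j).
  apply: Ck_invmx => // a b; apply: Ck_jacobian => //.
  by move/smooth_onP: Sf; exact.
have thetaV y : W y -> V (theta y) by move=> /thetaK [].
apply: (eq_Ck oW) (Ck_comp oW thetaV IH CJ) => y Wy /=.
rewrite partialE; last exact: diff_theta.
have [_ ->] := dtheta y Wy.
by rewrite -rowE mxE.
Qed.

(** After composition with the inverse of its derivative at [x0] the map is close
    to the identity near [x0]: it is expanding there, hence injective, and it is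
    onto a neighbourhood by [near_id_surjective]. *)
Theorem inverse_function_theorem (U : set 'rV[R]_n) f x0 :
  open U -> U x0 -> smooth_on U f -> jacobian f x0 \in unitmx ->
  exists V W theta, [/\ open V /\ open W, V x0 /\ V `<=` U,
    forall x, V x -> W (f x) /\ theta (f x) = x,
    forall y, W y -> V (theta y) /\ f (theta y) = y &
    smooth_on W theta].
Proof.
move=> oU Ux0 Sf uJ; set B := invmx (jacobian f x0).
pose g x := f x *m B; pose h x := x - g x.
have df x : U x -> differentiable f x by exact: smooth_differentiable.
have dg x : U x -> is_diff x g (fun v => 'd f x v *m B).
  move=> Ux; have := is_diff_mulmx B (f x); apply: is_diff_comp.
  exact/differentiableP/df.
have dh x : U x -> differentiable h x.
  by move=> Ux; apply: differentiableB => //; have [] := dg x Ux.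
have ph x i : U x -> partial i h x = delta_mx 0 i - partial i f x *m B.
  move=> Ux; have [dgx gE] := dg x Ux.
  have pg : partial i g x = partial i f x *m B.
    by rewrite partialE// gE partialE//; exact: df.
  have pid : partial i id x = delta_mx 0 i.
    by rewrite partialE//; have [_ ->] := is_diff_id x.
  by rewrite (@partialB _ _ _ i id g x)// pg pid.
have ph0 i : partial i h x0 = 0.
  have -> : partial i h x0 = delta_mx 0 i - delta_mx 0 i *m jacobian f x0 *m B.
    by rewrite ph// -diff_jacobian partialE//; exact: df.
  by rewrite mulmxK// subrr.
pose K : R := (2 * n.+1%:R)^-1.
have K0 : 0 < K by rewrite invr_gt0 mulr_gt0.
have [e /= e0 eP] : exists2 e : R, 0 < e & forall x, ball x0 e x ->
    [/\ U x, jacobian f x \in unitmx & forall i, `|partial i h x| <= K].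
  have dj : {for x0, continuous (fun x => \det (jacobian f x))}.
    apply: differentiable_continuous.
    apply: (@Ck_differentiable _ _ _ 0 U) Ux0; apply: Ck_det => // i j.
    by apply: Ck_jacobian => //; move/smooth_onP: Sf; exact.
  have cph i : {for x0, continuous (partial i h)}.
    apply: differentiable_continuous; apply: (@Ck_differentiable _ _ _ 0 U) Ux0.
    have Cf : Ck 0 U (partial i f) by apply: Ck_partial; move/smooth_onP: Sf; exact.
    have Cc : Ck 0 U (fun x => delta_mx 0 i - partial i f x *m B).
      split; last by [].
      move=> x Ux; have dc : differentiable (fun=> delta_mx 0 i : 'rV[R]_n) x.
        exact: differentiable_cst.
      apply: (differentiableB dc).
      apply: (differentiable_comp (f := partial i f) (g := fun v => v *m B)).
        exact: Ck_differentiable Cf Ux.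
      exact: differentiable_mulmx.
    by apply: (eq_Ck oU) Cc => x Ux; rewrite ph.
  have n1 : \forall x \near x0, U x by exact: open_nbhs_nbhs.
  have n2 : \forall x \near x0, \det (jacobian f x) != 0.
    by apply: (cvgr_neq0 _ dj); move: uJ; rewrite unitmxE unitfE.
  have n3 : \forall x \near x0, forall i, `|partial i h x| <= K.
    apply: (@filter_forall _ _ (fun i x => `|partial i h x| <= K) (nbhs x0) _) => i.
    have /cvgrPdist_le/(_ _ K0) := cph i.
    by apply: filterS => x; rewrite ph0 sub0r normrN.
  have [e /= e0 eP] := (nbhs_ballP x0 _).1 (filterI n1 (filterI n2 n3)).
  exists e; first exact: e0.
  move=> x ex; have [Ux [dx px]] := eP x ex; split; [exact: Ux| |exact: px].
  by rewrite unitmxE unitfE.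
have h_contract x y : ball x0 e x -> ball x0 e y ->
    `|(x - g x) - (y - g y)| <= 2^-1 * `|x - y|.
  move=> ex ey; have := @lipschitz_on_ball R n n h x0 e K y x.
  rewrite -/(h x) -/(h y) => lip.
  apply: (le_trans (lip _ _ ey ex)) => [w /eP [Uw _ _]|w i /eP [_ _]|].
  - exact: dh.
  - exact.
  apply: ler_wpM2r => //; rewrite /K invfM mulrCA ler_piMr//.
  by rewrite ler_pdivrMr// mul1r ler_nat.
have [C C0 BC] := norm_mulmx B.
pose W := (fun y : 'rV[R]_n => y *m B) @^-1` ball (g x0) (e / 4).
pose V := ball x0 e `&` (f @^-1` W).
have oW : open W.
  apply: open_comp => [y _|]; first exact: mulmx_continuous.
  exact: ball_open.
have eU x : ball x0 e x -> U x by move=> /eP [].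
have oV : open V.
  rewrite openE => x [ex Wx]; apply: filterI.
    by apply: open_nbhs_nbhs; split=> //; exact: ball_open.
  have cf : {for x, continuous f} by apply/differentiable_continuous/df/eU.
  by apply: cf; apply: open_nbhs_nbhs; split.
have expand x y : V x -> V y -> `|x - y| <= 2 * C * `|f x - f y|.
  move=> [ex _] [ey _]; apply: le_trans (near_id_expanding h_contract ex ey) _.
  by rewrite -mulrA ler_pM2l// /g -mulmxBl; exact: BC.
have e40 : 0 < e / 4 by rewrite divr_gt0.
have surj y : W y -> exists x, V x /\ f x = y.
  move=> Wy; have [x ex gx] := near_id_surjective e0 h_contract Wy.
  have fx : f x = y.
    by apply: (can_inj (mulmxK (_ : B \in unitmx))) gx; rewrite unitmx_inv.
  exists x; split; last exact: fx.
  by split; [exact: ex|rewrite /preimage/= fx].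
pose theta y := xget x0 [set x | V x /\ f x = y].
have thetaP y : W y -> V (theta y) /\ f (theta y) = y.
  by move=> /surj [x xP]; have := @xgetPex _ x0 [set x | V x /\ f x = y] (ex_intro _ x xP).
have thetaK x : V x -> W (f x) /\ theta (f x) = x.
  move=> Vx; have Wx : W (f x) by case: Vx.
  split=> //; have [Vt ft] := thetaP _ Wx.
  apply/eqP; rewrite -subr_eq0 -normr_le0; apply: le_trans (expand _ _ Vt Vx) _.
  by rewrite ft subrr normr0 mulr0.
have L0 : 0 < 2 * C by rewrite mulr_gt0.
have SfV : smooth_on V f by apply: sub_smooth Sf => x [/eU].
have uV x : V x -> jacobian f x \in unitmx by move=> [/eP []].
have Vx0 : V x0 by split; exact: ballxx.
have VU : V `<=` U by move=> x [/eU].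
have Stheta := smooth_inverse oV oW L0 thetaP expand SfV uV.
by exists V, W, theta; split; [split|split|exact: thetaK|exact: thetaP|exact: Stheta].
Qed.

End InverseFunctionTheorem.

(** * Linear algebra in E^5 *)

Section Horizontal.
Context {R : realType}.
Implicit Types p u v w : 'rV[R]_5.

Lemma inner_dt v : inner v (dt R) = v 0 ord_max.
Proof.
rewrite /inner (bigD1 ord_max)//= big1 ?addr0 => [|i im].
  by rewrite mxE !eqxx mulr1.
by rewrite mxE eqxx/= (negbTE im) mulr0.
Qed.

Lemma inner_dtl v : inner (dt R) v = v 0 ord_max.
Proof. by rewrite innerC inner_dt. Qed.

Lemma dt_dt : inner (dt R) (dt R) = 1.
Proof. by rewrite inner_dt mxE !eqxx. Qed.

Lemma sphere_partE v : sphere_part v = v - inner v (dt R) *: dt R.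
Proof. by rewrite inner_dt. Qed.

Lemma inner_sphere_dt v : inner (sphere_part v) (dt R) = 0.
Proof. by rewrite sphere_partE !inner_linear dt_dt mulr1 subrr. Qed.

Lemma sphere_part5 v : sphere_part v 0 ord_max = 0.
Proof. by rewrite -inner_dt inner_sphere_dt. Qed.

Lemma sphere_partD v w : sphere_part (v + w) = sphere_part v + sphere_part w.
Proof. by rewrite !sphere_partE !inner_linear scalerDl opprD addrACA. Qed.

Lemma sphere_partZ a v : sphere_part (a *: v) = a *: sphere_part v.
Proof. by rewrite !sphere_partE !inner_linear -scalerA scalerBr. Qed.

Lemma sphere_part_dt : sphere_part (dt R) = 0.
Proof. by rewrite sphere_partE dt_dt scale1r subrr. Qed.

Lemma sphere_part_id v : v 0 ord_max = 0 -> sphere_part v = v.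
Proof. by move=> v0; rewrite /sphere_part v0 scale0r subr0. Qed.

Lemma sphere_partK v : sphere_part v + v 0 ord_max *: dt R = v.
Proof. by rewrite /sphere_part subrK. Qed.

Lemma inner_spherer v w : inner v (sphere_part w) =
  inner v w - v 0 ord_max * w 0 ord_max.
Proof. by rewrite sphere_partE !inner_linear !inner_dt mulrC. Qed.

Lemma inner_sphere v w : inner (sphere_part v) (sphere_part w) =
  inner v w - v 0 ord_max * w 0 ord_max.
Proof. by rewrite inner_spherer sphere_part5 mul0r subr0 innerC inner_spherer innerC mulrC. Qed.

Lemma inner_spherel v w : inner (sphere_part v) w =
  inner v w - v 0 ord_max * w 0 ord_max.
Proof. by rewrite innerC inner_spherer innerC mulrC. Qed.

End Horizontal.

Section Orthogonal.
Context {R : realType}.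
Implicit Types (u v w : 'rV[R]_5) (A : 'M[R]_5).

Definition orthogonal_mx A := A *m A^T = 1%:M.

Lemma orthogonal_trmx A : orthogonal_mx A -> A^T *m A = 1%:M.
Proof. exact: mulmx1C. Qed.

Lemma inner_mulmxl u v A : inner (u *m A) v = inner u (v *m A^T).
Proof.
suff : (inner (u *m A) v)%:M = (inner u (v *m A^T))%:M :> 'M[R]_1.
  by move/(congr1 (fun M : 'M[R]_1 => M 0 0)); rewrite !mxE eqxx !mulr1n.
by rewrite -!inner_mulmx trmx_mul trmxK mulmxA.
Qed.

Lemma inner_orthogonal A u v : orthogonal_mx A ->
  inner (u *m A) (v *m A) = inner u v.
Proof. by move=> AA; rewrite inner_mulmxl -mulmxA AA mulmx1. Qed.

Lemma inner_delta u i : inner u (delta_mx 0 i) = u 0 i.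
Proof.
rewrite /inner (bigD1 i)//= big1 ?addr0 => [|j ji].
  by rewrite mxE !eqxx mulr1.
by rewrite mxE eqxx/= (negbTE ji) mulr0.
Qed.

Lemma mulmx_trmx_entry m n (A : 'M[R]_(m, 5)) (B : 'M[R]_(n, 5)) i j : (A *m B^T) i j = inner (row i A) (row j B).
Proof.
by rewrite mxE /inner; apply: eq_bigr => k _; rewrite !mxE.
Qed.

(** The entries of [A *m A^T] are the inner products of images of basis vectors. *)
Lemma orthogonal_isometry A :
  (forall u v, inner (u *m A) (v *m A) = inner u v) -> orthogonal_mx A.
Proof.
move=> iA; apply/matrixP => i j.
by rewrite mulmx_trmx_entry !rowE iA inner_delta !mxE eqxx eq_sym.
Qed.

Lemma inner_eq u v : (forall w, inner u w = inner v w) -> u = v.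
Proof.
move=> uv; apply/eqP; rewrite -subr_eq0; apply/eqP/inner_eq0.
by rewrite innerBl uv subrr.
Qed.

(** The first four rows are meant to span the horizontal space, so that the
    matrix maps [dt] to itself. *)
Definition frame_mx (a b c d : 'rV[R]_5) : 'M[R]_5 :=
  \matrix_i [:: a; b; c; d; dt R]`_i.

Definition orthonormal_frame (a b c d : 'rV[R]_5) : Prop :=
  [/\ [/\ inner a a = 1, inner b b = 1, inner c c = 1 & inner d d = 1],
      [/\ inner a b = 0, inner a c = 0 & inner a d = 0],
      [/\ inner b c = 0, inner b d = 0 & inner c d = 0] &
      [/\ inner a (dt R) = 0, inner b (dt R) = 0, inner c (dt R) = 0 &
          inner d (dt R) = 0]].

Lemma frame_orthogonal a b c d :
  orthonormal_frame a b c d -> orthogonal_mx (frame_mx a b c d).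
Proof.
move=> [[aa bb cc dd] [ab ac ad] [bc bd cd] [at_ bt ct dt_]].
apply/matrixP => i j; rewrite mulmx_trmx_entry !rowK mxE.
have [ba ca da] : [/\ inner b a = 0, inner c a = 0 & inner d a = 0].
  by rewrite innerC ab innerC ac innerC ad.
have [cb db dc] : [/\ inner c b = 0, inner d b = 0 & inner d c = 0].
  by rewrite innerC bc innerC bd innerC cd.
have [ta tb tc td] : [/\ inner (dt R) a = 0, inner (dt R) b = 0,
    inner (dt R) c = 0 & inner (dt R) d = 0].
  by rewrite innerC at_ innerC bt innerC ct innerC dt_.
case: i => [[|[|[|[|[|i]]]]] Hi] //=; case: j => [[|[|[|[|[|j]]]]] Hj] //=;
  by rewrite ?dt_dt.
Qed.

Lemma frame_mxE a b c d v : v *m frame_mx a b c d =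
  v 0 (inord 0) *: a + v 0 (inord 1) *: b + v 0 (inord 2) *: c +
  v 0 (inord 3) *: d + v 0 ord_max *: dt R.
Proof.
apply/rowP => j; rewrite mxE !big_ord_recl big_ord0 !mxE /= addr0 !addrA.
by do 5?congr (_ + _); congr (v 0 _ * _); apply/val_inj; rewrite /= ?inordK.
Qed.

Lemma frame_expansion a b c d v : orthonormal_frame a b c d ->
  v = inner v a *: a + inner v b *: b + inner v c *: c + inner v d *: d +
      inner v (dt R) *: dt R.
Proof.
move=> /frame_orthogonal/orthogonal_trmx F.
rewrite -{1}[v]mulmx1 -F mulmxA frame_mxE.
have E k : (v *m (frame_mx a b c d)^T) 0 k = inner v ([:: a; b; c; d; dt R]`_k).
  by rewrite mulmx_trmx_entry rowK; congr (inner _ _); apply/rowP => i; rewrite mxE.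
by rewrite !E !inordK.
Qed.

Lemma frame_mx_dt a b c d : dt R *m frame_mx a b c d = dt R.
Proof.
by rewrite /dt -rowE rowK.
Qed.

(** Cofactors: expanding a determinant along its first row makes it the inner
    product of that row with this vector. *)
Definition cross (a b c : 'rV[R]_5) : 'rV[R]_5 :=
  \row_j \det (\matrix_i [:: delta_mx 0 j; a; b; c; dt R]`_i : 'M[R]_5).

Lemma inner_cross u a b c :
  inner u (cross a b c) = \det (\matrix_i [:: u; a; b; c; dt R]`_i : 'M[R]_5).
Proof.
rewrite (expand_det_row _ ord0) /inner; apply: eq_bigr => j _.
rewrite !mxE /=; congr (_ * _).
rewrite (expand_det_row _ ord0) (bigD1 j)//= big1 ?addr0 => [|k kj].
  rewrite !mxE/= !eqxx mul1r /cofactor; congr (_ * \det _).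
  by apply/matrixP => i k; rewrite !mxE.
by rewrite !mxE/= (negbTE kj) mul0r.
Qed.

(** The cross product is orthogonal to its arguments because a determinant with two
    equal rows vanishes. Its squared length is a Gram determinant. *)
Lemma cross_frame a b c : inner a a = 1 -> inner b b = 1 -> inner c c = 1 ->
  inner a b = 0 -> inner a c = 0 -> inner b c = 0 ->
  inner a (dt R) = 0 -> inner b (dt R) = 0 -> inner c (dt R) = 0 ->
  orthonormal_frame a (cross a b c) b c.
Proof.
move=> aa bb cc ab ac bc at_ bt ct; set n := cross a b c.
have alt u (k : 'I_5) : k != ord0 -> u = [:: u; a; b; c; dt R]`_k -> inner u n = 0.
  move=> k0 uk; rewrite inner_cross (determinant_alternate (i1 := ord0) (i2 := k)) 1?eq_sym//.
  by move=> j; rewrite !mxE -uk.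
have an : inner a n = 0 by apply: (alt _ (inord 1)); rewrite -?val_eqE/= inordK.
have bn : inner b n = 0 by apply: (alt _ (inord 2)); rewrite -?val_eqE/= inordK.
have cn : inner c n = 0 by apply: (alt _ (inord 3)); rewrite -?val_eqE/= inordK.
have tn : inner (dt R) n = 0 by apply: (alt _ (inord 4)); rewrite -?val_eqE/= inordK.
(* A vector orthogonal to [a], [b], [c] and [dt] gives a diagonal Gram matrix. *)
have gram u : inner u a = 0 -> inner u b = 0 -> inner u c = 0 ->
    inner u (dt R) = 0 -> inner u n ^+ 2 = inner u u.
  move=> ua ub uc ut; rewrite inner_cross.
  set M : 'M[R]_5 := \matrix_i _.
  have -> : \det M ^+ 2 = \det (M *m M^T) by rewrite det_mulmx det_tr expr2.
  have -> : M *m M^T = diag_mx (\row_(i < 5) [:: inner u u; 1; 1; 1; 1]`_i).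
    apply/matrixP => i j; rewrite mulmx_trmx_entry !rowK mxE.
    have [au bu cu] : [/\ inner a u = 0, inner b u = 0 & inner c u = 0].
      by rewrite innerC ua innerC ub innerC uc.
    have [ba ca cb] : [/\ inner b a = 0, inner c a = 0 & inner c b = 0].
      by rewrite innerC ab innerC ac innerC bc.
    have [tu ta tb tc] : [/\ inner (dt R) u = 0, inner (dt R) a = 0,
        inner (dt R) b = 0 & inner (dt R) c = 0].
      by rewrite innerC ut innerC at_ innerC bt innerC ct.
    case: i => [[|[|[|[|[|i]]]]] Hi] //=; case: j => [[|[|[|[|[|j]]]]] Hj] //=;
      by rewrite !mxE/= ?mulr1n ?mulr0n ?dt_dt.
  by rewrite det_diag !big_ord_recl big_ord0 !mxE/= !mulr1.
have [na nb nc nt] : [/\ inner n a = 0, inner n b = 0, inner n c = 0 &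
    inner n (dt R) = 0].
  by rewrite (innerC n a) an (innerC n b) bn (innerC n c) cn (innerC n (dt R)) tn.
have n0 : n != 0.
  pose G : 'M[R]_(4, 5) := \matrix_i [:: a; b; c; dt R]`_i.
  have : kermx G^T != 0.
    rewrite -mxrank_eq0 mxrank_ker -lt0n subn_gt0.
    by apply: leq_ltn_trans (rank_leq_col _) _.
  move=> /rowV0Pn[u /sub_kermxP uG u0].
  have uk (k : 'I_4) : inner u ([:: a; b; c; dt R]`_k) = 0.
    have := congr1 (fun M : 'rV[R]_4 => M 0 k) uG.
    rewrite mulmx_trmx_entry rowK mxE => <-.
    by congr (inner _ _); apply/rowP => i; rewrite mxE.
  have [ua ub uc ut] : [/\ inner u a = 0, inner u b = 0, inner u c = 0 &
      inner u (dt R) = 0].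
    have := uk (inord 0); have := uk (inord 1); have := uk (inord 2).
    by have := uk (inord 3); rewrite !inordK.
  apply: contraNneq u0 => n0; have := gram u ua ub uc ut.
  by rewrite n0 inner0r expr0n/= => /esym/inner_eq0 ->.
have nn : inner n n = 1.
  have := gram n na nb nc nt; rewrite expr2 => /eqP.
  rewrite -subr_eq0 -[X in _ - X]mulr1 -mulrBr mulf_eq0 => /orP[/eqP/inner_eq0 n0'|].
    by rewrite n0' eqxx in n0.
  by rewrite subr_eq0 => /eqP.
by split; split=> //; rewrite innerC.
Qed.

End Orthogonal.

(** * Rotations and affine isometries *)

Section MoreCalculus.
Context {R : realType} {m : nat}.
Implicit Types (x z : 'rV[R]_m) (U : set 'rV[R]_m).

Lemma partial_coordinate i j x :
  partial i (fun y : 'rV[R]_m => y 0 j) x = (j == i)%:R :> R.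
Proof.
have -> : partial i (fun y : 'rV[R]_m => y 0 j : R) x = partial i id x 0 j.
  by rewrite partial_coord.
by rewrite partialE//; have [_ ->] := is_diff_id x; rewrite mxE eqxx.
Qed.

Lemma partial_scalel {W : normedModType R} i (a : 'rV[R]_m -> R) (v : W) x :
  differentiable a x ->
  partial i (fun y => a y *: v) x = partial i a x *: v.
Proof.
move=> da; rewrite partialE; last exact: differentiableZl.
by rewrite diffZl// partialE.
Qed.

Lemma partial_cos i (f : 'rV[R]_m -> R) x : differentiable f x ->
  partial i (fun y => cos (f y)) x = - sin (f x) * partial i f x.
Proof. by move=> df; exact: partial_comp1. Qed.

Lemma partial_sin i (f : 'rV[R]_m -> R) x : differentiable f x ->
  partial i (fun y => sin (f y)) x = cos (f x) * partial i f x.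
Proof. by move=> df; exact: partial_comp1. Qed.

Lemma differentiable_cos (f : 'rV[R]_m -> R) x : differentiable f x ->
  differentiable (fun y => cos (f y)) x.
Proof. by move=> df; exact: differentiable_comp1 (is_derive_cos _). Qed.

Lemma differentiable_sin (f : 'rV[R]_m -> R) x : differentiable f x ->
  differentiable (fun y => sin (f y)) x.
Proof. by move=> df; exact: differentiable_comp1 (is_derive_sin _). Qed.

Lemma Ck_cos k U (f : 'rV[R]_m -> R) : open U -> Ck k U f ->
  Ck k U (fun x => cos (f x)).
Proof. by move=> oU Cf; have [] := Ck_cos_sin oU Cf. Qed.

Lemma Ck_sin k U (f : 'rV[R]_m -> R) : open U -> Ck k U f ->
  Ck k U (fun x => sin (f x)).
Proof. by move=> oU Cf; have [] := Ck_cos_sin oU Cf. Qed.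

(** The combinations [cos A V - sin A V'] and [sin A V + cos A V'] have zero
    derivative. *)
Lemma rotation_equation n (V V' : 'rV[R]_m -> 'rV[R]_n)
    (A : 'rV[R]_m -> R) (alpha : 'I_m -> 'rV[R]_m -> R) z r x :
  0 < r ->
  (forall w, ball z r w -> differentiable V w) ->
  (forall w, ball z r w -> differentiable V' w) ->
  (forall w, ball z r w -> differentiable A w) ->
  (forall w i, ball z r w -> partial i V w = alpha i w *: V' w) ->
  (forall w i, ball z r w -> partial i V' w = - alpha i w *: V w) ->
  (forall w i, ball z r w -> partial i A w = alpha i w) ->
  A z = 0 -> ball z r x ->
  V x = cos (A x) *: V z + sin (A x) *: V' z.
Proof.
move=> r0 dV dV' dA pV pV' pA Az zx.
pose C w := cos (A w) *: V w - sin (A w) *: V' w.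
pose S w := sin (A w) *: V w + cos (A w) *: V' w.
have dcV w : ball z r w -> differentiable (fun w => cos (A w) *: V w) w.
  by move=> bw; apply: differentiable_scale; [exact/differentiable_cos/dA|exact: dV].
have dsV w : ball z r w -> differentiable (fun w => sin (A w) *: V w) w.
  by move=> bw; apply: differentiable_scale; [exact/differentiable_sin/dA|exact: dV].
have dcV' w : ball z r w -> differentiable (fun w => cos (A w) *: V' w) w.
  by move=> bw; apply: differentiable_scale; [exact/differentiable_cos/dA|exact: dV'].
have dsV' w : ball z r w -> differentiable (fun w => sin (A w) *: V' w) w.
  by move=> bw; apply: differentiable_scale; [exact/differentiable_sin/dA|exact: dV'].
have pcV w i (bw : ball z r w) : partial i (fun w => cos (A w) *: V w) w =
    (- sin (A w) * alpha i w) *: V w + cos (A w) *: (alpha i w *: V' w).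
  rewrite partial_scale; [|exact/differentiable_cos/dA|exact: dV].
  by rewrite partial_cos ?pA ?pV//; exact: dA.
have psV w i (bw : ball z r w) : partial i (fun w => sin (A w) *: V w) w =
    (cos (A w) * alpha i w) *: V w + sin (A w) *: (alpha i w *: V' w).
  rewrite partial_scale; [|exact/differentiable_sin/dA|exact: dV].
  by rewrite partial_sin ?pA ?pV//; exact: dA.
have pcV' w i (bw : ball z r w) : partial i (fun w => cos (A w) *: V' w) w =
    (- sin (A w) * alpha i w) *: V' w + cos (A w) *: (- alpha i w *: V w).
  rewrite partial_scale; [|exact/differentiable_cos/dA|exact: dV'].
  by rewrite partial_cos ?pA ?pV'//; exact: dA.
have psV' w i (bw : ball z r w) : partial i (fun w => sin (A w) *: V' w) w =
    (cos (A w) * alpha i w) *: V' w + sin (A w) *: (- alpha i w *: V w).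
  rewrite partial_scale; [|exact/differentiable_sin/dA|exact: dV'].
  by rewrite partial_sin ?pA ?pV'//; exact: dA.
have Cx : C x = C z.
  apply: (@constant_on_ball _ _ _ C z r x) => // [w bw|w i bw].
    by apply: differentiableB; [exact: dcV|exact: dsV'].
  rewrite partialB; [|exact: dcV|exact: dsV'].
  by rewrite pcV// psV'//; apply/rowP => j; rewrite !mxE; ring.
have Sx : S x = S z.
  apply: (@constant_on_ball _ _ _ S z r x) => // [w bw|w i bw].
    by apply: differentiableD; [exact: dsV|exact: dcV'].
  rewrite partialD; [|exact: dsV|exact: dcV'].
  by rewrite psV// pcV'//; apply/rowP => j; rewrite !mxE; ring.
have CE : V z = C x by rewrite Cx /C Az cos0 sin0 scale1r scale0r subr0.
have SE : V' z = S x by rewrite Sx /S Az cos0 sin0 scale1r scale0r add0r.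
rewrite CE SE /C /S; apply/rowP => j; rewrite !mxE.
have /(congr1 (fun c => c * V x 0 j)) := cos2Dsin2 (A x).
rewrite mul1r => {1}<-; ring.
Qed.

End MoreCalculus.

Ltac smoothness oU :=
  repeat first
    [ apply: Ck_cst | apply: (Ck_coordinate _ _ oU)
    | assumption
    | apply: (CkD oU) | apply: (CkB oU) | apply: (CkN oU)
    | apply: (CkM oU) | apply: (Ck_scale oU) | apply: (Ck_inner oU)
    | apply: (Ck_cos oU) | apply: (Ck_sin oU) ].

Section AffineIsometry.
Context {R : realType}.
Implicit Types (p v w : 'rV[R]_5) (L : 'M[R]_5).

Lemma S3RE p : S3R R p <-> inner (sphere_part p) (sphere_part p) = 1.
Proof. by []. Qed.

Lemma smooth_affine m n (A : 'M[R]_(m, n)) b U : open U ->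
  smooth_on U (fun v : 'rV[R]_m => v *m A + b).
Proof.
move=> oU; apply/smooth_onP => k; apply/Ck_rowP => // j.
have C : Ck k U (fun v : 'rV[R]_m => \sum_i v 0 i * A i j + b 0 j).
  apply: (CkD oU); last exact: Ck_cst.
  by apply: Ck_sum => // i _; smoothness oU.
by apply: (eq_Ck oU) C => v _; rewrite !mxE.
Qed.

Lemma diff_affine m n (A : 'M[R]_(m, n)) b x (v : 'rV[R]_m) :
  'd (fun v : 'rV[R]_m => v *m A + b) x v = v *m A.
Proof.
have -> : (fun v : 'rV[R]_m => v *m A + b) =
    (fun v : 'rV[R]_m => v *m A) + cst b by [].
have H := is_diffD (is_diff_mulmx A x) (is_diff_cst b x).
by rewrite (@diff_val _ _ _ _ _ _ _ H) fctE addr0.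
Qed.

Lemma sphere_part_mulmx L eps p : orthogonal_mx L -> dt R *m L = eps *: dt R ->
  sphere_part (p *m L) = sphere_part p *m L.
Proof.
move=> LL Lt.
have eps2 : eps * eps = 1.
  have := inner_orthogonal (dt R) (dt R) LL.
  by rewrite Lt !inner_linear dt_dt mulr1.
rewrite !sphere_partE mulmxBl -scalemxAl Lt; congr (_ - _).
rewrite scalerA; congr (_ *: _).
rewrite -(inner_orthogonal p (dt R) LL) Lt innerZr.
by rewrite mulrAC eps2 mul1r.
Qed.

Lemma affine_sphere_part L eps beta p : orthogonal_mx L ->
  dt R *m L = eps *: dt R ->
  sphere_part (p *m L + beta *: dt R) = sphere_part p *m L.
Proof.
move=> LL Lt; rewrite sphere_partD sphere_partZ sphere_part_dt scaler0 addr0.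
exact: sphere_part_mulmx Lt.
Qed.

(** The sphere is preserved by the orthogonal part, which fixes [dt], and the
    translation is along [dt]. *)
Lemma affine_isometry L beta : orthogonal_mx L -> dt R *m L = dt R ->
  isometry_S3R (fun p => p *m L + beta *: dt R).
Proof.
move=> LL Lt; have Lt1 : dt R *m L = 1 *: dt R by rewrite scale1r.
have LL' : orthogonal_mx L^T by rewrite /orthogonal_mx trmxK orthogonal_trmx.
have Lt' : dt R *m L^T = 1 *: dt R by rewrite scale1r -{1}Lt -mulmxA LL mulmx1.
have S3Rphi p : S3R R p -> S3R R (p *m L + beta *: dt R).
  by move=> /S3RE Sp; apply/S3RE; rewrite (affine_sphere_part _ _ LL Lt1) inner_orthogonal.
have S3Rpsi p : S3R R p -> S3R R (p *m L^T + (- beta) *: dt R).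
  by move=> /S3RE Sp; apply/S3RE; rewrite (affine_sphere_part _ _ LL' Lt') inner_orthogonal.
split; last by move=> p v w _ _ _; rewrite !diff_affine inner_orthogonal.
exists (fun p => p *m L^T + (- beta) *: dt R); split.
- by exists setT; split=> //; [exact: openT|apply: smooth_affine; exact: openT].
- by exists setT; split=> //; [exact: openT|apply: smooth_affine; exact: openT].
- move=> p Sp; split; first exact: S3Rphi.
  by rewrite mulmxDl -mulmxA LL mulmx1 -scalemxAl Lt' scale1r scaleNr addrK.
- move=> p Sp; split; first exact: S3Rpsi.
  by rewrite mulmxDl -mulmxA orthogonal_trmx// mulmx1 -scalemxAl Lt scaleNr subrK.
Qed.

End AffineIsometry.

(** * Isometries and second derivatives *)

Section SecondChainRule.
Context {R : realType}.

Lemma partial2_comp m n p (U : set 'rV[R]_m) (V : set 'rV[R]_n)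
    (g : 'rV[R]_m -> 'rV[R]_n) (f : 'rV[R]_n -> 'rV[R]_p) x i j :
  open U -> open V -> (forall y, U y -> V (g y)) ->
  smooth_on U g -> smooth_on V f -> U x ->
  partial i (partial j (f \o g)) x =
  \sum_a partial i (partial j g) x 0 a *: partial a f (g x) +
  \sum_a \sum_b (partial j g x 0 a * partial i g x 0 b) *:
    partial b (partial a f) (g x).
Proof.
move=> oU oV gV Sg Sf Ux.
have dg y : U y -> differentiable g y by exact: smooth_differentiable Sg.
have df y : V y -> differentiable f y by exact: smooth_differentiable Sf.
have dpg y k : U y -> differentiable (partial k g) y.
  exact: smooth_differentiable (smooth_partial k Sg).
have dpf y k : V y -> differentiable (partial k f) y.
  exact: smooth_differentiable (smooth_partial k Sf).
have pE y : U y -> partial j (f \o g) y =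
    \sum_a partial j g y 0 a *: (partial a f \o g) y.
  by move=> Uy; rewrite [LHS]partial_comp//; [exact: dg|exact/df/gV].
rewrite (eq_partial i oU Ux pE).
have dfg a : differentiable (partial a f \o g) x.
  by apply: differentiable_comp; [exact: dg|exact/dpf/gV].
have dga a : differentiable (fun y => partial j g y 0 a) x.
  exact: (differentiable_rowP _ _).1 (dpg _ j Ux) a.
rewrite (partial_bigsum (F := fun a y => partial j g y 0 a *: (partial a f \o g) y)); last first.
  by move=> a; exact: differentiable_scale.
rewrite -big_split; apply: eq_bigr => a _ /=.
rewrite partial_scale; [|exact: dga|exact: dfg].
congr (_ *: _ + _).
  by rewrite partial_coord//; exact: dpg.
rewrite (partial_comp _ (f := partial a f) (dg _ Ux)); last exact/dpf/gV.
by rewrite scaler_sumr; apply: eq_bigr => b _; rewrite scalerA.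
Qed.

Lemma differentiable_sphere_part m (f : 'rV[R]_m -> 'rV[R]_5) x :
  differentiable f x -> differentiable (fun y => sphere_part (f y)) x.
Proof.
move=> df; apply: differentiableB => //; apply: differentiableZl.
exact: (differentiable_rowP _ _).1 df ord_max.
Qed.

Lemma partial_sphere_part m (f : 'rV[R]_m -> 'rV[R]_5) i x :
  differentiable f x ->
  partial i (fun y => sphere_part (f y)) x = sphere_part (partial i f x).
Proof.
move=> df; have df5 := (differentiable_rowP _ _).1 df ord_max.
rewrite partialB//; last exact: differentiableZl.
by rewrite partial_scalel// -partial_coord.
Qed.

Lemma tangent_partial m U (f : 'rV[R]_m -> 'rV[R]_5) i x : open U -> U x ->
  (forall y, U y -> differentiable f y) -> (forall y, U y -> S3R R (f y)) ->
  tangent_S3R (f x) (partial i f x).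
Proof.
move=> oU Ux df Sf; rewrite /tangent_S3R/=.
have ds := differentiable_sphere_part (df x Ux).
have : partial i (fun y => inner (sphere_part (f y)) (sphere_part (f y))) x = 0.
  by rewrite (eq_partial (g := fun=> 1 : R) i oU Ux) ?partial_cst// => y /Sf.
rewrite partial_inner// partial_sphere_part; last exact: df.
rewrite [X in _ + X]innerC inner_sphere.
rewrite inner_spherer => /eqP; rewrite -mulr2n mulrn_eq0/= => /eqP.
exact.
Qed.

End SecondChainRule.

Section IsometryClassification.
Context {R : realType}.
Variable phi : 'rV[R]_5 -> 'rV[R]_5.
Hypothesis iso : isometry_S3R phi.
Implicit Types (p v w z : 'rV[R]_5).

Lemma isometry_smooth : exists U, [/\ open U, S3R R `<=` U & smooth_on U phi].
Proof. by have [[psi []]] := iso. Qed.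

Lemma isometry_stable p : S3R R p -> S3R R (phi p).
Proof. by have [[psi [_ _ H _]] _] := iso; move=> /H []. Qed.

Lemma isometry_inner p v w : S3R R p -> tangent_S3R p v -> tangent_S3R p w ->
  inner ('d phi p v) ('d phi p w) = inner v w.
Proof. by have [_] := iso; exact. Qed.

Lemma isometry_differentiable p : S3R R p -> differentiable phi p.
Proof.
by have [U [_ SU Sphi]] := isometry_smooth; move=> /SU; exact: smooth_differentiable.
Qed.

Section Curves.
Context {m : nat} (V : set 'rV[R]_m) (F : 'rV[R]_m -> 'rV[R]_5).
Hypotheses (oV : open V) (SF : smooth_on V F) (FS : forall x, V x -> S3R R (F x)).

Lemma isometry_comp_smooth : smooth_on V (phi \o F).
Proof.
have [U [oU SU Sphi]] := isometry_smooth.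
by apply: (smooth_comp oV oU _ SF Sphi) => x /FS; exact: SU.
Qed.

Lemma isometry_partial i x : V x ->
  partial i (phi \o F) x = 'd phi (F x) (partial i F x).
Proof.
move=> Vx; have dF := smooth_differentiable SF Vx.
have dphi := isometry_differentiable (FS Vx).
rewrite (partialE i (differentiable_comp dF dphi)) (diff_comp dF dphi) /=.
by rewrite (partialE i dF).
Qed.

Lemma isometry_metric i j x : V x ->
  inner (partial i (phi \o F) x) (partial j (phi \o F) x) =
  inner (partial i F x) (partial j F x).
Proof.
move=> Vx; rewrite !isometry_partial// isometry_inner//; first exact: FS.
- by apply: (tangent_partial _ oV) => // y; exact: smooth_differentiable.
- by apply: (tangent_partial _ oV) => // y; exact: smooth_differentiable.
Qed.

Lemma koszul_cancel (a b c d a' b' c' d' : R) :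
  a + b = a' + b' -> d + c = d' + c' -> b = c -> d = c -> b' = c' -> d' = c' ->
  a = a'.
Proof. lra. Qed.

(** Koszul's formula: the second derivatives of a map, paired with its first
    derivatives, are determined by the metric it induces. *)
Lemma isometry_koszul i j x : V x ->
  inner (partial i (partial i (phi \o F)) x) (partial j (phi \o F) x) =
  inner (partial i (partial i F) x) (partial j F x).
Proof.
move=> Vx; have Sg := isometry_comp_smooth.
have dmetric (h : 'rV[R]_m -> 'rV[R]_5) k a b : smooth_on V h ->
    partial k (fun y => inner (partial a h y) (partial b h y)) x =
    inner (partial k (partial a h) x) (partial b h x) +
    inner (partial a h x) (partial k (partial b h) x).
  move=> Sh; rewrite partial_inner//.
    exact: smooth_differentiable (smooth_partial a Sh) Vx.
  exact: smooth_differentiable (smooth_partial b Sh) Vx.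
have same k a b : partial k (fun y => inner (partial a (phi \o F) y)
      (partial b (phi \o F) y)) x =
    partial k (fun y => inner (partial a F y) (partial b F y)) x.
  by apply: (eq_partial k oV Vx) => y Vy; exact: isometry_metric.
have M1 := etrans (esym (dmetric _ i i j Sg)) (etrans (same i i j) (dmetric _ i i j SF)).
have M2 := etrans (esym (dmetric _ j i i Sg)) (etrans (same j i i) (dmetric _ j i i SF)).
have symg := partial_symmetric_row i j oV Vx Sg.
have symF := partial_symmetric_row i j oV Vx SF.
apply: koszul_cancel M1 M2 _ (innerC _ _) _ (innerC _ _).
  exact: (congr1 (fun w => inner (partial i (phi \o F) x) w) symg).
exact: (congr1 (fun w => inner (partial i F x) w) symF).
Qed.

End Curves.

End IsometryClassification.

(** * Geodesics of S^3 x R under isometries *)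

#[local] Opaque inner sphere_part.

Section Family.
Context {R : realType}.
Variables (a v W : 'rV[R]_5) (k omega h r beta : R).
Implicit Types x : 'rV[R]_2.

Let i0 : 'I_2 := ord0.
Let i1 : 'I_2 := ord_max.

(** Geodesics of S^3 x R in the first variable, deformed along [W] and [dt] in
    the second one. *)
Definition geodesic_family x : 'rV[R]_5 :=
  (cos (omega * x 0 i1) * cos (k * x 0 i0)) *: a +
  (cos (omega * x 0 i1) * sin (k * x 0 i0)) *: v +
  sin (omega * x 0 i1) *: W + (h + r * x 0 i0 + beta * x 0 i1) *: dt R.

Lemma smooth_geodesic_family : smooth_on setT geodesic_family.
Proof.
have oT : open (@setT 'rV[R]_2) by exact: openT.
by apply/smooth_onP => n; rewrite /geodesic_family; smoothness oT.
Qed.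

Let diff n x (f : 'rV[R]_2 -> R) : Ck n setT f -> differentiable f x.
Proof. by move=> Cf; exact: Ck_differentiable Cf _. Qed.

Let partial_sum4 i (A B C D : 'rV[R]_2 -> R) x :
  Ck 0 setT A -> Ck 0 setT B -> Ck 0 setT C -> Ck 0 setT D ->
  partial i (fun y => A y *: a + B y *: v + C y *: W + D y *: dt R) x =
  partial i A x *: a + partial i B x *: v + partial i C x *: W +
  partial i D x *: dt R.
Proof.
move=> CA CB CC CD.
have dA := diff x CA; have dB := diff x CB; have dC := diff x CC.
have dD := diff x CD.
have dAa : differentiable (fun y => A y *: a) x by exact: differentiableZl.
have dBv : differentiable (fun y => B y *: v) x by exact: differentiableZl.
have dCW : differentiable (fun y => C y *: W) x by exact: differentiableZl.
have dDt : differentiable (fun y => D y *: dt R) x by exact: differentiableZl.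
have dAB := differentiableD dAa dBv.
have dABC := differentiableD dAB dCW.
rewrite (partialD i dABC dDt) (partialD i dAB dCW) (partialD i dAa dBv).
by rewrite (partial_scalel i a dA) (partial_scalel i v dB) (partial_scalel i W dC)
  (partial_scalel i (dt R) dD).
Qed.

Let partial_lin i j (c : R) x :
  partial i (fun y : 'rV[R]_2 => c * y 0 j) x = c * (j == i)%:R.
Proof.
rewrite (partialZ i c (f := fun y : 'rV[R]_2 => y 0 j : R)).
  by rewrite partial_coordinate.
exact: differentiable_coord.
Qed.

Let dlin j (c : R) x : differentiable (fun y : 'rV[R]_2 => c * y 0 j) x.
Proof. by apply: differentiableM; [exact: differentiable_cst|exact: differentiable_coord]. Qed.

Lemma partial0_geodesic_family x : partial i0 geodesic_family x =
  (- k * (cos (omega * x 0 i1) * sin (k * x 0 i0))) *: a +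
  (k * (cos (omega * x 0 i1) * cos (k * x 0 i0))) *: v + r *: dt R.
Proof.
have oT : open (@setT 'rV[R]_2) by exact: openT.
rewrite [LHS]partial_sum4; try by smoothness oT.
have dc j c : differentiable (fun y : 'rV[R]_2 => cos (c * y 0 j)) x.
  exact/differentiable_cos/dlin.
have ds j c : differentiable (fun y : 'rV[R]_2 => sin (c * y 0 j)) x.
  exact/differentiable_sin/dlin.
have E1 : partial i0 (fun y : 'rV[R]_2 => cos (omega * y 0 i1) * cos (k * y 0 i0)) x =
    - k * (cos (omega * x 0 i1) * sin (k * x 0 i0)).
  rewrite (partialM i0 (dc _ _) (dc _ _)) (partial_cos i0 (dlin _ _ _)).
  by rewrite (partial_cos i0 (dlin _ _ _)) !partial_lin/=; ring.
have E2 : partial i0 (fun y : 'rV[R]_2 => cos (omega * y 0 i1) * sin (k * y 0 i0)) x =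
    k * (cos (omega * x 0 i1) * cos (k * x 0 i0)).
  rewrite (partialM i0 (dc _ _) (ds _ _)) (partial_cos i0 (dlin _ _ _)).
  by rewrite (partial_sin i0 (dlin _ _ _)) !partial_lin/=; ring.
have E3 : partial i0 (fun y : 'rV[R]_2 => sin (omega * y 0 i1)) x = 0.
  by rewrite (partial_sin i0 (dlin _ _ _)) !partial_lin/= !mulr0.
have E4 : partial i0 (fun y : 'rV[R]_2 => h + r * y 0 i0 + beta * y 0 i1) x = r.
  have dh : differentiable (fun=> h : R) x by exact: differentiable_cst.
  have dhr := differentiableD dh (dlin i0 r x).
  rewrite (partialD i0 dhr (dlin i1 beta x)) (partialD i0 dh (dlin i0 r x)).
  by rewrite partial_cst !partial_lin/=; ring.
by rewrite E1 E2 E3 E4 scale0r addr0.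
Qed.

Lemma partial1_geodesic_family x : partial i1 geodesic_family x =
  (- omega * (sin (omega * x 0 i1) * cos (k * x 0 i0))) *: a +
  (- omega * (sin (omega * x 0 i1) * sin (k * x 0 i0))) *: v +
  (omega * cos (omega * x 0 i1)) *: W + beta *: dt R.
Proof.
have oT : open (@setT 'rV[R]_2) by exact: openT.
rewrite [LHS]partial_sum4; try by smoothness oT.
have dc j c : differentiable (fun y : 'rV[R]_2 => cos (c * y 0 j)) x.
  exact/differentiable_cos/dlin.
have ds j c : differentiable (fun y : 'rV[R]_2 => sin (c * y 0 j)) x.
  exact/differentiable_sin/dlin.
have E1 : partial i1 (fun y : 'rV[R]_2 => cos (omega * y 0 i1) * cos (k * y 0 i0)) x =
    - omega * (sin (omega * x 0 i1) * cos (k * x 0 i0)).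
  rewrite (partialM i1 (dc _ _) (dc _ _)) (partial_cos i1 (dlin _ _ _)).
  by rewrite (partial_cos i1 (dlin _ _ _)) !partial_lin/=; ring.
have E2 : partial i1 (fun y : 'rV[R]_2 => cos (omega * y 0 i1) * sin (k * y 0 i0)) x =
    - omega * (sin (omega * x 0 i1) * sin (k * x 0 i0)).
  rewrite (partialM i1 (dc _ _) (ds _ _)) (partial_cos i1 (dlin _ _ _)).
  by rewrite (partial_sin i1 (dlin _ _ _)) !partial_lin/=; ring.
have E3 : partial i1 (fun y : 'rV[R]_2 => sin (omega * y 0 i1)) x =
    omega * cos (omega * x 0 i1).
  by rewrite (partial_sin i1 (dlin _ _ _)) !partial_lin/= mulr1 mulrC.
have E4 : partial i1 (fun y : 'rV[R]_2 => h + r * y 0 i0 + beta * y 0 i1) x = beta.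
  have dh : differentiable (fun=> h : R) x by exact: differentiable_cst.
  have dhr := differentiableD dh (dlin i0 r x).
  rewrite (partialD i1 dhr (dlin i1 beta x)) (partialD i1 dh (dlin i0 r x)).
  by rewrite partial_cst !partial_lin/=; ring.
by rewrite E1 E2 E3 E4.
Qed.

Lemma partial00_geodesic_family x : partial i0 (partial i0 geodesic_family) x =
  (- k ^+ 2 * cos (omega * x 0 i1)) *:
    (cos (k * x 0 i0) *: a + sin (k * x 0 i0) *: v).
Proof.
have oT : open (@setT 'rV[R]_2) by exact: openT.
have E0 : partial i0 geodesic_family = fun x =>
  (- k * (cos (omega * x 0 i1) * sin (k * x 0 i0))) *: a +
  (k * (cos (omega * x 0 i1) * cos (k * x 0 i0))) *: v + 0 *: W + r *: dt R.
  by apply/funext => y; rewrite partial0_geodesic_family scale0r addr0.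
rewrite E0 (@partial_sum4 i0 (fun x => - k * (cos (omega * x 0 i1) * sin (k * x 0 i0)))
  (fun x => k * (cos (omega * x 0 i1) * cos (k * x 0 i0))) (fun=> 0) (fun=> r));
  try by smoothness oT.
have dc j c : differentiable (fun y : 'rV[R]_2 => cos (c * y 0 j)) x.
  exact/differentiable_cos/dlin.
have ds j c : differentiable (fun y : 'rV[R]_2 => sin (c * y 0 j)) x.
  exact/differentiable_sin/dlin.
have E1 : partial i0 (fun y : 'rV[R]_2 => - k * (cos (omega * y 0 i1) * sin (k * y 0 i0))) x =
    - k * (k * (cos (omega * x 0 i1) * cos (k * x 0 i0))).
  rewrite (partialZ i0 (- k) (f := fun y : 'rV[R]_2 => cos (omega * y 0 i1) * sin (k * y 0 i0)));
    last exact: differentiableM.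
  congr (_ * _).
  rewrite (partialM i0 (dc _ _) (ds _ _)) (partial_cos i0 (dlin _ _ _)).
  by rewrite (partial_sin i0 (dlin _ _ _)) !partial_lin/=; ring.
have E2 : partial i0 (fun y : 'rV[R]_2 => k * (cos (omega * y 0 i1) * cos (k * y 0 i0))) x =
    k * (- k * (cos (omega * x 0 i1) * sin (k * x 0 i0))).
  rewrite (partialZ i0 k (f := fun y : 'rV[R]_2 => cos (omega * y 0 i1) * cos (k * y 0 i0)));
    last exact: differentiableM.
  congr (_ * _).
  rewrite (partialM i0 (dc _ _) (dc _ _)) (partial_cos i0 (dlin _ _ _)).
  by rewrite (partial_cos i0 (dlin _ _ _)) !partial_lin/=; ring.
rewrite E1 E2 !partial_cst !scale0r !addr0.
by apply/rowP => j; rewrite !mxE; ring.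
Qed.

End Family.

Section IsometryGeodesics.
Context {R : realType}.
Implicit Types (a v w p z W : 'rV[R]_5) (x y : 'rV[R]_2).

Let i0 : 'I_2 := ord0.
Let i1 : 'I_2 := ord_max.

(** The unit vector in the direction of [w], or zero when [w] is zero; the third
    clause is what the circle through a point in the direction [W] needs, and holds
    in both cases. *)
Lemma horizontal_speed w : w 0 ord_max = 0 -> exists omega W,
  [/\ w = omega *: W, W 0 ord_max = 0,
    forall t, cos (omega * t) ^+ 2 + sin (omega * t) ^+ 2 * inner W W = 1 &
    forall u, inner w u = 0 -> inner W u = 0].
Proof.
move=> w5; have [->|w0] := eqVneq w 0.
  exists 0, 0; split=> [||t|u _]; rewrite ?scale0r ?mxE ?inner0l//.
  by rewrite mul0r cos0 expr1n mulr0 addr0.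
have ww := inner_gt0 w0; set s := Num.sqrt (inner w w).
have s0 : s != 0 by rewrite gt_eqF// sqrtr_gt0.
have ss : inner w w = s ^+ 2 by rewrite sqr_sqrtr// inner_ge0.
exists s, (s^-1 *: w); split=> [||t|u wu].
- by rewrite scalerA divff// scale1r.
- by rewrite mxE w5 mulr0.
- have -> : inner (s^-1 *: w) (s^-1 *: w) = 1.
    by rewrite innerZl innerZr ss; field.
  by rewrite mulr1 cos2Dsin2.
- by rewrite innerZl wu mulr0.
Qed.

(** The spherical part moves on the circle of [a] and [v], then on the circle from
    that point towards [W]. *)
Lemma geodesic_family_S3R a v W k omega h r beta x :
  inner a a = 1 -> inner a v = 0 -> inner a W = 0 -> inner v W = 0 ->
  a 0 ord_max = 0 -> v 0 ord_max = 0 -> W 0 ord_max = 0 ->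
  (forall t, cos (k * t) ^+ 2 + sin (k * t) ^+ 2 * inner v v = 1) ->
  (forall t, cos (omega * t) ^+ 2 + sin (omega * t) ^+ 2 * inner W W = 1) ->
  S3R R (geodesic_family a v W k omega h r beta x).
Proof.
move=> aa av aW vW a5 v5 W5 Hv HW; apply/S3RE.
rewrite /geodesic_family !sphere_partD !sphere_partZ sphere_part_dt scaler0 addr0.
rewrite !sphere_part_id// !inner_linear (innerC v a) (innerC W a) (innerC W v).
rewrite aa av aW vW.
have := Hv (x 0 ord0); have := HW (x 0 ord_max).
set c1 := cos (omega * _); set s1 := sin (omega * _).
set c0 := cos (k * _); set s0 := sin (k * _) => H1 H0.
transitivity (c1 ^+ 2 * (c0 ^+ 2 + s0 ^+ 2 * inner v v) + s1 ^+ 2 * inner W W).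
  by ring.
by rewrite H0 mulr1.
Qed.

Variable phi : 'rV[R]_5 -> 'rV[R]_5.
Hypothesis iso : isometry_S3R phi.

Let oT : open (@setT 'rV[R]_2).
Proof. exact: openT. Qed.

(** The vector [z] is the velocity of a curve of S^3 x R, and the velocity of the
    image curve is tangent. *)
Lemma isometry_tangent p z : S3R R p -> tangent_S3R p z ->
  tangent_S3R (phi p) ('d phi p z).
Proof.
move=> Sp; rewrite {1}/tangent_S3R/= => zp.
have [omega [W [zW W5 HW Wperp]]] := horizontal_speed (sphere_part5 z).
pose F := geodesic_family (sphere_part p) 0 W 0 omega (p 0 ord_max) 0 (z 0 ord_max).
have SF : smooth_on setT F by exact: smooth_geodesic_family.
have FS x : setT x -> S3R R (F x).
  move=> _; have z5 : (0 : 'rV[R]_5) 0 ord_max = 0 by rewrite mxE.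
  have pW : inner (sphere_part p) W = 0.
    by rewrite innerC; apply: Wperp; rewrite inner_spherel sphere_part5 mulr0 subr0.
  apply: (geodesic_family_S3R _ _ _ _ Sp (inner0r _) pW (inner0l _) (sphere_part5 p) z5 W5 _ HW).
  by move=> t; rewrite mul0r cos0 expr1n inner0r mulr0 addr0.
have F0 : F 0 = p.
  rewrite /F /geodesic_family !mxE !mulr0 cos0 sin0 !scaler0 scale0r !addr0 mulr1.
  by rewrite scale1r sphere_partK.
have F1 : partial i1 F 0 = z.
  rewrite partial1_geodesic_family !mxE !mulr0 cos0 sin0 !mulr1 ?mul0r ?mulr0.
  by rewrite !scale0r !add0r -zW sphere_partK.
have Sg := isometry_comp_smooth iso oT SF FS.
have gS x : setT x -> S3R R ((phi \o F) x) by move=> Tx; exact/(isometry_stable iso)/FS.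
have dg x : setT x -> differentiable (phi \o F) x by exact: smooth_differentiable Sg.
have := tangent_partial i1 oT (I : setT (0 : 'rV[R]_2)) dg gS.
by rewrite (isometry_partial iso SF FS)// F0 F1 /= F0.
Qed.

(** The differential of the isometry at [p], extended to E^5 by sending the
    unit normal of S^3 x R at [p] to the one at [phi p]. *)
Lemma isometry_matrix p : S3R R p -> exists B : 'M[R]_5,
  [/\ orthogonal_mx B, forall z, tangent_S3R p z -> 'd phi p z = z *m B &
    sphere_part p *m B = sphere_part (phi p)].
Proof.
move=> Sp; have NN : inner (sphere_part p) (sphere_part p) = 1 by [].
have NN' : inner (sphere_part (phi p)) (sphere_part (phi p)) = 1.
  exact: isometry_stable Sp.
set N := sphere_part p in NN *; set N' := sphere_part (phi p) in NN' *.
pose J := jacobian phi p; pose B := J + N^T *m (N' - N *m J).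
have BE z : z *m B = z *m J + inner z N *: (N' - N *m J).
  by rewrite /B mulmxDr mulmxA inner_mulmx mul_scalar_mx.
have tE z : z *m B = 'd phi p (z - inner z N *: N) + inner z N *: N'.
  rewrite BE diff_jacobian [RHS]addrC (mulmxBl z (_ *: N)) -scalemxAl scalerBr.
  by rewrite addrCA.
have tan z : tangent_S3R p (z - inner z N *: N).
  by rewrite /tangent_S3R/= innerBl innerZl -/N NN mulr1 subrr.
exists B; split.
- apply: orthogonal_isometry => u w.
  have uwE := isometry_inner iso Sp (tan u) (tan w).
  have uE := tE u; have wE := tE w.
  have tu : inner ('d phi p (u - inner u N *: N)) N' = 0 := isometry_tangent Sp (tan u).
  have tw : inner ('d phi p (w - inner w N *: N)) N' = 0 := isometry_tangent Sp (tan w).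
  clearbody B N N'.
  move: ('d phi p _) uE tu uwE => du uE tu; move: ('d phi p _) wE tw => dw wE tw uwE.
  rewrite uE wE innerDl !innerDr !innerZl !innerZr tu (innerC N') tw NN' uwE.
  rewrite !innerBl !innerBr !innerZl !innerZr NN (innerC N w); ring.
- by move=> z; rewrite /tangent_S3R/= -/N => zN; rewrite tE zN !scale0r subr0 addr0.
- by rewrite BE NN scale1r addrC subrK.
Qed.

Section Geodesic.
Variables (a v : 'rV[R]_5) (h r : R).
Hypotheses (aa : inner a a = 1) (vv : inner v v = 1) (av : inner a v = 0).
Hypotheses (a5 : a 0 ord_max = 0) (v5 : v 0 ord_max = 0).

Definition geodesic := geodesic_family a v 0 1 0 h r 0.

Let gS x : cos (x 0 i0) *: a + sin (x 0 i0) *: v = sphere_part (geodesic x).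
Proof.
rewrite /geodesic /geodesic_family !sphere_partD !sphere_partZ sphere_part_dt.
rewrite !mul0r cos0 !mul1r sin0 scale0r !scaler0 !addr0.
by rewrite !sphere_part_id.
Qed.

Let g'S x := - sin (x 0 i0) *: a + cos (x 0 i0) *: v.

Lemma smooth_geodesic : smooth_on setT geodesic.
Proof. exact: smooth_geodesic_family. Qed.

Let unit1 (u : 'rV[R]_5) : inner u u = 1 ->
  forall t, cos (1 * t) ^+ 2 + sin (1 * t) ^+ 2 * inner u u = 1.
Proof. by move=> -> t; rewrite mulr1 cos2Dsin2. Qed.

Lemma geodesic_S3R x : setT x -> S3R R (geodesic x).
Proof.
move=> _; have z5 : (0 : 'rV[R]_5) 0 ord_max = 0 by rewrite mxE.
apply: (geodesic_family_S3R _ _ _ _ aa av (inner0r _) (inner0r _) a5 v5 z5 (unit1 vv)).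
by move=> t; rewrite mul0r cos0 expr1n inner0r mulr0 addr0.
Qed.

Lemma partial0_geodesic x : partial i0 geodesic x = g'S x + r *: dt R.
Proof.
by rewrite partial0_geodesic_family mul0r cos0 !mul1r mulN1r.
Qed.

Lemma partial1_geodesic x : partial i1 geodesic x = 0.
Proof.
by rewrite partial1_geodesic_family oppr0 !mul0r !scale0r !addr0.
Qed.

(** The acceleration of a geodesic is normal to S^3 x R, and by Koszul's
    formula so is that of its image: the deformations of the geodesic realise
    all tangent directions. *)
Lemma isometry_geodesic_normal x z : tangent_S3R (geodesic x) z ->
  inner (partial i0 (partial i0 (phi \o geodesic)) x) ('d phi (geodesic x) z) = 0.
Proof.
rewrite /tangent_S3R/= -gS => zt.
set c := cos (x 0 i0) in zt *; set s := sin (x 0 i0) in zt *.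
have cs : c ^+ 2 + s ^+ 2 = 1 by exact: cos2Dsin2.
pose la := inner z (g'S x); pose w := sphere_part z - la *: g'S x.
have w5 : w 0 ord_max = 0.
  rewrite -inner_dt /w innerBl innerZl inner_sphere_dt /g'S innerDl !innerZl.
  by rewrite !inner_dt a5 v5; ring.
have [omega [W [wW W5 HW Wperp]]] := horizontal_speed w5.
have za : inner z a = - s * la.
  have : inner z (c *: a + s *: v) = 0 := zt.
  rewrite /la /g'S -/c -/s !innerDr !innerZr => zt'.
  rewrite -[LHS]mul1r -cs; transitivity (c * (c * inner z a + s * inner z v) - s * (- s * inner z a + c * inner z v)); first by ring.
  by rewrite zt'; ring.
have zv : inner z v = c * la.
  have : inner z (c *: a + s *: v) = 0 := zt.
  rewrite /la /g'S -/c -/s !innerDr !innerZr => zt'.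
  rewrite -[LHS]mul1r -cs; transitivity (s * (c * inner z a + s * inner z v) + c * (- s * inner z a + c * inner z v)); first by ring.
  by rewrite zt'; ring.
have wa : inner w a = 0.
  rewrite /w innerBl innerZl inner_spherel a5 za /g'S innerDl !innerZl (innerC v a) av aa.
  by rewrite -/c -/s; ring.
have wv : inner w v = 0.
  rewrite /w innerBl innerZl inner_spherel v5 zv /g'S innerDl !innerZl vv av.
  by rewrite -/c -/s; ring.
have aW : inner a W = 0 by rewrite innerC; exact: Wperp.
have vW : inner v W = 0 by rewrite innerC; exact: Wperp.
(* The deformation [F] moves the geodesic with velocity [w + beta dt], and [z] is a
   combination of this vector and the velocity of the geodesic. *)
pose beta := z 0 ord_max - la * r.
pose F := geodesic_family a v W 1 omega h r beta.
pose y : 'rV[R]_2 := \row_j [:: x 0 i0; 0]`_j.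
have [y0 y1] : y 0 i0 = x 0 i0 /\ y 0 i1 = 0 by rewrite !mxE.
have SF : smooth_on setT F by exact: smooth_geodesic_family.
have FS u : setT u -> S3R R (F u).
  by move=> _; exact: (geodesic_family_S3R _ _ _ _ aa av aW vW a5 v5 W5 (unit1 vv) HW).
have Fy : F y = geodesic x.
  rewrite /F /geodesic /geodesic_family !mxE/= !mulr0 !mul0r cos0 sin0 !scale0r.
  by rewrite !addr0.
have F0 : partial i0 F y = g'S x + r *: dt R.
  by rewrite partial0_geodesic_family y0 y1 mulr0 cos0 !mul1r mulN1r.
have F1 : partial i1 F y = w + beta *: dt R.
  rewrite partial1_geodesic_family y1 mulr0 sin0 cos0 !mul0r mulr0 mulr1 !scale0r !add0r.
  by rewrite -wW.
have F00 : partial i0 (partial i0 F) y = - (c *: a + s *: v).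
  rewrite partial00_geodesic_family y0 y1 mulr0 cos0 mulr1 expr1n mul1r.
  by rewrite scaleN1r.
have [V [oV SV Sphi]] := isometry_smooth iso.
have jet : partial i0 (partial i0 (phi \o F)) y =
    partial i0 (partial i0 (phi \o geodesic)) x.
  have g00 : partial i0 (partial i0 geodesic) x = - (c *: a + s *: v).
    rewrite partial00_geodesic_family mul0r cos0 mulr1 expr1n !mul1r.
    by rewrite scaleN1r.
  have FV u : setT u -> V (F u) by move=> /FS /SV.
  have gV u : setT u -> V (geodesic u) by move=> /geodesic_S3R /SV.
  have EF := partial2_comp i0 i0 oT oV FV SF Sphi (I : setT y).
  have EG := partial2_comp i0 i0 oT oV gV smooth_geodesic Sphi (I : setT x).
  apply: etrans EF (etrans _ (esym EG)).
  by rewrite F00 g00 F0 (partial0_geodesic x) Fy.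
have K0 := isometry_koszul iso oT SF FS i0 i0 (I : setT y).
have K1 := isometry_koszul iso oT SF FS i0 i1 (I : setT y).
rewrite (isometry_partial iso SF FS i0 (I : setT y)) Fy F0 F00 in K0.
rewrite (isometry_partial iso SF FS i1 (I : setT y)) Fy F1 F00 in K1.
rewrite -jet.
have zE : z = la *: (g'S x + r *: dt R) + (w + beta *: dt R).
  rewrite -[LHS]sphere_partK /w /beta; apply/rowP => j; rewrite !mxE; ring.
have e0 : inner (- (c *: a + s *: v)) (g'S x + r *: dt R) = 0.
  rewrite innerNl innerDl !innerZl !(innerDr (g'S x)) /g'S !innerDr !innerZr.
  by rewrite !inner_dt a5 v5 vv aa av (innerC v a) av -/c -/s; ring.
have aw : inner a w = 0 by rewrite innerC.
have vw : inner v w = 0 by rewrite innerC.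
have e1 : inner (- (c *: a + s *: v)) (w + beta *: dt R) = 0.
  rewrite innerNl innerDl !innerZl !(innerDr w (beta *: dt R)) aw vw !innerZr.
  by rewrite !inner_dt a5 v5; ring.
rewrite zE linearD linearZ innerDr innerZr K0 K1 e0 e1; ring.
Qed.

End Geodesic.

End IsometryGeodesics.

(** * Isometries of S^3 x R are affine *)

Section IsometryAffine.
Context {R : realType}.
Implicit Types (a v w p z : 'rV[R]_5) (x y : 'rV[R]_2).

Let i0 : 'I_2 := ord0.
Let i1 : 'I_2 := ord_max.

Let oT : open (@setT 'rV[R]_2).
Proof. exact: openT. Qed.

Variable phi : 'rV[R]_5 -> 'rV[R]_5.
Hypothesis iso : isometry_S3R phi.

Section Geodesic.
Variables (a v : 'rV[R]_5) (h r : R).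
Hypotheses (aa : inner a a = 1) (vv : inner v v = 1) (av : inner a v = 0).
Hypotheses (a5 : a 0 ord_max = 0) (v5 : v 0 ord_max = 0).

Let g := geodesic a v h r.
Let sigma := phi \o g.

Let Sg : smooth_on setT g.
Proof. exact: smooth_geodesic. Qed.

Let gS x : setT x -> S3R R (g x).
Proof. exact: geodesic_S3R. Qed.

Let Ssigma : smooth_on setT sigma.
Proof. exact: isometry_comp_smooth. Qed.

Let dsigma x : differentiable sigma x.
Proof. exact: (smooth_differentiable Ssigma). Qed.

Let dpsigma i x : differentiable (partial i sigma) x.
Proof. exact: (smooth_differentiable (smooth_partial i Ssigma)). Qed.

Let partial1_sigma x : partial i1 sigma x = 0.
Proof.
by rewrite (isometry_partial iso Sg gS i1 (I : setT x)) partial1_geodesic linear0.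
Qed.

Let partial10_sigma x : partial i1 (partial i0 sigma) x = 0.
Proof.
rewrite (partial_symmetric_row i1 i0 oT (I : setT x) Ssigma).
rewrite (eq_partial (g := fun=> 0) i0 oT (I : setT x)) ?partial_cst//.
Qed.

Lemma geodesic_at0 : g 0 = a + h *: dt R.
Proof.
rewrite /g /geodesic /geodesic_family !mxE !mulr0 cos0 sin0 !mulr0 !scale0r !addr0.
by rewrite mulr1 scale1r.
Qed.

(** By [isometry_geodesic_normal] and [isometry_matrix] the acceleration is orthogonal
    to all tangent vectors at the image point. *)
Lemma isometry_geodesic_acceleration x :
  let N := sphere_part (sigma x) in
  partial i0 (partial i0 sigma) x = inner (partial i0 (partial i0 sigma) x) N *: N.
Proof.
move=> N; set acc := partial i0 (partial i0 sigma) x.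
have Sp := gS (I : setT x); have [B [BB tB NB]] := isometry_matrix iso Sp.
have NN : inner (sphere_part (g x)) (sphere_part (g x)) = 1 by [].
have NN' : inner N N = 1 by exact: (isometry_stable iso Sp).
have normal z : inner acc (z *m B) = inner (inner acc N *: N) (z *m B).
  pose k := inner z (sphere_part (g x)).
  have tz : tangent_S3R (g x) (z - k *: sphere_part (g x)).
    by rewrite /tangent_S3R/= innerBl innerZl NN mulr1 subrr.
  have zE : z = (z - k *: sphere_part (g x)) + k *: sphere_part (g x) by rewrite subrK.
  have := isometry_geodesic_normal iso aa vv av a5 v5 tz.
  have := isometry_tangent iso Sp tz; rewrite /tangent_S3R/=.
  rewrite (tB _ tz) -/g -/(sigma x) -/N -/sigma -/acc => tN accB.
  rewrite zE mulmxDl -scalemxAl NB -/(sigma x) -/N.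
  move: tN accB NN'; move: (_ *m B) N acc => t n c tn ct nn.
  by rewrite !innerDr ct !innerZr !innerZl (innerC n) tn nn; ring.
apply: inner_eq => u; have -> : u = (u *m B^T) *m B.
  by rewrite -mulmxA orthogonal_trmx// mulmx1.
exact: normal.
Qed.

(** The acceleration is normal to S^3 x R, hence horizontal, so that the height has
    zero second derivative. *)
Lemma isometry_geodesic_height x : sigma x 0 ord_max =
  sigma 0 0 ord_max + x 0 i0 * partial i0 sigma 0 0 ord_max.
Proof.
pose r0 := `|x| + 1; have r00 : 0 < r0 by rewrite ltr_wpDl.
have bx : ball (0 : 'rV[R]_2) r0 x.
  by rewrite -ball_normE/= sub0r normrN /r0 ltrDl.
have ds0 y : differentiable (fun y => partial i0 sigma y 0 ord_max) y.
  exact: (differentiable_rowP _ _).1 (dpsigma i0 y) ord_max.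
have cst0 y : ball (0 : 'rV[R]_2) r0 y ->
    partial i0 sigma y 0 ord_max = partial i0 sigma 0 0 ord_max.
  move=> by_; apply: (@constant_on_ball1 _ _ (fun y => partial i0 sigma y 0 ord_max) 0 r0) => //.
  move=> w i _; rewrite -(partial_coord _ _ (dpsigma i0 w)).
  case: i => -[|[|//]] Hi.
    rewrite (_ : Ordinal Hi = i0); last exact/val_inj.
    by rewrite isometry_geodesic_acceleration mxE sphere_part5 mulr0.
  rewrite (_ : Ordinal Hi = i1); last exact/val_inj.
  by rewrite partial10_sigma mxE.
pose f y := sigma y 0 ord_max - y 0 i0 * partial i0 sigma 0 0 ord_max.
have ds y : differentiable (fun y => sigma y 0 ord_max) y.
  exact: (differentiable_rowP _ _).1 (dsigma y) ord_max.
have dl y : differentiable (fun y : 'rV[R]_2 => y 0 i0 * partial i0 sigma 0 0 ord_max) y.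
  by apply: differentiableM; [exact: differentiable_coord|exact: differentiable_cst].
have : f x = f 0.
  apply: (@constant_on_ball1 _ _ f 0 r0) => // [w _|w i bw].
    exact: (differentiableB (ds w) (dl w)).
  rewrite (partialB i (ds w) (dl w)) -(partial_coord _ _ (dsigma w)).
  have dc : differentiable (fun y : 'rV[R]_2 => y 0 i0 : R) w by exact: differentiable_coord.
  have -> : partial i (fun y : 'rV[R]_2 => y 0 i0 * partial i0 sigma 0 0 ord_max) w =
     (i0 == i)%:R * partial i0 sigma 0 0 ord_max.
    rewrite (partialM i dc (differentiable_cst _ _)) partial_coordinate.
    by rewrite [partial i (fun=> _) w]partial_cst mulr0 add0r mulrC.
  case: i => -[|[|//]] Hi.
    rewrite (_ : Ordinal Hi = i0); last exact/val_inj.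
    by rewrite eqxx mul1r cst0// subrr.
  rewrite (_ : Ordinal Hi = i1); last exact/val_inj.
  by rewrite partial1_sigma mxE mul0r subr0.
have z0 : (0 : 'rV[R]_2) 0 i0 = 0 by rewrite mxE.
by rewrite /f z0 mul0r subr0 => <-; rewrite subrK.
Qed.

End Geodesic.

(** A horizontal geodesic is closed, hence so is its image, whose height is an
    affine function and therefore constant. *)
Lemma isometry_horizontal p z : S3R R p -> tangent_S3R p z -> z 0 ord_max = 0 ->
  ('d phi p z) 0 ord_max = 0.
Proof.
move=> Sp tz z5; have [omega [W [zW W5 HW Wperp]]] := horizontal_speed z5.
have [om0|om0] := eqVneq omega 0.
  by rewrite zW om0 scale0r linear0 mxE.
have WW : inner W W = 1.
  have := HW (omega^-1 * (pi / 2)).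
  by rewrite mulrA divff// mul1r cos_pihalf sin_pihalf expr0n expr1n add0r mul1r.
have pW : inner (sphere_part p) W = 0 by rewrite innerC; exact: Wperp.
have p5 := sphere_part5 p.
have height := isometry_geodesic_height (p 0 ord_max) 0 Sp WW pW p5 W5.
(* One turn around the great circle. *)
pose x : 'rV[R]_2 := \row_j [:: pi *+ 2; 0]`_j.
have gx : geodesic (sphere_part p) W (p 0 ord_max) 0 x =
    geodesic (sphere_part p) W (p 0 ord_max) 0 0.
  rewrite /geodesic /geodesic_family; have -> : x 0 ord0 = pi *+ 2 by rewrite mxE.
  have -> : x 0 ord_max = 0 by rewrite mxE.
  by rewrite !mxE !mul1r cos2pi sin2pi cos0 sin0 !mul0r.
have := height x; rewrite /= gx => /eqP; rewrite eq_sym -subr_eq0 addrC addKr.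
have -> : x 0 i0 = pi *+ 2 by rewrite mxE.
rewrite mulf_eq0 mulrn_eq0/= gt_eqF ?pi_gt0//= => /eqP.
have gS y : setT y -> S3R R (geodesic (sphere_part p) W (p 0 ord_max) 0 y).
  exact: geodesic_S3R.
rewrite (isometry_partial iso (smooth_geodesic _ _ _ _) gS i0 (I : setT 0)).
rewrite geodesic_at0 sphere_partK partial0_geodesic mxE sin0 cos0 oppr0 !scale0r.
by rewrite add0r addr0 scale1r => H0; rewrite zW linearZ mxE H0 mulr0.
Qed.

(** The vector [dt] spans the orthogonal complement of the horizontal directions in the
    tangent space, which the differential preserves. *)
Lemma isometry_vertical p B : S3R R p -> orthogonal_mx B ->
  (forall z, tangent_S3R p z -> 'd phi p z = z *m B) ->
  sphere_part p *m B = sphere_part (phi p) ->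
  exists2 eps : R, eps * eps = 1 & dt R *m B = eps *: dt R.
Proof.
move=> Sp BB tB NB; pose d := dt R *m B^T.
have dB : d *m B = dt R by rewrite /d -mulmxA orthogonal_trmx// mulmx1.
have dN : inner d (sphere_part p) = 0.
  by rewrite -(inner_orthogonal _ _ BB) dB NB innerC inner_sphere_dt.
have dz z : tangent_S3R p z -> z 0 ord_max = 0 -> inner d z = 0.
  move=> tz z5; rewrite -(inner_orthogonal _ _ BB) dB -tB//.
  by rewrite inner_dtl isometry_horizontal.
have dE : d = d 0 ord_max *: dt R.
  have S0 : sphere_part d = 0.
    apply: inner_eq0; rewrite inner_spherel sphere_part5 mulr0 subr0.
    apply: dz; last exact: sphere_part5.
    by rewrite /tangent_S3R/= inner_spherel sphere_part5 mulr0 subr0.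
  by rewrite -{1}[d]sphere_partK S0 add0r.
have d2 : d 0 ord_max * d 0 ord_max = 1.
  have := inner_orthogonal d d BB.
  by rewrite dB dt_dt dE innerZl innerZr dt_dt mulr1 -dE => /esym.
exists (d 0 ord_max) => //.
have := dB; rewrite {1}dE -scalemxAl => /(congr1 ( *:%R (d 0 ord_max))).
by rewrite scalerA d2 scale1r.
Qed.

Section AlongGeodesic.
Variables (a v : 'rV[R]_5) (h r : R).
Hypotheses (aa : inner a a = 1) (vv : inner v v = 1) (av : inner a v = 0).
Hypotheses (a5 : a 0 ord_max = 0) (v5 : v 0 ord_max = 0).

Let g := geodesic a v h r.
Let sigma := phi \o g.
Let Sg : smooth_on setT g. Proof. exact: smooth_geodesic. Qed.
Let gS x : setT x -> S3R R (g x). Proof. exact: geodesic_S3R. Qed.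
Let Ssigma : smooth_on setT sigma. Proof. exact: isometry_comp_smooth. Qed.
Let dsigma x : differentiable sigma x. Proof. exact: (smooth_differentiable Ssigma). Qed.
Let dpsigma i x : differentiable (partial i sigma) x.
Proof. exact: (smooth_differentiable (smooth_partial i Ssigma)). Qed.

(** The image of the geodesic moves horizontally at unit speed, because the
    differential of the isometry preserves horizontal and vertical vectors. *)
Lemma isometry_geodesic_unit x :
  inner (partial i0 sigma x) (sphere_part (partial i0 sigma x)) = 1.
Proof.
have Sp := gS (I : setT x); have [B [BB tB NB]] := isometry_matrix iso Sp.
have [eps ee Bt] := isometry_vertical Sp BB tB NB.
pose w := - sin (x 0 i0) *: a + cos (x 0 i0) *: v.
have gE : partial i0 g x = w + r *: dt R by exact: partial0_geodesic.
have sE : sphere_part (g x) = cos (x 0 i0) *: a + sin (x 0 i0) *: v.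
  rewrite /g /geodesic /geodesic_family !sphere_partD !sphere_partZ sphere_part_dt.
  rewrite !mul0r cos0 !mul1r sin0 scale0r !scaler0 !addr0.
  by rewrite !sphere_part_id.
have w5 : w 0 ord_max = 0 by rewrite !mxE a5 v5 !mulr0 addr0.
have ww : inner w w = 1.
  rewrite /w !innerDl !innerDr !innerZl !innerZr aa vv av (innerC v a) av.
  by rewrite -[RHS](cos2Dsin2 (x 0 i0)); ring.
have tw : tangent_S3R (g x) w.
  rewrite /tangent_S3R/= sE /w !innerDl !innerDr !innerZl !innerZr aa vv av (innerC v a) av.
  ring.
have tt : tangent_S3R (g x) (dt R) by rewrite /tangent_S3R/= innerC inner_sphere_dt.
have -> : partial i0 sigma x = w *m B + (r * eps) *: dt R.
  rewrite (isometry_partial iso Sg gS i0 (I : setT x)) gE linearD linearZ/=.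
  by rewrite (tB _ tw) (tB _ tt) Bt scalerA.
have wB5 : (w *m B) 0 ord_max = 0 by rewrite -(tB _ tw) isometry_horizontal.
rewrite inner_spherer -!inner_dt !innerDl !innerDr !innerZl !innerZr dt_dt.
rewrite inner_dtl inner_dt wB5 (inner_orthogonal _ _ BB) ww; ring.
Qed.

Let N x := sphere_part (sigma x).

Let dN x : differentiable N x.
Proof. exact: differentiable_sphere_part. Qed.

Let pN i x : partial i N x = sphere_part (partial i sigma x).
Proof. exact: partial_sphere_part. Qed.

Let pNN x : partial i0 (partial i0 N) x = - N x.
Proof.
have E y : setT y -> partial i0 N y = sphere_part (partial i0 sigma y) by move=> _; exact: pN.
rewrite (eq_partial i0 oT (I : setT x) E) (partial_sphere_part i0 (dpsigma i0 x)).
have tang y : setT y -> inner (partial i0 sigma y) (N y) = 0.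
  move=> Ty; apply: (tangent_partial i0 oT Ty) => u Tu; first exact: dsigma.
  exact/(isometry_stable iso)/gS.
have := partial_inner i0 (dpsigma i0 x) (dN x).
rewrite (eq_partial (g := fun=> 0 : R) i0 oT (I : setT x) tang) partial_cst pN.
rewrite isometry_geodesic_unit => /esym/eqP; rewrite addr_eq0 => /eqP accN.
rewrite (isometry_geodesic_acceleration h r aa vv av a5 v5) -/g -/sigma -/(N x) accN.
by rewrite sphere_partZ sphere_part_id ?sphere_part5// scaleN1r.
Qed.

(** The spherical part [N] of the image has unit speed and normal acceleration, hence
    [N'' = - N]; the height is affine. *)
Lemma isometry_along_geodesic B eps : orthogonal_mx B ->
  (forall z, tangent_S3R (a + h *: dt R) z -> 'd phi (a + h *: dt R) z = z *m B) ->
  a *m B = sphere_part (phi (a + h *: dt R)) -> dt R *m B = eps *: dt R ->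
  forall x, sigma x = (cos (x 0 i0) *: a + sin (x 0 i0) *: v) *m B +
    (phi (a + h *: dt R) 0 ord_max + x 0 i0 * (r * eps)) *: dt R.
Proof.
move=> BB tB aB Bt x.
have g0 : g 0 = a + h *: dt R by exact: geodesic_at0.
have aS : sphere_part (a + h *: dt R) = a.
  by rewrite sphere_partD sphere_partZ sphere_part_dt scaler0 addr0 sphere_part_id.
have tv : tangent_S3R (a + h *: dt R) v by rewrite /tangent_S3R/= aS innerC.
have tt : tangent_S3R (a + h *: dt R) (dt R) by rewrite /tangent_S3R/= innerC inner_sphere_dt.
have s0 : partial i0 sigma 0 = v *m B + (r * eps) *: dt R.
  rewrite (isometry_partial iso Sg gS i0 (I : setT 0)) g0 partial0_geodesic.
  rewrite mxE sin0 cos0 oppr0 scale0r add0r scale1r linearD linearZ/=.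
  by rewrite (tB _ tv) (tB _ tt) Bt scalerA.
have vB5 : (v *m B) 0 ord_max = 0.
  rewrite -(tB _ tv) isometry_horizontal//; rewrite -g0; exact: gS.
have E0 : sphere_part (phi (g 0)) = a *m B by rewrite g0 aB.
have E1 : partial i0 N 0 = v *m B.
  rewrite pN s0 sphere_partD sphere_partZ sphere_part_dt scaler0 addr0.
  by rewrite sphere_part_id.
have NE : N x = cos (x 0 i0) *: N 0 + sin (x 0 i0) *: partial i0 N 0.
  pose alpha (i : 'I_2) (y : 'rV[R]_2) : R := (i0 == i)%:R.
  pose r0 := `|x| + 1; have r00 : 0 < r0 by rewrite ltr_wpDl.
  have SN : smooth_on setT N.
    have -> : N = fun y => sigma y *m (1%:M - (dt R)^T *m dt R) + 0.
      apply/funext => y; rewrite addr0 mulmxBr mulmx1 mulmxA inner_mulmx mul_scalar_mx.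
      by rewrite /N sphere_partE.
    have SA := @smooth_affine R 5 5 (1%:M - (dt R)^T *m dt R) 0 setT openT.
    exact: (smooth_comp oT openT (fun _ _ => I) Ssigma SA).
  have dpN y : differentiable (partial i0 N) y.
    exact: (smooth_differentiable (smooth_partial i0 SN)).
  have p1 y : partial i1 N y = 0.
    rewrite pN (isometry_partial iso Sg gS i1 (I : setT y)) partial1_geodesic linear0.
    by rewrite -(scale0r (0 : 'rV[R]_5)) sphere_partZ !scale0r.
  have p10 y : partial i1 (partial i0 N) y = 0.
    rewrite (partial_symmetric_row i1 i0 oT (I : setT y) SN).
    rewrite (eq_partial (g := fun=> 0) i0 oT (I : setT y)) ?partial_cst//.
  apply: (@rotation_equation _ _ _ N (partial i0 N) (fun y => y 0 i0) alpha 0 r0 x r00).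
  - by move=> w _; exact: dN.
  - by move=> w _; exact: dpN.
  - by move=> w _; exact: differentiable_coord.
  - move=> w i _; case: i => -[|[|//]] Hi.
      by rewrite (_ : Ordinal Hi = i0) ?/alpha ?eqxx ?scale1r//; exact/val_inj.
    by rewrite (_ : Ordinal Hi = i1) ?p1 ?/alpha ?scale0r//; exact/val_inj.
  - move=> w i _; case: i => -[|[|//]] Hi.
      by rewrite (_ : Ordinal Hi = i0) ?pNN ?/alpha ?eqxx ?scaleN1r//; exact/val_inj.
    by rewrite (_ : Ordinal Hi = i1) ?p10 ?/alpha ?oppr0 ?scale0r//; exact/val_inj.
  - by move=> w i _; rewrite partial_coordinate.
  - by rewrite mxE.
  - by rewrite -ball_normE/= sub0r normrN /r0 ltrDl.
have s05 : partial i0 sigma 0 0 ord_max = r * eps.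
  by rewrite s0 !mxE; move: vB5; rewrite mxE => ->; rewrite !eqxx mulr1 add0r.
have sigma0 : sigma 0 = phi (a + h *: dt R) by rewrite /sigma /= g0.
have H5 : sigma x 0 ord_max = phi (a + h *: dt R) 0 ord_max + x 0 i0 * (r * eps).
  rewrite -sigma0 -s05; exact: isometry_geodesic_height.
have N0 : N 0 = a *m B by rewrite /N sigma0 aB.
by rewrite -[LHS]sphere_partK -/(N x) NE E1 N0 H5 mulmxDl -!scalemxAl.
Qed.

End AlongGeodesic.

(** Every point of S^3 x R lies on a geodesic through a fixed one, along which
    [isometry_along_geodesic] determines the map. *)
Theorem isometry_affine : exists L beta eps, [/\ orthogonal_mx L,
  dt R *m L = eps *: dt R, eps * eps = 1 &
  forall q, S3R R q -> phi q = q *m L + beta *: dt R].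
Proof.
pose a : 'rV[R]_5 := delta_mx 0 ord0.
have a5 : a 0 ord_max = 0 by rewrite mxE.
have aa : inner a a = 1 by rewrite inner_delta mxE !eqxx.
have Sa : S3R R (a + 0 *: dt R) by apply/S3RE; rewrite scale0r addr0 sphere_part_id.
have [L [LL tL NL]] := isometry_matrix iso Sa.
have [eps ee Lt] := isometry_vertical Sa LL tL NL.
exists L, (phi (a + 0 *: dt R) 0 ord_max), eps; split=> // q Sq.
suff [v [t [[vv av v5 t0] qE]]] : exists v t,
    [/\ inner v v = 1, inner a v = 0, v 0 ord_max = 0 & t != 0] /\
    sphere_part q = cos t *: a + sin t *: v.
  pose x : 'rV[R]_2 := \row_j [:: t; 0]`_j.
  have x0 : x 0 i0 = t by rewrite mxE.
  have aL : a *m L = sphere_part (phi (a + 0 *: dt R)).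
    by rewrite -NL scale0r addr0 sphere_part_id.
  have := isometry_along_geodesic (q 0 ord_max / t) aa vv av a5 v5 LL tL aL Lt x.
  rewrite x0 -qE /= => E.
  have gq : geodesic a v 0 (q 0 ord_max / t) x = q.
    rewrite /geodesic /geodesic_family x0 !mul0r cos0 !mul1r sin0 scale0r addr0 -qE.
    by rewrite add0r addr0 divfK// sphere_partK.
  have qL : q *m L = sphere_part q *m L + (q 0 ord_max * eps) *: dt R.
    by rewrite -{1}[q]sphere_partK mulmxDl -scalemxAl Lt scalerA.
  rewrite gq in E; rewrite E qL -addrA; congr (_ + _).
  by rewrite -scalerDl; congr (_ *: _); field.
set u := sphere_part q; have u5 : u 0 ord_max = 0 by exact: sphere_part5.
have uu : inner u u = 1 by [].
clearbody u.
pose ka := inner u a; pose w := u - ka *: a.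
have w5 : w 0 ord_max = 0.
  by rewrite -inner_dt /w innerBl innerZl !inner_dt u5 a5 mulr0 subr0.
have aw : inner a w = 0 by rewrite innerBr innerZr aa innerC -/ka mulr1 subrr.
have ww : inner w w = 1 - ka ^+ 2.
  rewrite /w innerBl !innerBr !innerZl !innerZr uu (innerC a u) -/ka aa; ring.
have uE : u = ka *: a + w by rewrite addrC subrK.
(* If [u] is [a] or [- a] any direction will do; a full turn rather than none leads
   to [a], because the height has to be reached at a nonzero parameter. *)
have [w0|w0] := eqVneq w 0.
  have vv : inner (delta_mx 0 (inord 1)) (delta_mx 0 (inord 1) : 'rV[R]_5) = 1.
    by rewrite inner_delta mxE !eqxx.
  have av : inner a (delta_mx 0 (inord 1)) = 0.
    by rewrite inner_delta mxE/= -val_eqE/= inordK.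
  have v5 : (delta_mx 0 (inord 1) : 'rV[R]_5) 0 ord_max = 0.
    by rewrite mxE/= -val_eqE/= inordK.
  have : ka ^+ 2 = 1 by apply/eqP; rewrite eq_sym -subr_eq0 -ww w0 inner0l.
  move=> /eqP; rewrite sqrf_eq1 => /orP[]/eqP kE.
    exists (delta_mx 0 (inord 1)), (pi *+ 2); split.
      by split=> //; rewrite mulrn_eq0/= gt_eqF// pi_gt0.
    by rewrite uE w0 kE cos2pi sin2pi scale0r.
  exists (delta_mx 0 (inord 1)), pi; split.
    by split=> //; rewrite gt_eqF// pi_gt0.
  by rewrite uE w0 kE cospi sinpi scale0r.
have ww0 := inner_gt0 w0; rewrite ww in ww0.
have kI : -1 <= ka <= 1.
  by apply/andP; split; nra.
have ct : cos (acos ka) = ka by have [_] := acos_def kI.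
have st : sin (acos ka) = Num.sqrt (1 - ka ^+ 2) by exact: sin_acos.
have s0 : Num.sqrt (1 - ka ^+ 2) != 0 by rewrite gt_eqF// sqrtr_gt0.
exists ((Num.sqrt (1 - ka ^+ 2))^-1 *: w), (acos ka); split; last first.
  by rewrite ct st scalerA divff// scale1r.
split.
- rewrite innerZl innerZr ww -{3}(sqr_sqrtr (ltW ww0)); field.
  exact: s0.
- by rewrite innerZr aw mulr0.
- by rewrite mxE w5 mulr0.
- by apply: contra_neq s0 => t0; rewrite -st t0 sin0.
Qed.

End IsometryAffine.

(** * Mean curvature *)

Section TraceFormula.
Context {R : realType}.

(** If the rows of [P] express the coordinate vectors in an orthonormal basis, then
    [P *m P^T] is the metric and [A] is the form in that basis. *)
Lemma trace_metric n (P A : 'M[R]_n) : P \in unitmx ->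
  \sum_i \sum_j invmx (P *m P^T) i j * (P *m A *m P^T) i j = \tr A.
Proof.
move=> uP; have uPT : P^T \in unitmx by rewrite unitmx_tr.
have -> : invmx (P *m P^T) = invmx P^T *m invmx P.
  have uPP : P *m P^T \in unitmx by rewrite unitmx_mul uP.
  apply: (can_inj (mulmxK uPP)); rewrite mulVmx// -mulmxA mulKmx// mulVmx//.
set Q := invmx P^T *m invmx P.
have QT : Q^T = Q by rewrite /Q trmx_mul !trmx_inv trmxK.
transitivity (\tr (Q *m (P *m A *m P^T))).
  rewrite /mxtrace exchange_big/=; apply: eq_bigr => j _.
  by rewrite mxE; apply: eq_bigr => i _; rewrite -{1}QT mxE.
rewrite /Q -!mulmxA mulKmx// mxtrace_mulC -mulmxA mulmxV//.
by rewrite mulmx1.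
Qed.

End TraceFormula.

Section MeanCurvature.
Context {R : realType}.
Variables (f : 'rV[R]_2 -> 'rV[R]_5) (x : 'rV[R]_2).
Implicit Types (v w : 'rV[R]_5).

Lemma metric_unit : differentiable f x -> injective ('d f x) ->
  metric f x \in unitmx.
Proof.
move=> df inj_df; rewrite -row_free_unit; apply: inj_row_free => v vg.
have rowJ i : row i (jacobian f x) = partial i f x.
  by apply/rowP => k; rewrite mxE jacobianE.
have gE : metric f x = jacobian f x *m (jacobian f x)^T.
  by apply/matrixP => i j; rewrite mulmx_trmx_entry !rowJ mxE.
have vJ : v *m jacobian f x = 0.
  apply: inner_eq0.
  have : v *m metric f x *m v^T = 0 by rewrite vg mul0mx.
  rewrite gE mulmxA -mulmxA -trmx_mul inner_mulmx.
  by move/(congr1 (fun M : 'M[R]_1 => M 0 0)); rewrite !mxE eqxx mulr1n.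
by apply: inj_df; rewrite linear0 diff_jacobian.
Qed.

Lemma tangent_planeP w : differentiable f x ->
  tangent_plane f x w <-> exists v : 'rV[R]_2, w = \sum_i v 0 i *: partial i f x.
Proof.
move=> df; split=> [[v _ <-]|[v ->]]; exists v => //; first exact: diff_partial.
exact: diff_partial.
Qed.

Lemma inner_proj_tangent v k : metric f x \in unitmx ->
  inner (proj_tangent f x v) (partial k f x) = inner v (partial k f x).
Proof.
move=> ug; rewrite /proj_tangent inner_suml.
transitivity (\sum_i inner v (partial i f x) * (invmx (metric f x) *m metric f x) i k).
  apply: eq_bigr => i _; rewrite inner_suml mxE mulr_sumr; apply: eq_bigr => j _.
  by rewrite innerZl [metric f x j k]mxE; ring.
rewrite mulVmx// (bigD1 k)//= big1 ?addr0 => [|i ik]; rewrite mxE.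
  by rewrite eqxx mulr1.
by rewrite (negbTE ik) mulr0.
Qed.

Lemma proj_tangent_normal v w : (forall k, inner (partial k f x) w = 0) ->
  inner (proj_tangent f x v) w = 0.
Proof.
move=> fw; rewrite /proj_tangent inner_suml big1// => i _.
by rewrite inner_suml big1// => j _; rewrite innerZl fw mulr0.
Qed.

Lemma second_fundamental_form_normal i j w :
  inner (sphere_part (f x)) w = 0 -> (forall k, inner (partial k f x) w = 0) ->
  inner (second_fundamental_form f x i j) w = inner (partial i (partial j f) x) w.
Proof.
move=> Nw fw; rewrite /second_fundamental_form innerBl proj_tangent_normal// subr0.
by rewrite /proj_S3R innerBl innerZl Nw mulr0 subr0.
Qed.

Lemma inner_mean_curvature w :
  inner (mean_curvature f x) w = 2^-1 * \sum_i \sum_j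
    invmx (metric f x) i j * inner (second_fundamental_form f x i j) w.
Proof.
rewrite /mean_curvature innerZl inner_suml; congr (_ * _).
by apply: eq_bigr => i _; rewrite inner_suml; apply: eq_bigr => j _; rewrite innerZl.
Qed.

Lemma mean_curvature_normal w :
  inner (sphere_part (f x)) w = 0 -> (forall k, inner (partial k f x) w = 0) ->
  inner (mean_curvature f x) w = 2^-1 * \sum_i \sum_j
    invmx (metric f x) i j * inner (partial i (partial j f) x) w.
Proof.
move=> Nw fw; rewrite inner_mean_curvature; congr (_ * _).
apply: eq_bigr => i _; apply: eq_bigr => j _; congr (_ * _).
exact: second_fundamental_form_normal.
Qed.

(** The mean curvature vector is itself normal, hence it vanishes as soon as it
    is orthogonal to all normal vectors. *)
Lemma mean_curvature_eq0 : S3R R (f x) -> metric f x \in unitmx ->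
  (forall k, inner (partial k f x) (sphere_part (f x)) = 0) ->
  (forall w, inner (sphere_part (f x)) w = 0 ->
     (forall k, inner (partial k f x) w = 0) ->
     \sum_i \sum_j invmx (metric f x) i j * inner (partial i (partial j f) x) w = 0) ->
  mean_curvature f x = 0.
Proof.
move=> Sx ug fN Hw.
have NN : inner (sphere_part (f x)) (sphere_part (f x)) = 1 by [].
have HN : inner (mean_curvature f x) (sphere_part (f x)) = 0.
  rewrite inner_mean_curvature big1 ?mulr0// => i _; rewrite big1// => j _.
  rewrite /second_fundamental_form innerBl proj_tangent_normal// subr0.
  by rewrite /proj_S3R innerBl innerZl NN mulr1 subrr mulr0.
have Hf k : inner (mean_curvature f x) (partial k f x) = 0.
  rewrite inner_mean_curvature big1 ?mulr0// => i _; rewrite big1// => j _.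
  by rewrite /second_fundamental_form innerBl inner_proj_tangent// subrr mulr0.
apply: inner_eq0; rewrite mean_curvature_normal.
- by rewrite Hw ?mulr0// => [|k]; rewrite innerC.
- by rewrite innerC.
- by move=> k; rewrite innerC.
Qed.

End MeanCurvature.

(** * The model tori *)

Section Rotation.
Context {R : realType}.
Implicit Types (V Z : 'rV[R]_5) (u : 'rV[R]_2).

Let i0 : 'I_2 := ord0.
Let i1 : 'I_2 := ord_max.

Definition linear_form (p q : R) u : R := p * u 0 i0 + q * u 0 i1.

Definition rotating (p q : R) V V' u : 'rV[R]_5 :=
  cos (linear_form p q u) *: V + sin (linear_form p q u) *: V'.

Lemma ord2P (P : 'I_2 -> Prop) : P i0 -> P i1 -> forall i, P i.
Proof.
move=> P0 P1; case=> -[|[|//]] Hi.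
  by rewrite (_ : Ordinal Hi = i0)//; exact/val_inj.
by rewrite (_ : Ordinal Hi = i1)//; exact/val_inj.
Qed.

Lemma sum_ord2 (S : nmodType) (F : 'I_2 -> S) : \sum_i F i = F i0 + F i1.
Proof.
rewrite !big_ord_recl big_ord0 addr0; congr (_ + F _); exact/val_inj.
Qed.

Lemma Ck_linear_form k p q : Ck k setT (linear_form p q).
Proof.
have oT : open (@setT 'rV[R]_2) by exact: openT.
by rewrite /linear_form; smoothness oT.
Qed.

Lemma partial_linear_form p q i u :
  partial i (linear_form p q) u = if i == i0 then p else q.
Proof.
have d (c : R) j : differentiable (fun u : 'rV[R]_2 => c * u 0 j) u.
  by apply: differentiableM; [exact: differentiable_cst|exact: differentiable_coord].
have pl (c : R) j : partial i (fun u : 'rV[R]_2 => c * u 0 j) u = c * (j == i)%:R.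
  rewrite (partialZ i c (f := fun u : 'rV[R]_2 => u 0 j : R)) ?partial_coordinate//.
  exact: differentiable_coord.
rewrite (partialD i (d p i0) (d q i1)) !pl; move: i {pl}.
by apply: ord2P; rewrite /= ?mulr1 ?mulr0 ?addr0 ?add0r.
Qed.

Lemma Ck_rotating k p q V V' : Ck k setT (rotating p q V V').
Proof.
have oT : open (@setT 'rV[R]_2) by exact: openT.
have Cl := Ck_linear_form k p q.
by rewrite /rotating; smoothness oT.
Qed.

Lemma partial_rotating p q V V' i u : partial i (rotating p q V V') u =
  (if i == i0 then p else q) *: rotating p q V' (- V) u.
Proof.
have dl := Ck_differentiable (Ck_linear_form 0 p q) (I : setT u).
have dc := differentiable_cos dl; have ds := differentiable_sin dl.
rewrite (partialD i (differentiableZl _ dc) (differentiableZl _ ds)).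
rewrite (partial_scalel i V dc) (partial_scalel i V' ds).
rewrite (partial_cos i dl) (partial_sin i dl) partial_linear_form /rotating.
by apply/rowP => j; rewrite !mxE; ring.
Qed.

Lemma inner_rotating p q V V' Z Z' u : inner (rotating p q V V' u) (rotating p q Z Z' u) =
  cos (linear_form p q u) ^+ 2 * inner V Z + sin (linear_form p q u) ^+ 2 * inner V' Z' +
  cos (linear_form p q u) * sin (linear_form p q u) * (inner V Z' + inner V' Z).
Proof.
by rewrite /rotating !innerDl !innerDr !innerZl !innerZr; ring.
Qed.

Lemma inner_rotating_eq0 p q V V' u Z : inner V Z = 0 -> inner V' Z = 0 ->
  inner (rotating p q V V' u) Z = 0.
Proof. by move=> VZ V'Z; rewrite /rotating innerDl !innerZl VZ V'Z; ring. Qed.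

End Rotation.

Section Torus.
Context {R : realType}.
Implicit Types (u : 'rV[R]_2).

Let i0 : 'I_2 := ord0.
Let i1 : 'I_2 := ord_max.

Variables (v v' w w' : 'rV[R]_5) (a1 a2 m1 n2 m2 n1 s h K : R).

(** The model in a general orthonormal frame: two circles of radii [a1] and [a2],
    and a linear height. *)
Definition torus u : 'rV[R]_5 :=
  rotating m1 n2 (a1 *: v) (a1 *: v') u + rotating m2 (- n1) (a2 *: w) (a2 *: w') u +
  (h + linear_form s 0 u) *: dt R.

Lemma Ck_torus k : Ck k setT torus.
Proof.
have oT : open (@setT 'rV[R]_2) by exact: openT.
have C1 := Ck_rotating k m1 n2 (a1 *: v) (a1 *: v').
have C2 := Ck_rotating k m2 (- n1) (a2 *: w) (a2 *: w').
have C3 := Ck_linear_form k s 0.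
by rewrite /torus; smoothness oT.
Qed.

Lemma smooth_torus : smooth_on setT torus.
Proof. by apply/smooth_onP => k; exact: Ck_torus. Qed.

Lemma partial_torus i u : partial i torus u =
  (if i == i0 then m1 else n2) *: rotating m1 n2 (a1 *: v') (- (a1 *: v)) u +
  (if i == i0 then m2 else - n1) *: rotating m2 (- n1) (a2 *: w') (- (a2 *: w)) u +
  (if i == i0 then s else 0) *: dt R.
Proof.
have d1 := Ck_differentiable (Ck_rotating 0 m1 n2 (a1 *: v) (a1 *: v')) (I : setT u).
have d2 := Ck_differentiable (Ck_rotating 0 m2 (- n1) (a2 *: w) (a2 *: w')) (I : setT u).
have dl := Ck_differentiable (Ck_linear_form 0 s 0) (I : setT u).
have dh : differentiable (fun=> h : R) u by exact: differentiable_cst.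
have d3 := differentiableD dh dl.
rewrite (partialD i (differentiableD d1 d2) (differentiableZl _ d3)) (partialD i d1 d2).
rewrite (partial_scalel i _ d3) (partialD i dh dl) partial_cst add0r.
by rewrite !partial_rotating partial_linear_form.
Qed.

Lemma partial2_torus i u : partial i (partial i torus) u =
  - ((if i == i0 then m1 else n2) ^+ 2 *: rotating m1 n2 (a1 *: v) (a1 *: v') u +
     (if i == i0 then m2 else - n1) ^+ 2 *: rotating m2 (- n1) (a2 *: w) (a2 *: w') u).
Proof.
set c := if i == i0 then m1 else n2; set d := if i == i0 then m2 else - n1.
have d1 := Ck_differentiable (Ck_rotating 0 m1 n2 (a1 *: v') (- (a1 *: v))) (I : setT u).
have d2 := Ck_differentiable (Ck_rotating 0 m2 (- n1) (a2 *: w') (- (a2 *: w))) (I : setT u).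
have E y : setT y -> partial i torus y =
    c *: rotating m1 n2 (a1 *: v') (- (a1 *: v)) y +
    d *: rotating m2 (- n1) (a2 *: w') (- (a2 *: w)) y +
    (if i == i0 then s else 0) *: dt R by move=> _; exact: partial_torus.
rewrite (eq_partial i openT (I : setT u) E).
have dk : differentiable (fun=> (if i == i0 then s else 0) *: dt R) u.
  exact: differentiable_cst.
rewrite (partialD i (differentiableD (differentiableZ c d1) (differentiableZ d d2)) dk).
rewrite (partialD i (differentiableZ c d1) (differentiableZ d d2)).
rewrite (partialZ i c d1) (partialZ i d d2) partial_cst addr0 !partial_rotating -/c -/d.
by rewrite /rotating; apply/rowP => j; rewrite !mxE; ring.
Qed.

Hypothesis frame : orthonormal_frame v v' w w'.
Hypotheses (a12 : a1 ^+ 2 + a2 ^+ 2 = 1)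
  (metric00 : a1 ^+ 2 * m1 ^+ 2 + a2 ^+ 2 * m2 ^+ 2 + s ^+ 2 = 1)
  (metric11 : a1 ^+ 2 * n2 ^+ 2 + a2 ^+ 2 * n1 ^+ 2 = 1)
  (metric01 : a1 ^+ 2 * (m1 * n2) = a2 ^+ 2 * (m2 * n1))
  (trace1 : m1 ^+ 2 + n2 ^+ 2 = K) (trace2 : m2 ^+ 2 + n1 ^+ 2 = K).

Lemma sphere_part_torus u : sphere_part (torus u) =
  rotating m1 n2 (a1 *: v) (a1 *: v') u + rotating m2 (- n1) (a2 *: w) (a2 *: w') u.
Proof.
have [_ _ _ [vt v't wt w't]] := frame.
rewrite /torus; set A := rotating m1 _ _ _ u; set B := rotating m2 _ _ _ u.
have A5 : A 0 ord_max = 0 by rewrite -inner_dt inner_rotating_eq0// innerZl ?vt ?v't mulr0.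
have B5 : B 0 ord_max = 0 by rewrite -inner_dt inner_rotating_eq0// innerZl ?wt ?w't mulr0.
clearbody A B; rewrite !sphere_partD sphere_partZ sphere_part_dt scaler0 addr0.
by rewrite !sphere_part_id.
Qed.

Lemma torus_S3R u : S3R R (torus u).
Proof.
have [[vv v'v' ww w'w'] [vv' vw vw'] [v'w v'w' ww'] _] := frame.
apply/S3RE; rewrite sphere_part_torus.
have AA := inner_rotating m1 n2 (a1 *: v) (a1 *: v') (a1 *: v) (a1 *: v') u.
have BB := inner_rotating m2 (- n1) (a2 *: w) (a2 *: w') (a2 *: w) (a2 *: w') u.
have AB : inner (rotating m1 n2 (a1 *: v) (a1 *: v') u)
    (rotating m2 (- n1) (a2 *: w) (a2 *: w') u) = 0.
  rewrite /rotating !innerDl !innerDr !innerZl !innerZr vw vw' v'w v'w'; ring.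
move: AA BB AB; move: (rotating m1 _ _ _ u) (rotating m2 _ _ _ u) => A B AA BB AB.
rewrite innerDl !innerDr AB (innerC B) AB AA BB.
rewrite !innerZl !innerZr vv v'v' ww w'w' vv' ww' (innerC v' v) vv' (innerC w' w) ww'.
transitivity (a1 ^+ 2 * (cos (linear_form m1 n2 u) ^+ 2 + sin (linear_form m1 n2 u) ^+ 2) +
  a2 ^+ 2 * (cos (linear_form m2 (- n1) u) ^+ 2 + sin (linear_form m2 (- n1) u) ^+ 2)).
  by ring.
by rewrite !cos2Dsin2 !mulr1.
Qed.

Let tangents u : [/\
  inner (rotating m1 n2 (a1 *: v') (- (a1 *: v)) u)
    (rotating m1 n2 (a1 *: v') (- (a1 *: v)) u) = a1 ^+ 2,
  inner (rotating m2 (- n1) (a2 *: w') (- (a2 *: w)) u)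
    (rotating m2 (- n1) (a2 *: w') (- (a2 *: w)) u) = a2 ^+ 2,
  inner (rotating m1 n2 (a1 *: v') (- (a1 *: v)) u)
    (rotating m2 (- n1) (a2 *: w') (- (a2 *: w)) u) = 0,
  inner (rotating m1 n2 (a1 *: v') (- (a1 *: v)) u) (dt R) = 0 &
  inner (rotating m2 (- n1) (a2 *: w') (- (a2 *: w)) u) (dt R) = 0].
Proof.
have [[vv v'v' ww w'w'] [vv' vw vw'] [v'w v'w' ww'] [vt v't wt w't]] := frame.
split; rewrite ?inner_rotating /rotating !inner_linear.
- rewrite (innerC v' v) vv' vv v'v'.
  transitivity (a1 ^+ 2 * (cos (linear_form m1 n2 u) ^+ 2 + sin (linear_form m1 n2 u) ^+ 2)).
    by ring.
  by rewrite cos2Dsin2 mulr1.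
- rewrite (innerC w' w) ww' ww w'w'.
  transitivity (a2 ^+ 2 * (cos (linear_form m2 (- n1) u) ^+ 2 + sin (linear_form m2 (- n1) u) ^+ 2)).
    by ring.
  by rewrite cos2Dsin2 mulr1.
- by rewrite vw vw' v'w v'w'; ring.
- by rewrite vt v't; ring.
- by rewrite wt w't; ring.
Qed.

Lemma torus_dt i u : inner (partial i torus u) (dt R) = if i == i0 then s else 0.
Proof.
have [_ _ _ At Bt] := tangents u; rewrite partial_torus.
move: At Bt; move: (rotating m1 _ _ _ u) (rotating m2 _ _ _ u) => A B At Bt.
by rewrite !innerDl !innerZl At Bt dt_dt; ring.
Qed.

Lemma torus_metric i j u :
  inner (partial i torus u) (partial j torus u) = (i == j)%:R.
Proof.
have [AA BB AB At Bt] := tangents u; rewrite !partial_torus.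
move: AA BB AB At Bt; move: (rotating m1 _ _ _ u) (rotating m2 _ _ _ u) => A B AA BB AB At Bt.
rewrite !innerDl !innerDr !innerZl !innerZr AA BB AB (innerC B A) AB.
rewrite (innerC (dt R) A) (innerC (dt R) B) At Bt dt_dt.
move: i j; apply: ord2P; apply: ord2P => /=.
- transitivity (a1 ^+ 2 * m1 ^+ 2 + a2 ^+ 2 * m2 ^+ 2 + s ^+ 2); first by ring.
  by rewrite metric00.
- transitivity (a1 ^+ 2 * (m1 * n2) - a2 ^+ 2 * (m2 * n1)); first by ring.
  by rewrite metric01 subrr.
- transitivity (a1 ^+ 2 * (m1 * n2) - a2 ^+ 2 * (m2 * n1)); first by ring.
  by rewrite metric01 subrr.
- transitivity (a1 ^+ 2 * n2 ^+ 2 + a2 ^+ 2 * n1 ^+ 2); first by ring.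
  by rewrite metric11.
Qed.

(** The two circle components are eigenfunctions for [m1^2 + n2^2] and
    [m2^2 + n1^2], which agree. *)
Lemma torus_laplacian u :
  \sum_i partial i (partial i torus) u = - K *: sphere_part (torus u).
Proof.
rewrite sum_ord2 !partial2_torus sphere_part_torus /=.
move: (rotating m1 _ _ _ u) (rotating m2 _ _ _ u) => A B.
transitivity (- ((m1 ^+ 2 + n2 ^+ 2) *: A + (m2 ^+ 2 + n1 ^+ 2) *: B)).
  by apply/rowP => j; rewrite !mxE; ring.
by rewrite trace1 trace2 -scalerDr scaleNr.
Qed.

End Torus.

(** * The parameters of the model *)

Section ModelParameters.
Context {R : realType}.
Variables (theta n : R).
Hypothesis theta_bounds : 0 < theta < pi / 2.

Lemma cos_theta_gt0 : 0 < cos theta.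
Proof.
case/andP: theta_bounds => t0 t1; apply: cos_gt0_pihalf.
by rewrite t1 andbT (lt_trans _ t0)// oppr_lt0 divr_gt0// pi_gt0.
Qed.

Lemma sin_theta_gt0 : 0 < sin theta.
Proof.
case/andP: theta_bounds => t0 t1; apply: sin_gt0_pi; rewrite t0/=.
by rewrite (lt_le_trans t1)// ler_pdivrMr// ler_peMr ?pi_ge0// ler1n.
Qed.

Hypothesis n_bounds : 1 <= n <= Num.sqrt (1 + cos theta ^+ 2).

Let c := cos theta.
Let s := sin theta.
Let c0 : 0 < c. Proof. exact: cos_theta_gt0. Qed.
Let cs : c ^+ 2 + s ^+ 2 = 1. Proof. exact: cos2Dsin2. Qed.
Let s2 : s ^+ 2 = 1 - c ^+ 2. Proof. by rewrite -cs; ring. Qed.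
Let D := 1 - n ^+ 2 * s ^+ 2.
Let E := 1 + c ^+ 2 - n ^+ 2 * s ^+ 2.
Let q := 1 + c ^+ 2 - n ^+ 2.

Let n1 : 1 <= n. Proof. by case/andP: n_bounds. Qed.
Let n0 : 0 < n. Proof. exact: lt_le_trans ltr01 n1. Qed.

Let q0 : 0 <= q.
Proof.
have [_ nq] := andP n_bounds; rewrite /q subr_ge0.
have p0 : 0 <= 1 + cos theta ^+ 2 by rewrite addr_ge0 ?sqr_ge0.
by rewrite -[leRHS](sqr_sqrtr p0) ler_sqr ?nnegrE ?sqrtr_ge0// ltW.
Qed.

Lemma model_D_gt0 : 0 < D.
Proof.
have -> : D = c ^+ 2 * c ^+ 2 + q * s ^+ 2.
  by rewrite /D /q s2; ring.
have c20 : 0 < c ^+ 2 by exact: exprn_gt0.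
by apply: ltr_pwDl; [exact: mulr_gt0|rewrite mulr_ge0 ?sqr_ge0].
Qed.

Let E0 : 0 < E.
Proof.
have -> : E = D + c ^+ 2 by rewrite /E /D; ring.
by rewrite addr_gt0 ?model_D_gt0// exprn_gt0.
Qed.

Let rD := Num.sqrt D.
Let rE := Num.sqrt E.
Let rq := Num.sqrt q.
Let rD0 : 0 < rD. Proof. by rewrite sqrtr_gt0 model_D_gt0. Qed.
Let rE0 : 0 < rE. Proof. by rewrite sqrtr_gt0. Qed.
Let rq0 : 0 <= rq. Proof. exact: sqrtr_ge0. Qed.
Let rD2 : rD ^+ 2 = D. Proof. by rewrite sqr_sqrtr// ltW// model_D_gt0. Qed.
Let rE2 : rE ^+ 2 = E. Proof. by rewrite sqr_sqrtr// ltW. Qed.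
Let rq2 : rq ^+ 2 = q. Proof. by rewrite sqr_sqrtr. Qed.

Let sqrt_of_square (a b : R) : 0 <= b -> a = b ^+ 2 -> Num.sqrt a = b.
Proof. by move=> b0 ->; rewrite sqrtr_sqr ger0_norm. Qed.

Lemma nu2E : nu2 theta n = rq / rD.
Proof.
apply: sqrt_of_square; first exact: divr_ge0 rq0 (ltW rD0).
by rewrite expr_div_n rq2 rD2.
Qed.

Lemma mu1E : mu1 theta n = n * c ^+ 2 / rD.
Proof.
apply: sqrt_of_square.
  by apply: divr_ge0 (ltW rD0); rewrite mulr_ge0 ?sqr_ge0// ltW.
by rewrite expr_div_n rD2 exprMn -exprM.
Qed.

Lemma mu2E : mu2 theta n = rq.
Proof. by []. Qed.

Lemma c1E : c1 theta n = rD / rE.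
Proof.
apply: sqrt_of_square; first exact: divr_ge0 (ltW rD0) (ltW rE0).
by rewrite expr_div_n rE2 rD2.
Qed.

Lemma c2E : c2 theta n = c / rE.
Proof.
apply: sqrt_of_square; first exact: divr_ge0 (ltW c0) (ltW rE0).
by rewrite expr_div_n rE2.
Qed.

Let rDn0 : rD != 0. Proof. by rewrite gt_eqF. Qed.
Let rEn0 : rE != 0. Proof. by rewrite gt_eqF. Qed.
Let cn0 : c != 0. Proof. by rewrite gt_eqF. Qed.

Lemma model_radii : c1 theta n ^+ 2 + c2 theta n ^+ 2 = 1.
Proof.
rewrite c1E c2E !expr_div_n rD2 rE2 -mulrDl.
have -> : D + c ^+ 2 = E by rewrite /D /E; ring.
by rewrite divff// gt_eqF.
Qed.

Lemma model_metric00 : c1 theta n ^+ 2 * mu1 theta n ^+ 2 +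
  c2 theta n ^+ 2 * mu2 theta n ^+ 2 + s ^+ 2 = 1.
Proof.
rewrite c1E c2E mu1E mu2E !expr_div_n rD2 rE2 rq2 exprMn.
have D0 : D != 0 by rewrite gt_eqF// model_D_gt0.
have En0 : E != 0 by rewrite gt_eqF.
transitivity ((n ^+ 2 * (c ^+ 2) ^+ 2 + c ^+ 2 * q) / E + s ^+ 2); first by field; rewrite En0.
have -> : n ^+ 2 * (c ^+ 2) ^+ 2 + c ^+ 2 * q = c ^+ 2 * E by rewrite /q /E s2; ring.
by rewrite mulfK.
Qed.

Lemma model_metric11 : c1 theta n ^+ 2 * nu2 theta n ^+ 2 +
  c2 theta n ^+ 2 * n ^+ 2 = 1.
Proof.
rewrite c1E c2E nu2E !expr_div_n rD2 rE2 rq2.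
have D0 : D != 0 by rewrite gt_eqF// model_D_gt0.
have En0 : E != 0 by rewrite gt_eqF.
transitivity ((q + c ^+ 2 * n ^+ 2) / E); first by field; rewrite En0.
have -> : q + c ^+ 2 * n ^+ 2 = E by rewrite /q /E s2; ring.
by rewrite divff.
Qed.

Lemma model_metric01 : c1 theta n ^+ 2 * (mu1 theta n * nu2 theta n) =
  c2 theta n ^+ 2 * (mu2 theta n * n).
Proof.
rewrite c1E c2E nu2E mu1E mu2E; field.
by rewrite rEn0 rDn0.
Qed.

Lemma model_trace1 : mu1 theta n ^+ 2 + nu2 theta n ^+ 2 = 1 + c ^+ 2.
Proof.
rewrite mu1E nu2E !expr_div_n rD2 rq2 -mulrDl.
have -> : (n * c ^+ 2) ^+ 2 + q = (1 + c ^+ 2) * D by rewrite /q /D s2; ring.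
by rewrite mulfK// gt_eqF// model_D_gt0.
Qed.

Lemma model_trace2 : mu2 theta n ^+ 2 + n ^+ 2 = 1 + c ^+ 2.
Proof. by rewrite mu2E rq2 /q subrK. Qed.

End ModelParameters.

Section ModelTorus.
Context {R : realType}.

Lemma torus_mulmx (v v' w w' : 'rV[R]_5) a1 a2 m1 n2 m2 n1 s h u L eps beta :
  dt R *m L = eps *: dt R ->
  torus v v' w w' a1 a2 m1 n2 m2 n1 s h u *m L + beta *: dt R =
  torus (v *m L) (v' *m L) (w *m L) (w' *m L) a1 a2 m1 n2 m2 n1
    (s * eps) (h * eps + beta) u.
Proof.
move=> Lt; rewrite /torus /rotating !mulmxDl -!scalemxAl Lt -[LHS]addrA (scalerA _ eps).
rewrite -scalerDl; congr (_ + _ *: _); rewrite /linear_form; ring.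
Qed.

Let d (k : nat) : 'rV[R]_5 := delta_mx 0 (inord k).

Lemma delta_frame : orthonormal_frame (d 0) (d 1) (d 2) (d 3).
Proof.
have dd i j : (i < 5)%N -> (j < 5)%N -> inner (d i) (d j) = (i == j)%:R.
  by move=> i5 j5; rewrite inner_delta mxE eqxx/= -val_eqE/= !inordK// eq_sym.
have dt_ i : (i < 4)%N -> inner (d i) (dt R) = 0.
  move=> i4; rewrite inner_dt mxE eqxx/= -val_eqE/= inordK ?(ltn_trans i4)//.
  by rewrite gtn_eqF.
by do !split; rewrite ?dd ?dt_.
Qed.

Lemma model_torus theta n (u : 'rV[R]_2) : model theta n (u 0 0) (u 0 1) =
  torus (d 0) (d 1) (d 2) (d 3) (c1 theta n) (c2 theta n) (mu1 theta n)
    (nu2 theta n) (mu2 theta n) n (sin theta) 0 u.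
Proof.
have u1 : u 0 1 = u 0 ord_max by congr (u _ _); exact/val_inj.
apply/rowP => j; rewrite u1 /torus /rotating /linear_form !mxE mul0r addr0 add0r mulNr.
have E k : (k < 5)%N -> (inord k : 'I_5) == j = (k == j).
  by move=> k5; rewrite -val_eqE/= inordK.
rewrite ![j == _]eq_sym !E// -val_eqE eqxx/=.
case: j {E} => -[|[|[|[|[|//]]]]] Hj /=; rewrite !(mulr0, mulr1, addr0, add0r) //.
all: by rewrite ?[_ * c1 _ _]mulrC ?[_ * c2 _ _]mulrC ?[_ * sin theta]mulrC.
Qed.

End ModelTorus.

(** * Reparametrizations of the tori *)

Lemma normal_component_unit (R : realType) (c s : R) (t : 'rV[R]_5) :
  inner t t = 1 -> inner t (dt R) = s -> c ^+ 2 + s ^+ 2 = 1 -> c != 0 ->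
  inner (c^-1 *: (dt R - s *: t)) (c^-1 *: (dt R - s *: t)) = 1.
Proof.
move=> tt tdt cs cn0.
rewrite innerZl innerZr innerBl !innerBr !innerZl !innerZr dt_dt tt.
rewrite (innerC (dt R)) tdt.
have c2 : c ^+ 2 = 1 - s ^+ 2 by rewrite -cs; ring.
have -> : 1 - s * s - (s * s - s * (s * 1)) = c ^+ 2 by rewrite c2; ring.
by rewrite expr2 mulKf// mulVf.
Qed.

Section Reparametrization.
Context {R : realType}.
Variables (T : 'rV[R]_2 -> 'rV[R]_5) (K eps theta : R).
Hypotheses (ST : smooth_on setT T) (TS : forall u, S3R R (T u)).
Hypothesis T_metric : forall i j u,
  inner (partial i T u) (partial j T u) = (i == j)%:R.
Hypothesis T_laplacian : forall u,
  \sum_i partial i (partial i T) u = - K *: sphere_part (T u).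
Hypothesis T_dt : forall i u, inner (partial i T u) (dt R) =
  if i == ord0 then sin theta * eps else 0.
Hypotheses (eps2 : eps * eps = 1) (theta_bounds : 0 < theta < pi / 2).

Variables (f : 'rV[R]_2 -> 'rV[R]_5) (V : set 'rV[R]_2)
  (kappa : 'rV[R]_2 -> 'rV[R]_2) (x : 'rV[R]_2).
Hypotheses (oV : open V) (Vx : V x) (Skappa : smooth_on V kappa).
Hypothesis fE : forall y, V y -> f y = T (kappa y).
Hypothesis inj_df : injective ('d f x).

Let Tk := T \o kappa.
Let i0 : 'I_2 := ord0.
Let J := jacobian kappa x.

Let nearE : \near x, Tk x = f x.
Proof. by apply: (near_open oV Vx) => y Vy; rewrite fE. Qed.

Let dk y : V y -> differentiable kappa y.
Proof. exact: smooth_differentiable Skappa. Qed.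

Let dT u : differentiable T u.
Proof. exact: (smooth_differentiable ST). Qed.

Let df : differentiable f x.
Proof.
apply: (near_differentiable nearE); exact: differentiable_comp (dk Vx) (dT _).
Qed.

Let partial_f i : partial i f x = \sum_a J i a *: partial a T (kappa x).
Proof.
rewrite (eq_partial (g := Tk) i oV Vx fE).
rewrite (partial_comp i (dk Vx) (dT _)); apply: eq_bigr => a _.
by rewrite /J (jacobianE i a (dk Vx)).
Qed.

Let partial2_f i j : partial i (partial j f) x =
  \sum_a partial i (partial j kappa) x 0 a *: partial a T (kappa x) +
  \sum_a \sum_b (J j a * J i b) *: partial b (partial a T) (kappa x).
Proof.
have E y : V y -> partial j f y = partial j Tk y.
  by move=> Vy; exact: eq_partial fE.
rewrite (eq_partial i oV Vx E).
rewrite (partial2_comp i j oV openT (fun _ _ => I) Skappa ST Vx).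
congr (_ + _); apply: eq_bigr => a _; apply: eq_bigr => b _.
by rewrite /J (jacobianE j a (dk Vx)) (jacobianE i b (dk Vx)).
Qed.

Let metric_f : metric f x = J *m J^T.
Proof.
apply/matrixP => i j; rewrite [LHS]mxE [RHS]mxE !partial_f inner_suml; apply: eq_bigr => a _.
rewrite innerC inner_suml (bigD1 a)//= big1 ?addr0 => [|b ba].
  by rewrite innerZl innerZr T_metric eqxx mulr1 mulrC [J^T a j]mxE.
by rewrite innerZl innerZr T_metric (negbTE ba) !mulr0.
Qed.

Let uJ : J \in unitmx.
Proof.
have := metric_unit df inj_df; rewrite metric_f unitmx_mul => /andP[].
exact.
Qed.

Let partial_T a : partial a T (kappa x) = \sum_i invmx J a i *: partial i f x.
Proof.
under eq_bigr => i _ do rewrite partial_f scaler_sumr.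
rewrite exchange_big/= (bigD1 a)//= [X in _ + X]big1 ?addr0 => [|b ba].
  under eq_bigr => i _ do rewrite scalerA.
  rewrite -scaler_suml; have := congr1 (fun M : 'M[R]_2 => M a a) (mulVmx uJ).
  by rewrite !mxE eqxx => ->; rewrite scale1r.
under eq_bigr => i _ do rewrite scalerA.
rewrite -scaler_suml; have := congr1 (fun M : 'M[R]_2 => M a b) (mulVmx uJ).
by rewrite !mxE eq_sym (negbTE ba) => ->; rewrite scale0r.
Qed.

Let T_normal a : inner (partial a T (kappa x)) (sphere_part (T (kappa x))) = 0.
Proof.
exact: (tangent_partial a openT (I : setT (kappa x)) (fun y _ => dT y) (fun y _ => TS y)).
Qed.

(** In the coordinates of the torus the metric is the identity, so that the trace of the
    second derivatives is the Laplacian, which is normal to S^3 x R. *)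
Lemma reparametrized_minimal : mean_curvature f x = 0.
Proof.
have fS := fE Vx.
apply: mean_curvature_eq0.
- by rewrite fS.
- exact: metric_unit.
- move=> k; rewrite fS partial_f inner_suml big1// => a _.
  by rewrite innerZl T_normal mulr0.
- move=> w Nw fw; rewrite fS in Nw.
  have Tw a : inner (partial a T (kappa x)) w = 0.
    by rewrite partial_T inner_suml big1// => i _; rewrite innerZl fw mulr0.
  pose A : 'M[R]_2 := \matrix_(b, a) inner (partial b (partial a T) (kappa x)) w.
  have fA i j : inner (partial i (partial j f) x) w = (J *m A *m J^T) i j.
    rewrite partial2_f innerDl !inner_suml big1 ?add0r => [|a _]; last first.
      by rewrite innerZl Tw mulr0.
    rewrite mxE; apply: eq_bigr => a _; rewrite inner_suml !mxE mulr_suml.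
    by apply: eq_bigr => b _; rewrite innerZl !mxE; ring.
  under eq_bigr => i _ do under eq_bigr => j _ do rewrite fA.
  rewrite metric_f trace_metric// /mxtrace.
  under eq_bigr => a _ do rewrite mxE.
  by rewrite -inner_suml T_laplacian innerZl Nw mulr0.
Qed.

(** The tangential part of [dt] is [sin theta] times the first coordinate vector of the
    torus, up to the sign [eps]. *)
Lemma reparametrized_angle : has_angle f x theta.
Proof.
case/andP: theta_bounds => t0 t1; split; first by rewrite !ltW.
have c0 := cos_theta_gt0 theta_bounds; have s0 := sin_theta_gt0 theta_bounds.
have cn0 : cos theta != 0 by rewrite gt_eqF.
pose t := eps *: partial i0 T (kappa x).
pose xi := (cos theta)^-1 *: (dt R - sin theta *: t).
have tt : inner t t = 1.
  by rewrite /t innerZl innerZr T_metric eqxx mulr1 eps2.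
have tdt : inner t (dt R) = sin theta.
  by rewrite /t innerZl T_dt eqxx mulrCA eps2 mulr1.
have tN : inner t (sphere_part (T (kappa x))) = 0 by rewrite /t innerZl T_normal mulr0.
exists t, xi; split.
- split=> //; apply/tangent_planeP => //.
  exists (eps *: row i0 (invmx J)); rewrite /t partial_T scaler_sumr.
  by apply: eq_bigr => i _; rewrite !mxE scalerA.
- split; last first.
    by apply: normal_component_unit => //; exact: cos2Dsin2.
  split.
    rewrite /tangent_S3R/= fE// /xi innerZl innerBl innerZl tN.
    by rewrite (innerC (dt R)) inner_sphere_dt; ring.
  move=> w /(tangent_planeP _ df)[v ->].
  rewrite innerC inner_suml big1// => i _; rewrite innerZl partial_f inner_suml big1 ?mulr0// => a _.
  rewrite innerZl /xi innerZr innerBr T_dt innerZr /t innerZr T_metric.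
  move: a; apply: ord2P => /=; rewrite -?(inj_eq val_inj)/=; ring.
- by rewrite /xi [cos _ *: _]scalerA divff// scale1r addrC subrK.
Qed.

End Reparametrization.

Lemma open_cinv_preimage (R : realType) (M : topologicalType) (c : chart R M)
    (A : set M) : open A -> open (ccod c `&` cinv c @^-1` A).
Proof.
move=> oA; have cc := @cinv_continuous _ _ c.
rewrite openE => x [Cx Ax].
have : {within ccod c, continuous (cinv c)} := cc.
rewrite continuous_open_subspace; last exact: ccod_open.
move=> /(_ x); rewrite inE => /(_ Cx) cx.
apply: filterI; first by apply: open_nbhs_nbhs; split=> //; exact: ccod_open.
by apply: cx; apply: open_nbhs_nbhs.
Qed.

(** The isometry in the local form is affine by [isometry_affine], so it takes the model
    to another torus, of which the surface is locally a reparametrization. *)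
Lemma locally_model_minimal_constant_angle (R : realType) (theta : R)
    (M : surface R) (F : M -> 'rV[R]_5) :
  0 < theta < pi / 2 -> immersion_S3R F -> locally_model F theta ->
  minimal F /\ constant_angle F theta.
Proof.
move=> theta_bounds [FS Fimm] [nu1 [_ [nu1_bounds loc]]].
suff H c x : atlas c -> ccod c x ->
    mean_curvature (F \o cinv c) x = 0 /\ has_angle (F \o cinv c) x theta.
  by split=> c x ac Cx; have [] := H c x ac Cx.
move=> ac Cx; have [_ inj_df] := Fimm c ac.
have [k [phi [lk kp iso FE]]] := loc (cinv c x).
have [L [beta [eps [LL Lt eps2 phiE]]]] := isometry_affine iso.
set n := nu1 (cinv c x) in FE; have nb := nu1_bounds (cinv c x); rewrite -/n in nb.
pose d (j : nat) : 'rV[R]_5 := delta_mx 0 (inord j).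
have dframe : orthonormal_frame (d 0) (d 1) (d 2) (d 3) by exact: delta_frame.
have Lframe : orthonormal_frame (d 0 *m L) (d 1 *m L) (d 2 *m L) (d 3 *m L).
  have Ldt v : inner v (dt R) = 0 -> inner (v *m L) (dt R) = 0.
    move=> v0; have dtE : dt R = (eps *: dt R) *m L.
      by rewrite -scalemxAl Lt scalerA eps2 scale1r.
    by rewrite dtE inner_orthogonal// innerZr v0 mulr0.
  have [[H1 H2 H3 H4] [H5 H6 H7] [H8 H9 H10] [H11 H12 H13 H14]] := dframe.
  by do !split; rewrite ?inner_orthogonal//; exact: Ldt.
pose T := torus (d 0 *m L) (d 1 *m L) (d 2 *m L) (d 3 *m L) (c1 theta n) (c2 theta n)
  (mu1 theta n) (nu2 theta n) (mu2 theta n) n (sin theta * eps) (0 * eps + beta).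
have m00 : c1 theta n ^+ 2 * mu1 theta n ^+ 2 + c2 theta n ^+ 2 * mu2 theta n ^+ 2 +
    (sin theta * eps) ^+ 2 = 1.
  by rewrite exprMn [eps ^+ 2]expr2 eps2 mulr1 model_metric00.
pose V := ccod c `&` cinv c @^-1` cdom k.
have oV : open V by apply: open_cinv_preimage; exact: cdom_open.
have Vx : V x by split.
have Sk : smooth_on V (k \o cinv c) by have [_] := lk c ac.
have fE y : V y -> (F \o cinv c) y = T ((k \o cinv c) y).
  move=> [Cy ky] /=; rewrite FE// model_torus phiE; last first.
    by apply: torus_S3R; [exact: delta_frame|exact: model_radii].
  by rewrite (torus_mulmx _ _ _ _ _ _ _ _ _ _ _ _ _ _ Lt).
have hT1 := smooth_torus (d 0 *m L) (d 1 *m L) (d 2 *m L) (d 3 *m L) (c1 theta n)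
  (c2 theta n) (mu1 theta n) (nu2 theta n) (mu2 theta n) n (sin theta * eps) (0 * eps + beta).
have hT2 u : S3R R (T u) by apply: torus_S3R => //; exact: model_radii.
have hT3 i j u : inner (partial i T u) (partial j T u) = (i == j)%:R.
  apply: torus_metric => //.
  - exact: model_metric11.
  - exact: model_metric01.
have hT4 u : \sum_i partial i (partial i T) u = - (1 + cos theta ^+ 2) *: sphere_part (T u).
  by apply: torus_laplacian => //; [exact: model_trace1|exact: model_trace2].
have hT5 i u : inner (partial i T u) (dt R) = if i == ord0 then sin theta * eps else 0.
  exact: torus_dt.
split.
  exact: (reparametrized_minimal hT1 hT2 hT3 hT4 oV Vx Sk fE (inj_df x Cx)).
exact: (reparametrized_angle hT1 hT2 hT3 hT5 eps2 theta_bounds oV Vx Sk fE (inj_df x Cx)).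
Qed.

(** * The adapted frame of a constant angle surface *)

Section AdaptedAlgebra.
Context {R : realType}.
Variables (f0 f1 t E e : 'rV[R]_5) (t0 t1 tau0 tau1 delta rho0 rho1 : R).
Hypotheses (tt : inner t t = 1) (tE : t = t0 *: f0 + t1 *: f1).
Hypothesis free : forall a b, a *: f0 + b *: f1 = 0 -> a = 0 /\ b = 0.
Hypotheses (tau0E : tau0 = inner t f0) (tau1E : tau1 = inner t f1)
  (EE : E = tau0 *: f1 - tau1 *: f0) (deltaE : delta = Num.sqrt (inner E E))
  (eE : e = delta^-1 *: E) (rho0E : rho0 = inner e f0) (rho1E : rho1 = inner e f1).

Let Delta := inner f0 f0 * inner f1 f1 - inner f0 f1 ^+ 2.

Let tau0_metric : tau0 = t0 * inner f0 f0 + t1 * inner f0 f1.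
Proof. by rewrite tau0E tE innerDl !innerZl (innerC f1 f0). Qed.

Let tau1_metric : tau1 = t0 * inner f0 f1 + t1 * inner f1 f1.
Proof. by rewrite tau1E tE innerDl !innerZl. Qed.

Let unit : t0 * tau0 + t1 * tau1 = 1.
Proof. by rewrite -tt {1}tE innerDl !innerZl tau0E tau1E !(innerC t). Qed.

Let Ef0 : inner E f0 = - t1 * Delta.
Proof.
by rewrite EE innerBl !innerZl tau0_metric tau1_metric /Delta (innerC f1 f0); ring.
Qed.

Let Ef1 : inner E f1 = t0 * Delta.
Proof. by rewrite EE innerBl !innerZl tau0_metric tau1_metric /Delta; ring. Qed.

Let EE_Delta : inner E E = Delta.
Proof.
rewrite {2}EE innerBr !innerZr Ef0 Ef1.
transitivity ((t0 * tau0 + t1 * tau1) * Delta); first by ring.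
by rewrite unit mul1r.
Qed.

Lemma adapted_normal_gt0 : 0 < inner E E.
Proof.
apply: inner_gt0; apply/eqP => E0.
have := @free (- tau1) tau0; rewrite scaleNr addrC -EE => /(_ E0) [/eqP].
rewrite oppr_eq0 => /eqP h1 h0; move: unit; rewrite h0 h1 !mulr0 addr0.
by move=> /eqP; rewrite eq_sym oner_eq0.
Qed.

Let delta0 : delta != 0.
Proof. by rewrite deltaE gt_eqF// sqrtr_gt0 adapted_normal_gt0. Qed.

Let delta2 : delta * delta = Delta.
Proof. by rewrite -expr2 deltaE sqr_sqrtr ?inner_ge0. Qed.

Let rho0_metric : rho0 = - t1 * delta.
Proof. by rewrite rho0E eE innerZl Ef0 -delta2; field. Qed.

Let rho1_metric : rho1 = t0 * delta.
Proof. by rewrite rho1E eE innerZl Ef1 -delta2; field. Qed.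

(** The determinant of the coframe is the area of the coordinate parallelogram, which is
    the length of [E]. *)
Lemma adapted_delta : tau0 * rho1 - tau1 * rho0 = delta.
Proof.
rewrite rho0_metric rho1_metric.
transitivity ((t0 * tau0 + t1 * tau1) * delta); last by rewrite unit mul1r.
by ring.
Qed.

Lemma adapted_tangent : t = delta^-1 *: (rho1 *: f0 - rho0 *: f1).
Proof.
rewrite rho0_metric rho1_metric tE scalerBr !scalerA -scaleNr.
by congr (_ *: _ + _ *: _); field.
Qed.

Lemma adapted_expansion0 : f0 = tau0 *: t + rho0 *: e.
Proof.
rewrite adapted_tangent eE EE; apply/rowP => j; rewrite !mxE.
transitivity (delta^-1 * (tau0 * rho1 - tau1 * rho0) * f0 0 j).
  by rewrite adapted_delta mulVf// mul1r.
by ring.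
Qed.

Lemma adapted_expansion1 : f1 = tau1 *: t + rho1 *: e.
Proof.
rewrite adapted_tangent eE EE; apply/rowP => j; rewrite !mxE.
transitivity (delta^-1 * (tau0 * rho1 - tau1 * rho0) * f1 0 j).
  by rewrite adapted_delta mulVf// mul1r.
by ring.
Qed.

Lemma adapted_unit : inner e e = 1.
Proof. by rewrite eE innerZl innerZr EE_Delta -delta2; field. Qed.

Lemma adapted_orthogonal : inner t e = 0.
Proof. by rewrite eE innerZr EE innerBr !innerZr -tau0E -tau1E; ring. Qed.

End AdaptedAlgebra.

Lemma adapted_horizontal_unit (R : realType) (c s : R) (t : 'rV[R]_5) :
  inner t t = 1 -> inner t (dt R) = s -> c ^+ 2 + s ^+ 2 = 1 -> c != 0 ->
  inner (c^-1 *: (t - s *: dt R)) (c^-1 *: (t - s *: dt R)) = 1.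
Proof.
move=> tt tdt cs cn0.
rewrite innerZl innerZr innerBl !innerBr !innerZl !innerZr dt_dt tt.
rewrite (innerC (dt R)) tdt; have c2 : c ^+ 2 = 1 - s ^+ 2 by rewrite -cs; ring.
have -> : 1 - s * s - (s * s - s * (s * 1)) = c ^+ 2 by rewrite c2; ring.
by rewrite expr2 mulKf// mulVf.
Qed.

Lemma inner_combination_eq0 (R : realType) (k a b s : R) (u v w : 'rV[R]_5) :
  inner u w = s * b -> inner v w = s * a -> inner (k *: (a *: u - b *: v)) w = 0.
Proof. by move=> uw vw; rewrite innerZl innerBl !innerZl uw vw; ring. Qed.

Lemma inner_span_eq0 (R : realType) (a b : R) (u v w : 'rV[R]_5) :
  inner u w = 0 -> inner v w = 0 -> inner (a *: u + b *: v) w = 0.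
Proof. by move=> uw vw; rewrite innerDl !innerZl uw vw; ring. Qed.

Section AdaptedFrame.
Context {R : realType}.
Variables (f : 'rV[R]_2 -> 'rV[R]_5) (V : set 'rV[R]_2) (theta : R).
Hypotheses (oV : open V) (Sf : smooth_on V f) (fS : forall x, V x -> S3R R (f x)).
Hypothesis inj_df : forall x, V x -> injective ('d f x).
Hypothesis theta_bounds : 0 < theta < pi / 2.
Hypothesis angle_f : forall x, V x -> has_angle f x theta.

Let i0 : 'I_2 := ord0.
Let i1 : 'I_2 := ord_max.
Let c := cos theta.
Let s := sin theta.
Let c0 : c != 0. Proof. by rewrite gt_eqF// cos_theta_gt0. Qed.
Let s0 : s != 0. Proof. by rewrite gt_eqF// sin_theta_gt0. Qed.
Let cs : c ^+ 2 + s ^+ 2 = 1. Proof. exact: cos2Dsin2. Qed.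

(** The tangential part of [dt] is [sin theta] times a unit vector [T], and
    [frame_tau i] is the inner product of [T] with the i-th coordinate vector. Hence
    [frame_E] is orthogonal to [T], and solving for [T] the equations that express the
    coordinate vectors in the basis [T], [frame_e] gives [frame_T]. *)
Definition frame_tau i x : R := s^-1 * partial i f x 0 ord_max.
Definition frame_E x := frame_tau i0 x *: partial i1 f x - frame_tau i1 x *: partial i0 f x.
Definition frame_delta x := Num.sqrt (inner (frame_E x) (frame_E x)).
Definition frame_e x := (frame_delta x)^-1 *: frame_E x.
Definition frame_rho i x := inner (frame_e x) (partial i f x).
Definition frame_T x := (frame_delta x)^-1 *:
  (frame_rho i1 x *: partial i0 f x - frame_rho i0 x *: partial i1 f x).
(** The horizontal part of the axis [T = cos theta U + sin theta dt]. *)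
Definition frame_U x := c^-1 *: (frame_T x - s *: dt R).
Definition frame_N x := sphere_part (f x).
Definition frame_eta x := cross (frame_N x) (frame_U x) (frame_e x).

Let df x : V x -> differentiable f x.
Proof. exact: smooth_differentiable Sf. Qed.

Lemma frame_pointwise x : V x ->
  [/\ 0 < inner (frame_E x) (frame_E x),
      frame_tau i0 x * frame_rho i1 x - frame_tau i1 x * frame_rho i0 x = frame_delta x,
      orthonormal_frame (frame_N x) (frame_eta x) (frame_U x) (frame_e x) &
      forall i, partial i f x =
        frame_tau i x *: (c *: frame_U x + s *: dt R) + frame_rho i x *: frame_e x].
Proof.
move=> Vx; have [_ [t [xi [[/(tangent_planeP _ (df Vx))[v tE] tt] [[xiN xif] _] dtE]]]] := angle_f Vx.
rewrite sum_ord2 in tE.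
have free a b : a *: partial i0 f x + b *: partial i1 f x = 0 -> a = 0 /\ b = 0.
  move=> ab; pose u : 'rV[R]_2 := \row_j [:: a; b]`_j.
  have u0 : u = 0.
    apply: (inj_df Vx); rewrite linear0 (diff_partial _ (df Vx)) sum_ord2.
    by rewrite !mxE.
  have := congr1 (fun w : 'rV[R]_2 => w 0 i0) u0.
  have := congr1 (fun w : 'rV[R]_2 => w 0 i1) u0.
  by rewrite !mxE.
have tangent_f i : tangent_plane f x (partial i f x).
  by exists (delta_mx 0 i) => //; rewrite -partialE//; exact: df.
have tauE i : frame_tau i x = inner t (partial i f x).
  rewrite /frame_tau -inner_dt innerC dtE innerDl !innerZl (xif _ (tangent_f i)).
  by rewrite mulr0 addr0 mulKf.
have tdt : inner t (dt R) = s.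
  rewrite dtE innerDr !innerZr tt (innerC t xi) xif ?mulr0 ?addr0 ?mulr1//.
  by apply/tangent_planeP; [exact: df|exists v; rewrite sum_ord2].
have T0 := tauE i0; have T1 := tauE i1.
have E0 := adapted_normal_gt0 tt tE free T0 T1 erefl.
have dE := adapted_delta tt tE free T0 T1 erefl erefl erefl erefl erefl.
have TE := adapted_tangent tt tE free T0 T1 erefl erefl erefl erefl erefl.
have f0E := adapted_expansion0 tt tE free T0 T1 erefl erefl erefl erefl erefl.
have f1E := adapted_expansion1 tt tE free T0 T1 erefl erefl erefl erefl erefl.
have ee := adapted_unit tt tE free T0 T1 erefl erefl erefl.
have te := adapted_orthogonal T0 T1 erefl (erefl (frame_e x)).
have {}TE : frame_T x = t by exact/esym/TE.
have UE : frame_U x = c^-1 *: (t - s *: dt R) by rewrite /frame_U TE.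
have tU : t = c *: frame_U x + s *: dt R by rewrite UE scalerA divff// scale1r subrK.
have fdt i : inner (partial i f x) (dt R) = s * frame_tau i x.
  by rewrite inner_dt /frame_tau mulVKf.
have e_dt : inner (frame_e x) (dt R) = 0.
  exact: inner_combination_eq0 (fdt i1) (fdt i0).
have NN : inner (frame_N x) (frame_N x) = 1 by exact: (fS Vx).
have fN i : inner (partial i f x) (frame_N x) = 0.
  exact: (tangent_partial i oV Vx df fS).
have fN0 i : inner (partial i f x) (frame_N x) = 0 * frame_tau i x.
  by rewrite mul0r; exact: fN.
have Ne : inner (frame_N x) (frame_e x) = 0.
  by rewrite innerC; exact: inner_combination_eq0 (fN0 i1) (fN0 i0).
have Nt : inner (frame_N x) t = 0.
  by rewrite innerC tE; exact: inner_span_eq0 (fN i0) (fN i1).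
have N_dt : inner (frame_N x) (dt R) = 0 by exact: inner_sphere_dt.
split.
- exact: E0.
- exact: dE.
- apply: cross_frame => //.
  + by rewrite UE; exact: adapted_horizontal_unit.
  + by rewrite UE innerZr innerBr innerZr Nt N_dt mulr0 subrr mulr0.
  + by rewrite UE innerZl innerBl innerZl te (innerC (dt R)) e_dt mulr0 subrr mulr0.
  + by rewrite UE innerZl innerBl innerZl tdt dt_dt mulr1 subrr mulr0.
- by apply: ord2P; rewrite -tU; [exact: f0E|exact: f1E].
Qed.

Section Smoothness.
Variable k : nat.

Let Cf : Ck k V f. Proof. by move/smooth_onP: Sf; exact. Qed.
Let Cpf i : Ck k V (partial i f).
Proof. by apply: Ck_partial; move/smooth_onP: Sf; exact. Qed.

Lemma Ck_frame_tau i : Ck k V (frame_tau i).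
Proof.
have Cp : Ck k V (fun x => partial i f x 0 ord_max) by move: (ord_max); apply/Ck_rowP.
by rewrite /frame_tau; smoothness oV.
Qed.

Lemma Ck_frame_E : Ck k V frame_E.
Proof.
have C0 := Ck_frame_tau i0; have C1 := Ck_frame_tau i1.
have D0 := Cpf i0; have D1 := Cpf i1.
by rewrite /frame_E; smoothness oV.
Qed.

Lemma Ck_frame_delta : Ck k V frame_delta.
Proof.
have CE := Ck_frame_E; apply: (Ck_sqrt oV) => [x Vx|].
  by have [] := frame_pointwise Vx.
by smoothness oV.
Qed.

Let Ck_inv : Ck k V (fun x => (frame_delta x)^-1).
Proof.
apply: (CkV oV) Ck_frame_delta => x Vx; rewrite gt_eqF// sqrtr_gt0.
by have [] := frame_pointwise Vx.
Qed.

Lemma Ck_frame_e : Ck k V frame_e.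
Proof.
by have CE := Ck_frame_E; have CI := Ck_inv; rewrite /frame_e; smoothness oV.
Qed.

Lemma Ck_frame_rho i : Ck k V (frame_rho i).
Proof.
by have Ce := Ck_frame_e; have Cp := Cpf i; rewrite /frame_rho; smoothness oV.
Qed.

Lemma Ck_frame_U : Ck k V frame_U.
Proof.
have Cr0 := Ck_frame_rho i0; have Cr1 := Ck_frame_rho i1.
have D0 := Cpf i0; have D1 := Cpf i1; have CI := Ck_inv.
have CT : Ck k V frame_T by rewrite /frame_T; smoothness oV.
by rewrite /frame_U; smoothness oV.
Qed.

Lemma Ck_frame_N : Ck k V frame_N.
Proof.
have C5 : Ck k V (fun x => f x 0 ord_max) by move: (ord_max); apply/Ck_rowP.
have C : Ck k V (fun x => f x - f x 0 ord_max *: dt R) by smoothness oV.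
exact: C.
Qed.

Lemma Ck_frame_eta : Ck k V frame_eta.
Proof.
have CN := Ck_frame_N; have CU := Ck_frame_U; have Ce := Ck_frame_e.
apply/Ck_rowP => // j.
have C : Ck k V (fun x => \det (\matrix_i [:: delta_mx 0 j; frame_N x; frame_U x;
    frame_e x; dt R]`_i : 'M[R]_5)).
  apply: (Ck_det oV) => a b.
  have CC (g : 'rV[R]_2 -> 'rV[R]_5) : Ck k V g -> Ck k V (fun x => g x 0 b).
    by move=> Cg; exact: (Ck_rowP _ _ oV).1 Cg b.
  have C1 : Ck k V (fun x => ([:: delta_mx 0 j; frame_N x; frame_U x;
    frame_e x; dt R]`_a : 'rV[R]_5) 0 b).
    case: a => -[|[|[|[|[|//]]]]] Ha /=.
    - exact: Ck_cst.
    - exact: CC.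
    - exact: CC.
    - exact: CC.
    - exact: Ck_cst.
  by apply: (eq_Ck oV) C1 => x _; rewrite mxE.
by apply: (eq_Ck oV) C => x _; rewrite mxE.
Qed.

End Smoothness.

End AdaptedFrame.

(** * Structure equations *)

Lemma inner_second_derivative (R : realType) (a k b r c s : R)
    (U T e dU de w : 'rV[R]_5) :
  inner (a *: (c *: U + s *: T) + k *: dU + (b *: e + r *: de)) w =
  a * (c * inner U w + s * inner T w) + k * inner dU w +
  (b * inner e w + r * inner de w).
Proof. by rewrite !innerDl !innerZl !innerDl !innerZl. Qed.

Section MovingFrame.
Context {R : realType}.
Variables (f N eta U e : 'rV[R]_2 -> 'rV[R]_5) (tau rho : 'I_2 -> 'rV[R]_2 -> R).
Variables (c s : R) (V : set 'rV[R]_2).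

Let i0 : 'I_2 := ord0.
Let i1 : 'I_2 := ord_max.

(** The adapted frame of a surface of constant angle: [c U + s dt] is the unit
    tangent vector in the direction of the projection of [dt], and [tau], [rho]
    are the coordinates of the dual coframe. *)
Record adapted_frame : Prop := AdaptedFrame {
  af_open : open V;
  af_f : smooth_on V f;
  af_N : smooth_on V N;
  af_eta : smooth_on V eta;
  af_U : smooth_on V U;
  af_e : smooth_on V e;
  af_tau : forall i k, Ck k V (tau i);
  af_rho : forall i k, Ck k V (rho i);
  af_frame : forall x, V x -> orthonormal_frame (N x) (eta x) (U x) (e x);
  af_normal : forall x, V x -> N x = sphere_part (f x);
  af_partial : forall x i, V x ->
    partial i f x = tau i x *: (c *: U x + s *: dt R) + rho i x *: e x;
  af_delta : forall x, V x -> tau i0 x * rho i1 x - tau i1 x * rho i0 x != 0;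
  af_c : c != 0;
  af_s : s != 0;
  af_cs : c ^+ 2 + s ^+ 2 = 1 }.

Hypothesis AF : adapted_frame.

Let oV := af_open AF.
Let dU x : V x -> differentiable U x. Proof. exact: smooth_differentiable (af_U AF). Qed.
Let de x : V x -> differentiable e x. Proof. exact: smooth_differentiable (af_e AF). Qed.
Let dN x : V x -> differentiable N x. Proof. exact: smooth_differentiable (af_N AF). Qed.
Let deta x : V x -> differentiable eta x.
Proof. exact: smooth_differentiable (af_eta AF). Qed.
Let df x : V x -> differentiable f x. Proof. exact: smooth_differentiable (af_f AF). Qed.
Let dtau i x : V x -> differentiable (tau i) x.
Proof. exact: Ck_differentiable (af_tau AF i 0). Qed.
Let drho i x : V x -> differentiable (rho i) x.
Proof. exact: Ck_differentiable (af_rho AF i 0). Qed.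

Let frameE x (Vx : V x) := af_frame AF Vx.

Lemma inner_constant_derivative (X Y : 'rV[R]_2 -> 'rV[R]_5) (k : R) i x :
  V x -> differentiable X x -> differentiable Y x ->
  (forall y, V y -> inner (X y) (Y y) = k) ->
  inner (partial i X x) (Y x) = - inner (X x) (partial i Y x).
Proof.
move=> Vx dX dY XY; apply/eqP; rewrite -addr_eq0; apply/eqP.
rewrite -(partial_inner i dX dY) (eq_partial (g := fun=> k) i oV Vx XY).
exact: partial_cst.
Qed.

Lemma inner_unit_derivative (X : 'rV[R]_2 -> 'rV[R]_5) i x :
  V x -> differentiable X x -> (forall y, V y -> inner (X y) (X y) = 1) ->
  inner (partial i X x) (X x) = 0.
Proof.
move=> Vx dX XX; have := inner_constant_derivative i Vx dX dX XX.
by rewrite [X in - X]innerC => /eqP; rewrite -addr_eq0 -mulr2n mulrn_eq0 => /eqP.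
Qed.

Lemma inner_dt_derivative (X : 'rV[R]_2 -> 'rV[R]_5) i x :
  V x -> differentiable X x -> (forall y, V y -> inner (X y) (dt R) = 0) ->
  inner (partial i X x) (dt R) = 0.
Proof.
move=> Vx dX Xt; have dc : differentiable (fun=> dt R) x by exact: differentiable_cst.
by rewrite (inner_constant_derivative i Vx dX dc Xt) partial_cst inner0r oppr0.
Qed.

Lemma partial_frame_N i x : V x ->
  partial i N x = (c * tau i x) *: U x + rho i x *: e x.
Proof.
move=> Vx; rewrite (eq_partial i oV Vx (af_normal AF)) (partial_sphere_part i (df Vx)).
rewrite (af_partial AF i Vx) sphere_partD !sphere_partZ sphere_partD !sphere_partZ.
have [_ _ _ [_ _ Ut et]] := frameE Vx.
rewrite sphere_part_dt !sphere_part_id -?inner_dt//.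
by rewrite scaler0 addr0 scalerA mulrC.
Qed.

(** The connection forms of the frame, apart from those that [partial_frame_N]
    computes. *)
Definition frame_p i x := inner (partial i U x) (eta x).
Definition frame_q i x := inner (partial i e x) (eta x).
Definition frame_psi i x := inner (partial i U x) (e x).

Let partial_U i x : V x -> partial i U x =
  - (c * tau i x) *: N x + frame_p i x *: eta x + frame_psi i x *: e x.
Proof.
move=> Vx; have F := frameE Vx.
have UN : inner (partial i U x) (N x) = - (c * tau i x).
  have NU y : V y -> inner (U y) (N y) = 0.
    by move=> /frameE [_ [_ H _] _ _]; rewrite innerC.
  rewrite (inner_constant_derivative i Vx (dU Vx) (dN Vx) NU) (partial_frame_N i Vx).
  have [[_ _ UU _] _ [_ _ Ue] _] := F.
  by rewrite innerDr !innerZr UU Ue mulr1 mulr0 addr0.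
have UU : inner (partial i U x) (U x) = 0.
  by apply: (inner_unit_derivative i Vx (dU Vx)) => y /frameE [[]].
have Ut : inner (partial i U x) (dt R) = 0.
  by apply: (inner_dt_derivative i Vx (dU Vx)) => y /frameE [_ _ _ []].
rewrite [LHS](frame_expansion _ F) UN UU Ut -/(frame_p i x) -/(frame_psi i x).
by rewrite !scale0r !addr0.
Qed.

Let partial_e i x : V x -> partial i e x =
  - rho i x *: N x + frame_q i x *: eta x - frame_psi i x *: U x.
Proof.
move=> Vx; have F := frameE Vx.
have eN : inner (partial i e x) (N x) = - rho i x.
  have Ne y : V y -> inner (e y) (N y) = 0.
    by move=> /frameE [_ [_ _ H] _ _]; rewrite innerC.
  rewrite (inner_constant_derivative i Vx (de Vx) (dN Vx) Ne) (partial_frame_N i Vx).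
  have [[_ _ _ ee] _ [_ _ Ue] _] := F.
  by rewrite innerDr !innerZr ee (innerC (e x)) Ue mulr1 mulr0 add0r.
have ee : inner (partial i e x) (e x) = 0.
  by apply: (inner_unit_derivative i Vx (de Vx)) => y /frameE [[]].
have et : inner (partial i e x) (dt R) = 0.
  by apply: (inner_dt_derivative i Vx (de Vx)) => y /frameE [_ _ _ []].
have eU : inner (partial i e x) (U x) = - frame_psi i x.
  have Ue y : V y -> inner (e y) (U y) = 0.
    by move=> /frameE [_ _ [_ _ H] _]; rewrite innerC.
  by rewrite (inner_constant_derivative i Vx (de Vx) (dU Vx) Ue) innerC.
rewrite [LHS](frame_expansion _ F) eN ee et eU -/(frame_q i x).
by rewrite !scale0r !addr0 !scaleNr.
Qed.

Let partial_eta i x : V x -> partial i eta x =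
  - frame_p i x *: U x - frame_q i x *: e x.
Proof.
move=> Vx; have F := frameE Vx.
have hN : inner (partial i eta x) (N x) = 0.
  have eN y : V y -> inner (eta y) (N y) = 0.
    by move=> /frameE [_ [H _ _] _ _]; rewrite innerC.
  rewrite (inner_constant_derivative i Vx (deta Vx) (dN Vx) eN) (partial_frame_N i Vx).
  have [_ _ [H1 H2 _] _] := F.
  by rewrite innerDr !innerZr H1 H2 !mulr0 addr0 oppr0.
have hh : inner (partial i eta x) (eta x) = 0.
  by apply: (inner_unit_derivative i Vx (deta Vx)) => y /frameE [[]].
have ht : inner (partial i eta x) (dt R) = 0.
  by apply: (inner_dt_derivative i Vx (deta Vx)) => y /frameE [_ _ _ []].
have hU : inner (partial i eta x) (U x) = - frame_p i x.
  have eU y : V y -> inner (eta y) (U y) = 0 by move=> /frameE [_ _ []].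
  by rewrite (inner_constant_derivative i Vx (deta Vx) (dU Vx) eU) innerC.
have he : inner (partial i eta x) (e x) = - frame_q i x.
  have ee y : V y -> inner (eta y) (e y) = 0 by move=> /frameE [_ _ []].
  by rewrite (inner_constant_derivative i Vx (deta Vx) (de Vx) ee) innerC.
rewrite [LHS](frame_expansion _ F) hN hh ht hU he.
by rewrite !scale0r !addr0 add0r !scaleNr.
Qed.

Let partial2_f i j x : V x -> partial j (partial i f) x =
  partial j (tau i) x *: (c *: U x + s *: dt R) + (tau i x * c) *: partial j U x +
  (partial j (rho i) x *: e x + rho i x *: partial j e x).
Proof.
move=> Vx.
have E y : V y -> partial i f y = tau i y *: (c *: U y + s *: dt R) + rho i y *: e y.
  exact: af_partial.
rewrite (eq_partial j oV Vx E).
have dcU : differentiable (fun y => c *: U y) x by exact: differentiableZ (dU Vx).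
have dst : differentiable (fun=> s *: dt R) x by exact: differentiable_cst.
have dT := differentiableD dcU dst.
have dtT := differentiable_scale (dtau i Vx) dT.
have dre := differentiable_scale (drho i Vx) (de Vx).
rewrite (partialD j dtT dre) (partial_scale j (dtau i Vx) dT).
rewrite (partial_scale j (drho i Vx) (de Vx)) (partialD j dcU dst).
by rewrite (partialZ j c (dU Vx)) partial_cst addr0 scalerA.
Qed.

Let eta_component i j x : V x -> inner (partial j (partial i f) x) (eta x) =
  c * (tau i x * frame_p j x) + rho i x * frame_q j x.
Proof.
move=> Vx; rewrite (partial2_f i j Vx) inner_second_derivative.
rewrite -/(frame_p j x) -/(frame_q j x).
have [_ _ [hU he _] [_ ht _ _]] := frameE Vx.
rewrite (innerC (U x)) hU (innerC (dt R)) ht (innerC (e x)) he !mulr0 addr0 mulr0 !add0r.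
by rewrite [tau i x * c]mulrC mulrA.
Qed.

(** The unit normal [c dt - s U] is the vector called [xi] in the definition of
    the angle function. *)
Let xi_component i j x : V x ->
  inner (partial j (partial i f) x) (c *: dt R - s *: U x) = s * (rho i x * frame_psi j x).
Proof.
move=> Vx; have [[NN hh UU ee] [Nh NU Ne] [hU he Ue] [Nt ht Ut et]] := frameE Vx.
have Uxi : inner (U x) (c *: dt R - s *: U x) = - s.
  by rewrite innerBr !innerZr Ut UU mulr0 mulr1 sub0r.
have txi : inner (dt R) (c *: dt R - s *: U x) = c.
  by rewrite innerBr !innerZr dt_dt (innerC (dt R)) Ut mulr0 mulr1 subr0.
have exi : inner (e x) (c *: dt R - s *: U x) = 0.
  by rewrite innerBr !innerZr et (innerC (e x)) Ue !mulr0 subr0.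
have Nxi : inner (N x) (c *: dt R - s *: U x) = 0.
  by rewrite innerBr !innerZr Nt NU !mulr0 subr0.
have hxi : inner (eta x) (c *: dt R - s *: U x) = 0.
  by rewrite innerBr !innerZr ht hU !mulr0 subr0.
have dUxi : inner (partial j U x) (c *: dt R - s *: U x) = 0.
  by rewrite (partial_U j Vx) !innerDl !innerZl Nxi hxi exi !mulr0 !addr0.
have dexi : inner (partial j e x) (c *: dt R - s *: U x) = s * frame_psi j x.
  rewrite (partial_e j Vx) innerBl innerDl !innerZl Nxi hxi Uxi !mulr0 add0r sub0r.
  by rewrite mulrN opprK mulrC.
rewrite (partial2_f i j Vx) inner_second_derivative Uxi txi exi dUxi dexi.
by rewrite mulrN [c * s]mulrC addNr !mulr0 !add0r mulrCA.
Qed.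

Let metric_frame x : V x ->
  metric f x = (\matrix_(i, a) (if a == i0 then tau i x else rho i x)) *m
    (\matrix_(i, a) (if a == i0 then tau i x else rho i x))^T.
Proof.
move=> Vx; apply/matrixP => i j; rewrite !mxE sum_ord2 !mxE /=.
rewrite (af_partial AF i Vx) (af_partial AF j Vx).
have [[NN hh UU ee] [Nh NU Ne] [hU he Ue] [Nt ht Ut et]] := frameE Vx.
rewrite !inner_linear (innerC (dt R) (U x)) dt_dt (innerC (e x) (U x)) Ut et.
rewrite (innerC (dt R) (e x)) et UU ee Ue.
transitivity ((c ^+ 2 + s ^+ 2) * (tau i x * tau j x) + rho i x * rho j x); first by ring.
by rewrite (af_cs AF) mul1r.
Qed.

(** In the dual coframe the trace with respect to the metric is the sum of the
    diagonal coefficients. *)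
Let frame_trace x (a00 a01 a10 a11 : R) (A : 'I_2 -> 'I_2 -> R) : V x ->
  (forall i j, A i j = a00 * (tau i x * tau j x) + a01 * (tau i x * rho j x) +
     a10 * (rho i x * tau j x) + a11 * (rho i x * rho j x)) ->
  \sum_i \sum_j invmx (metric f x) i j * A i j = a00 + a11.
Proof.
move=> Vx AE; rewrite (metric_frame Vx); set P := \matrix_(i, a) _.
pose al : 'M[R]_2 := \matrix_(i, j) (if i == i0 then (if j == i0 then a00 else a01)
  else (if j == i0 then a10 else a11)).
have PA i j : A i j = (P *m al *m P^T) i j.
  by rewrite AE !mxE sum_ord2 !mxE !sum_ord2 !mxE /=; ring.
under eq_bigr => i _ do under eq_bigr => j _ do rewrite PA.
rewrite trace_metric.
  by rewrite /mxtrace sum_ord2 !mxE.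
rewrite unitmxE unitfE (expand_det_row _ i0) sum_ord2 /cofactor !det_mx11 !mxE /=.
have := af_delta AF Vx; apply: contra_neq => H; rewrite -[RHS]H.
have -> : lift i0 (0 : 'I_1) = i1 by exact/val_inj.
by rewrite /=; ring.
Qed.

Hypothesis minimal_f : forall x, V x -> mean_curvature f x = 0.

Let normal_trace x (w : 'rV[R]_5) : V x -> inner (N x) w = 0 ->
  (forall k, inner (partial k f x) w = 0) ->
  \sum_i \sum_j invmx (metric f x) i j * inner (partial i (partial j f) x) w = 0.
Proof.
move=> Vx Nw fw; have := mean_curvature_normal (f := f) (x := x) (w := w).
rewrite -(af_normal AF Vx) (minimal_f Vx) inner0l => /(_ Nw fw) /esym/eqP.
by rewrite mulf_eq0 invr_eq0 pnatr_eq0/= => /eqP.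
Qed.

(** By minimality the components of the second fundamental form along [eta], in the
    coframe [tau], [rho], are [a], [b], [- a]; Cramer's rule gives [a] and [b]. *)
Definition frame_a x : R := c * (frame_p i0 x * rho i1 x - frame_p i1 x * rho i0 x) /
  (tau i0 x * rho i1 x - tau i1 x * rho i0 x).
Definition frame_b x : R := (frame_q i0 x * rho i1 x - frame_q i1 x * rho i0 x) /
  (tau i0 x * rho i1 x - tau i1 x * rho i0 x).

Let coframe_expansion (t0 t1 r0 r1 u0 u1 : R) : t0 * r1 - t1 * r0 != 0 ->
  u0 = (u0 * r1 - u1 * r0) / (t0 * r1 - t1 * r0) * t0 +
       (t0 * u1 - t1 * u0) / (t0 * r1 - t1 * r0) * r0 /\
  u1 = (u0 * r1 - u1 * r0) / (t0 * r1 - t1 * r0) * t1 +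
       (t0 * u1 - t1 * u0) / (t0 * r1 - t1 * r0) * r1.
Proof. by move=> d0; split; field. Qed.

Let coframe_symmetric (t0 t1 r0 r1 pt pr qt qr : R) : t0 * r1 - t1 * r0 != 0 ->
  c * (t0 * (pt * t1 + pr * r1)) + r0 * (qt * t1 + qr * r1) =
  c * (t1 * (pt * t0 + pr * r0)) + r1 * (qt * t0 + qr * r0) -> c * pr = qt.
Proof.
move=> d0 /eqP; rewrite -subr_eq0 => /eqP sym.
apply/eqP; rewrite -subr_eq0; apply/eqP/(mulIf d0); rewrite mul0r -[RHS]sym.
by ring.
Qed.

(** Paired with the unit normal [c dt - s U], the second fundamental form is a multiple
    of [rho (x) psi]. By symmetry [psi] is a multiple of [rho], and the
    trace then kills the factor. *)
Lemma frame_psi_eq0 i x : V x -> frame_psi i x = 0.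
Proof.
move=> Vx; have d0 := af_delta AF Vx.
have [E0 E1] := coframe_expansion (frame_psi i0 x) (frame_psi i1 x) d0.
set l := _ / _ in E0 E1; set k := (tau i0 x * _ - _) / _ in E0 E1.
have sym : rho i0 x * frame_psi i1 x = rho i1 x * frame_psi i0 x.
  have S := partial_symmetric_row i1 i0 oV Vx (af_f AF).
  have := xi_component i0 i1 Vx; have := xi_component i1 i0 Vx.
  move: S; move: (partial i1 (partial i0 f) x) (partial i0 (partial i1 f) x).
  by move=> A B -> -> /(mulfI (af_s AF)) /esym.
have l0 : l = 0.
  rewrite /l; move: (frame_psi i0 x) (frame_psi i1 x) sym => p0 p1 sym.
  by rewrite [p0 * _]mulrC -sym [_ * p1]mulrC subrr mul0r.
have psiE j : frame_psi j x = k * rho j x.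
  by move: j; apply: ord2P; [rewrite {1}E0|rewrite {1}E1]; rewrite l0 mul0r add0r.
have [[NN hh UU ee] [Nh NU Ne] [hU he Ue] [Nt ht Ut et]] := frameE Vx.
have Nxi : inner (N x) (c *: dt R - s *: U x) = 0.
  by rewrite innerBr !innerZr Nt NU !mulr0 subr0.
have fxi j : inner (partial j f x) (c *: dt R - s *: U x) = 0.
  rewrite (af_partial AF j Vx) innerDl !innerZl innerDl !innerZl !innerBr !innerZr.
  rewrite Ut UU dt_dt (innerC (dt R)) Ut et (innerC (e x)) Ue; ring.
have tr : s * k = 0.
  apply: etrans (esym (add0r _)) (etrans (esym _) (normal_trace Vx Nxi fxi)).
  apply: (frame_trace (a01 := 0) (a10 := 0) Vx) => a b.
  apply: etrans (xi_component b a Vx) _; rewrite (psiE a).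
  move: (rho a x) (rho b x) (tau a x) (tau b x); clear => ? ? ? ?.
  by clearbody k; ring.
have /eqP := tr; rewrite mulf_eq0 (negbTE (af_s AF))/= => /eqP k0.
by rewrite (psiE i) k0 mul0r.
Qed.

(** Paired with [eta], the second fundamental form is [c tau (x) p + rho (x) q]: it
    is symmetric, and its trace vanishes. *)
Lemma frame_coefficients i x : V x ->
  frame_p i x = c^-1 * (frame_a x * tau i x + frame_b x * rho i x) /\
  frame_q i x = frame_b x * tau i x - frame_a x * rho i x.
Proof.
move=> Vx; have d0 := af_delta AF Vx; have cn0 := af_c AF.
have [P0 P1] := coframe_expansion (frame_p i0 x) (frame_p i1 x) d0.
have [Q0 Q1] := coframe_expansion (frame_q i0 x) (frame_q i1 x) d0.
rewrite -/(frame_b x) in Q0 Q1.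
set pr := (tau i0 x * frame_p i1 x - _) / _ in P0 P1.
set qr := (tau i0 x * frame_q i1 x - _) / _ in Q0 Q1.
set pt := (frame_p i0 x * _ - _) / _ in P0 P1.
have aE : frame_a x = c * pt by rewrite /frame_a /pt mulrA.
have pE j : frame_p j x = pt * tau j x + pr * rho j x.
  by move: j; apply: ord2P; [exact: P0|exact: P1].
have qE j : frame_q j x = frame_b x * tau j x + qr * rho j x.
  by move: j; apply: ord2P; [exact: Q0|exact: Q1].
have sym : c * (tau i0 x * frame_p i1 x) + rho i0 x * frame_q i1 x =
    c * (tau i1 x * frame_p i0 x) + rho i1 x * frame_q i0 x.
  have S := partial_symmetric_row i1 i0 oV Vx (af_f AF).
  have := eta_component i0 i1 Vx; have := eta_component i1 i0 Vx.
  move: S; move: (partial i1 (partial i0 f) x) (partial i0 (partial i1 f) x).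
  by move=> A B -> -> /esym.
have prE : c * pr = frame_b x.
  apply: (coframe_symmetric (pt := pt) (qr := qr)) d0 _.
  have p0 := pE i0; have p1 := pE i1; have q0 := qE i0; have q1 := qE i1.
  by move: sym p0 p1 q0 q1; move: (frame_p i0 x) (frame_p i1 x) (frame_q i0 x)
    (frame_q i1 x) => ? ? ? ? sym p0 p1 q0 q1;
    move: sym; rewrite p0 p1 q0 q1.
have [[NN hh UU ee] [Nh NU Ne] [hU he Ue] [Nt ht Ut et]] := frameE Vx.
have feta j : inner (partial j f x) (eta x) = 0.
  rewrite (af_partial AF j Vx) innerDl !innerZl innerDl !innerZl.
  by rewrite (innerC (U x)) hU (innerC (dt R)) ht (innerC (e x)) he; ring.
have tr : c * pt + qr = 0.
  apply: etrans (esym _) (normal_trace Vx Nh feta).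
  apply: (frame_trace (a01 := frame_b x) (a10 := c * pr) Vx) => a b.
  apply: etrans (eta_component b a Vx) _; rewrite (pE a) (qE a).
  move: (rho a x) (rho b x) (tau a x) (tau b x) (frame_b x).
  by clearbody pt pr qr; clear => ? ? ? ? ?; ring.
have qrE : qr = - frame_a x by apply/eqP; rewrite -addr_eq0 addrC aE tr.
split; last by rewrite qE qrE mulNr.
by rewrite pE aE -prE; field.
Qed.

Lemma structure_U i x : V x -> partial i U x =
  - (c * tau i x) *: N x + (c^-1 * (frame_a x * tau i x + frame_b x * rho i x)) *: eta x.
Proof.
move=> Vx; rewrite (partial_U i Vx) (frame_psi_eq0 i Vx) scale0r addr0.
by have [-> _] := frame_coefficients i Vx.
Qed.

Lemma structure_e i x : V x -> partial i e x =
  - rho i x *: N x + (frame_b x * tau i x - frame_a x * rho i x) *: eta x.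
Proof.
move=> Vx; rewrite (partial_e i Vx) (frame_psi_eq0 i Vx) scale0r subr0.
by have [_ ->] := frame_coefficients i Vx.
Qed.

Lemma structure_eta i x : V x -> partial i eta x =
  - (c^-1 * (frame_a x * tau i x + frame_b x * rho i x)) *: U x -
  (frame_b x * tau i x - frame_a x * rho i x) *: e x.
Proof.
by move=> Vx; rewrite (partial_eta i Vx); have [-> ->] := frame_coefficients i Vx.
Qed.

Lemma Ck_frame_ab k : Ck k V frame_a /\ Ck k V frame_b.
Proof.
have Ct i : Ck k V (tau i) by exact: af_tau.
have Cr i : Ck k V (rho i) by exact: af_rho.
have Ceta : Ck k V eta by have /smooth_onP := af_eta AF; exact.
have Cp i : Ck k V (frame_p i).
  have CU : Ck k V (partial i U) by have /smooth_onP := smooth_partial i (af_U AF); exact.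
  by rewrite /frame_p; smoothness oV.
have Cq i : Ck k V (frame_q i).
  have Ce : Ck k V (partial i e) by have /smooth_onP := smooth_partial i (af_e AF); exact.
  by rewrite /frame_q; smoothness oV.
have Ct0 := Ct i0; have Ct1 := Ct i1; have Cr0 := Cr i0; have Cr1 := Cr i1.
have Cp0 := Cp i0; have Cp1 := Cp i1; have Cq0 := Cq i0; have Cq1 := Cq i1.
have Cd : Ck k V (fun x => (tau i0 x * rho i1 x - tau i1 x * rho i0 x)^-1).
  by apply: (CkV oV) => [x /(af_delta AF)//|]; smoothness oV.
by split; rewrite /frame_a /frame_b; smoothness oV.
Qed.

End MovingFrame.

(** * Integrability *)

Lemma inner_pair (R : realType) (k l m n : R) (p q r t w : 'rV[R]_5) :
  inner (k *: p + l *: q + (m *: r + n *: t)) w =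
  k * inner p w + l * inner q w + (m * inner r w + n * inner t w).
Proof. by rewrite !innerDl !innerZl. Qed.

Lemma pair_cancel1 (R : realType) (a a' b b' k k' l l' p q u u' v v' : R) :
  p = 1 -> q = 0 -> u = 0 -> v = 0 -> u' = 0 -> v' = 0 ->
  a * p + k * u + (b * q + l * v) = a' * p + k' * u' + (b' * q + l' * v') -> a = a'.
Proof. by move=> -> -> -> -> -> ->; rewrite !mulr0 !addr0 !mulr1. Qed.

Lemma pair_cancel0 (R : realType) (a a' b b' k k' l l' p p' q q' : R) :
  a * 0 + k * p + (b * 0 + l * q) = a' * 0 + k' * p' + (b' * 0 + l' * q') ->
  k * p + l * q = k' * p' + l' * q'.
Proof. by rewrite !mulr0 !add0r. Qed.

Section PairSymmetric.
Context {R : realType}.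
Variables (V : set 'rV[R]_2) (X P Q : 'rV[R]_2 -> 'rV[R]_5).
Variables (A B : 'I_2 -> 'rV[R]_2 -> R) (x : 'rV[R]_2) (w : 'rV[R]_5) (i j : 'I_2).
Hypotheses (oV : open V) (Vx : V x) (SX : smooth_on V X).
Hypothesis XE : forall y k, V y -> partial k X y = A k y *: P y + B k y *: Q y.
Hypotheses (dA : forall k, differentiable (A k) x) (dB : forall k, differentiable (B k) x).
Hypotheses (dP : differentiable P x) (dQ : differentiable Q x).

(** The symmetry of the second derivatives of [X], paired with [w]. *)
Let pair_symmetric :
  partial j (A i) x * inner (P x) w + A i x * inner (partial j P x) w +
  (partial j (B i) x * inner (Q x) w + B i x * inner (partial j Q x) w) =
  partial i (A j) x * inner (P x) w + A j x * inner (partial i P x) w +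
  (partial i (B j) x * inner (Q x) w + B j x * inner (partial i Q x) w).
Proof.
have E k l : partial l (partial k X) x =
    partial l (A k) x *: P x + A k x *: partial l P x +
    (partial l (B k) x *: Q x + B k x *: partial l Q x).
  rewrite (eq_partial l oV Vx (fun y Vy => XE k Vy)).
  have dAP := differentiable_scale (dA k) dP.
  have dBQ := differentiable_scale (dB k) dQ.
  by rewrite (partialD l dAP dBQ) (partial_scale l (dA k) dP) (partial_scale l (dB k) dQ).
have S := partial_symmetric_row j i oV Vx SX; rewrite (E i j) (E j i) in S.
apply: etrans (esym (inner_pair _ _ _ _ _ _ _ _ _)) _.
apply: etrans _ (inner_pair _ _ _ _ _ _ _ _ _).
exact: (congr1 (fun v => inner v w) S).
Qed.

Lemma pair_symmetric1 : inner (P x) w = 1 -> inner (Q x) w = 0 ->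
  (forall k, inner (partial k P x) w = 0) -> (forall k, inner (partial k Q x) w = 0) ->
  partial j (A i) x = partial i (A j) x.
Proof.
move=> P1 Q0 dP0 dQ0.
exact: (pair_cancel1 P1 Q0 (dP0 j) (dQ0 j) (dP0 i) (dQ0 i) pair_symmetric).
Qed.

Lemma pair_symmetric0 : inner (P x) w = 0 -> inner (Q x) w = 0 ->
  A i x * inner (partial j P x) w + B i x * inner (partial j Q x) w =
  A j x * inner (partial i P x) w + B j x * inner (partial i Q x) w.
Proof.
move=> P0 Q0; have := pair_symmetric; rewrite P0 Q0.
exact: pair_cancel0.
Qed.

End PairSymmetric.

Lemma pair_symmetric2 (R : realType) (V : set 'rV[R]_2) (X P Q : 'rV[R]_2 -> 'rV[R]_5)
    (A B : 'I_2 -> 'rV[R]_2 -> R) (x : 'rV[R]_2) (w : 'rV[R]_5) (i j : 'I_2) :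
  open V -> V x -> smooth_on V X ->
  (forall y k, V y -> partial k X y = A k y *: P y + B k y *: Q y) ->
  (forall k, differentiable (A k) x) -> (forall k, differentiable (B k) x) ->
  differentiable P x -> differentiable Q x ->
  inner (P x) w = 0 -> inner (Q x) w = 1 ->
  (forall k, inner (partial k P x) w = 0) -> (forall k, inner (partial k Q x) w = 0) ->
  partial j (B i) x = partial i (B j) x.
Proof.
move=> oV Vx SX XE dA dB dP dQ P0 Q1 dP0 dQ0.
have XE' y k : V y -> partial k X y = B k y *: Q y + A k y *: P y.
  by move=> Vy; rewrite (XE y k Vy) addrC.
exact: (pair_symmetric1 i j oV Vx SX XE' dB dA dQ dP Q1 P0 dQ0 dP0).
Qed.

Section IntegrabilityAlgebra.
Context {R : realType}.
Variables (a b c t0 t1 r0 r1 : R).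
Hypotheses (d0 : t0 * r1 - t1 * r0 != 0) (cn0 : c != 0).
Let P t r := c^-1 * (a * t + b * r).
Let Q t r := b * t - a * r.

Lemma gauss_algebra :
  - r0 * (c * t1) - Q t0 r0 * P t1 r1 = - r1 * (c * t0) - Q t1 r1 * P t0 r0 ->
  a ^+ 2 + b ^+ 2 = c ^+ 2.
Proof.
rewrite /P /Q => /eqP; rewrite -subr_eq0 => /eqP G.
apply/eqP; rewrite -subr_eq0; apply/eqP/(mulIf d0)/(mulfI (invr_neq0 cn0)).
by rewrite mul0r mulr0 -[RHS]oppr0 -[in RHS]G; field.
Qed.

(** The derivative of [(a, b)] is orthogonal to [(a, b)], hence a multiple [k] of
    [(- b, a)], and the equations force [k] to be proportional to both members of a
    basis. *)
Lemma codazzi_algebra (a0 a1 b0 b1 : R) : a ^+ 2 + b ^+ 2 = c ^+ 2 ->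
  a * a0 + b * b0 = 0 -> a * a1 + b * b1 = 0 ->
  a1 * t0 + b1 * r0 = a0 * t1 + b0 * r1 ->
  b1 * t0 - a1 * r0 = b0 * t1 - a0 * r1 ->
  [/\ a0 = 0, a1 = 0, b0 = 0 & b1 = 0].
Proof.
move=> ab A0 A1 E1 E2.
have c2 : c ^+ 2 != 0 by rewrite expf_neq0.
pose k0 := a * b0 - b * a0; pose k1 := a * b1 - b * a1.
have T : k1 * t0 = k0 * t1.
  apply/eqP; rewrite -subr_eq0; apply/eqP.
  transitivity (a * (b1 * t0 - a1 * r0 - (b0 * t1 - a0 * r1)) -
     b * (a1 * t0 + b1 * r0 - (a0 * t1 + b0 * r1)) + (a * a1 + b * b1) * r0
     - (a * a0 + b * b0) * r1); first by rewrite /k0 /k1; ring.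
  by rewrite E1 E2 A0 A1 !subrr; ring.
have K : k1 * r0 = k0 * r1.
  apply/eqP; rewrite -subr_eq0; apply/eqP.
  transitivity (b * (b1 * t0 - a1 * r0 - (b0 * t1 - a0 * r1)) +
     a * (a1 * t0 + b1 * r0 - (a0 * t1 + b0 * r1)) - (a * a1 + b * b1) * t0
     + (a * a0 + b * b0) * t1); first by rewrite /k0 /k1; ring.
  by rewrite E1 E2 A0 A1 !subrr; ring.
have k10 : k1 = 0.
  apply: (mulIf d0); rewrite mul0r mulrBr !mulrA T mulrAC -K.
  by rewrite -!mulrA [t1 * r0]mulrC subrr.
have k00 : k0 = 0.
  apply: (mulIf d0); rewrite mul0r mulrBr !mulrA mulrAC -K -T.
  by rewrite mulrAC subrr.
have sol x y : a * x + b * y = 0 -> a * y - b * x = 0 -> x = 0 /\ y = 0.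
  move=> h1 h2; split; apply: (mulfI c2); rewrite mulr0 -ab.
    transitivity (a * (a * x + b * y) - b * (a * y - b * x)); first by ring.
    by rewrite h1 h2 !mulr0 subrr.
  transitivity (b * (a * x + b * y) + a * (a * y - b * x)); first by ring.
  by rewrite h1 h2 !mulr0 addr0.
by have [] := sol _ _ A0 k00; have [] := sol _ _ A1 k10.
Qed.

End IntegrabilityAlgebra.

Lemma codazzi_cancel1 (R : realType) (k l t0 t1 r0 r1 a0 a1 b0 b1 a b : R) :
  a * k + t0 * a1 + (b * l + r0 * b1) = a * k + t1 * a0 + (b * l + r1 * b0) ->
  a1 * t0 + b1 * r0 = a0 * t1 + b0 * r1.
Proof.
by move=> H; lra.
Qed.

Lemma codazzi_cancel2 (R : realType) (k l t0 t1 r0 r1 a0 a1 b0 b1 a b : R) :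
  b * k + t0 * b1 - (a * l + r0 * a1) = b * k + t1 * b0 - (a * l + r1 * a0) ->
  b1 * t0 - a1 * r0 = b0 * t1 - a0 * r1.
Proof. by move=> H; lra. Qed.

Section Structure.
Context {R : realType}.
Variables (f N eta U e : 'rV[R]_2 -> 'rV[R]_5) (tau rho : 'I_2 -> 'rV[R]_2 -> R).
Variables (a b : 'rV[R]_2 -> R) (c s : R) (V : set 'rV[R]_2).

Let i0 : 'I_2 := ord0.
Let i1 : 'I_2 := ord_max.

Record structure_equations : Prop := StructureEquations {
  se_frame : adapted_frame f N eta U e tau rho c s V;
  se_a : forall k, Ck k V a;
  se_b : forall k, Ck k V b;
  se_U : forall x i, V x -> partial i U x = - (c * tau i x) *: N x +
    (c^-1 * (a x * tau i x + b x * rho i x)) *: eta x;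
  se_e : forall x i, V x -> partial i e x = - rho i x *: N x +
    (b x * tau i x - a x * rho i x) *: eta x;
  se_eta : forall x i, V x -> partial i eta x =
    - (c^-1 * (a x * tau i x + b x * rho i x)) *: U x +
    - (b x * tau i x - a x * rho i x) *: e x }.

Hypothesis SE : structure_equations.
Let AF := se_frame SE.
Let oV := af_open AF.

Let dU x : V x -> differentiable U x. Proof. exact: smooth_differentiable (af_U AF). Qed.
Let de x : V x -> differentiable e x. Proof. exact: smooth_differentiable (af_e AF). Qed.
Let dN x : V x -> differentiable N x. Proof. exact: smooth_differentiable (af_N AF). Qed.
Let deta x : V x -> differentiable eta x.
Proof. exact: smooth_differentiable (af_eta AF). Qed.
Let dtau i x : V x -> differentiable (tau i) x.
Proof. exact: Ck_differentiable (af_tau AF i 0). Qed.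
Let drho i x : V x -> differentiable (rho i) x.
Proof. exact: Ck_differentiable (af_rho AF i 0). Qed.
Let da x : V x -> differentiable a x. Proof. exact: Ck_differentiable (se_a SE 0). Qed.
Let db x : V x -> differentiable b x. Proof. exact: Ck_differentiable (se_b SE 0). Qed.

Let partial_N x i : V x -> partial i N x = (c * tau i x) *: U x + rho i x *: e x.
Proof. exact: (partial_frame_N AF). Qed.

Let P i y := c^-1 * (a y * tau i y + b y * rho i y).
Let Q i y := b y * tau i y - a y * rho i y.

Let dct i x : V x -> differentiable (fun y => c * tau i y) x.
Proof. by move=> Vx; exact: differentiableZ (dtau i Vx). Qed.
Let dP i x : V x -> differentiable (P i) x.
Proof.
move=> Vx; apply: differentiableZ; apply: differentiableD.
  exact: differentiableM (da Vx) (dtau i Vx).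
exact: differentiableM (db Vx) (drho i Vx).
Qed.
Let dQ i x : V x -> differentiable (Q i) x.
Proof.
move=> Vx; apply: differentiableB.
  exact: differentiableM (db Vx) (dtau i Vx).
exact: differentiableM (da Vx) (drho i Vx).
Qed.

(** The symmetry of the second derivatives of [N], whose derivative is
    [c tau U + rho e]. *)
Lemma coframe_closed x i j : V x ->
  partial j (tau i) x = partial i (tau j) x /\
  partial j (rho i) x = partial i (rho j) x.
Proof.
move=> Vx; have [[NN hh UU ee] [Nh NU Ne] [hU he Ue] _] := af_frame AF Vx.
have UU' k : inner (partial k U x) (U x) = 0.
  by rewrite (se_U SE k Vx) innerDl !innerZl NU hU !mulr0 addr0.
have Ue' k : inner (partial k U x) (e x) = 0.
  by rewrite (se_U SE k Vx) innerDl !innerZl Ne he !mulr0 addr0.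
have eU' k : inner (partial k e x) (U x) = 0.
  by rewrite (se_e SE k Vx) innerDl !innerZl NU hU !mulr0 addr0.
have ee' k : inner (partial k e x) (e x) = 0.
  by rewrite (se_e SE k Vx) innerDl !innerZl Ne he !mulr0 addr0.
have dct' k := dct k Vx; have dr' k := drho k Vx.
split.
  have H := pair_symmetric1 i j oV Vx (af_N AF) partial_N dct' dr' (dU Vx) (de Vx)
    UU (etrans (innerC _ _) Ue) UU' eU'.
  apply: (mulfI (af_c AF)).
  exact: etrans (esym (partialZ j c (dtau i Vx))) (etrans H (partialZ i c (dtau j Vx))).
exact: (pair_symmetric2 i j oV Vx (af_N AF) partial_N dct' dr' (dU Vx) (de Vx)
    Ue ee Ue' ee').
Qed.

(** The connection form [<dU, e>] vanishes, so the contributions of [N] and [eta] to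
    its curvature cancel: this is the Gauss equation. *)
Lemma gauss_equation x : V x -> a x ^+ 2 + b x ^+ 2 = c ^+ 2.
Proof.
move=> Vx; have [[NN hh UU ee] [Nh NU Ne] [hU he Ue] _] := af_frame AF Vx.
have dr' k := differentiableN (drho k Vx); have dQ' k := dQ k Vx.
have S := pair_symmetric0 i0 i1 oV Vx (af_e AF) (se_e SE) dr' dQ' (dN Vx) (deta Vx) NU hU.
have NU' k : inner (partial k N x) (U x) = c * tau k x.
  by rewrite (partial_N k Vx) innerDl !innerZl UU (innerC (e x)) Ue mulr0 addr0 mulr1.
have hU' k : inner (partial k eta x) (U x) = - P k x.
  by rewrite (se_eta SE k Vx) innerDl !innerZl UU (innerC (e x)) Ue mulr0 addr0 mulr1.
apply: (gauss_algebra (af_delta AF Vx) (af_c AF)).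
by rewrite (NU' i0) (NU' i1) (hU' i0) (hU' i1) !mulrN in S; exact: S.
Qed.

(** The connection forms [<dU, eta>] and [<de, eta>] are closed, since
    [<dU, e>] vanishes. *)
Lemma codazzi_equations x i j : V x ->
  partial j (P i) x = partial i (P j) x /\ partial j (Q i) x = partial i (Q j) x.
Proof.
move=> Vx; have [[NN hh UU ee] [Nh NU Ne] [hU he Ue] _] := af_frame AF Vx.
have dct' k := differentiableN (dct k Vx); have dP' k := dP k Vx.
have dr' k := differentiableN (drho k Vx); have dQ' k := dQ k Vx.
have Nh' k : inner (partial k N x) (eta x) = 0.
  rewrite (partial_N k Vx) innerDl !innerZl (innerC (U x)) hU (innerC (e x)) he.
  by rewrite !mulr0 addr0.
have hh' k : inner (partial k eta x) (eta x) = 0.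
  rewrite (se_eta SE k Vx) innerDl !innerZl (innerC (U x)) hU (innerC (e x)) he.
  by rewrite !mulr0 addr0.
split.
  exact: (pair_symmetric2 i j oV Vx (af_U AF) (se_U SE) dct' dP' (dN Vx) (deta Vx)
    Nh hh Nh' hh').
exact: (pair_symmetric2 i j oV Vx (af_e AF) (se_e SE) dr' dQ' (dN Vx) (deta Vx)
  Nh hh Nh' hh').
Qed.

Lemma structure_constants x i : V x -> partial i a x = 0 /\ partial i b x = 0.
Proof.
move=> Vx.
have partialP k l : c * partial l (P k) x =
    a x * partial l (tau k) x + tau k x * partial l a x +
    (b x * partial l (rho k) x + rho k x * partial l b x).
  have d1 := differentiableM (da Vx) (dtau k Vx).
  have d2 := differentiableM (db Vx) (drho k Vx).
  rewrite (partialZ l c^-1 (differentiableD d1 d2)) (partialD l d1 d2).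
  rewrite (partialM l (da Vx) (dtau k Vx)) (partialM l (db Vx) (drho k Vx)).
  by rewrite mulVKf // (af_c AF).
have partialQ k l : partial l (Q k) x =
    b x * partial l (tau k) x + tau k x * partial l b x -
    (a x * partial l (rho k) x + rho k x * partial l a x).
  have d1 := differentiableM (db Vx) (dtau k Vx).
  have d2 := differentiableM (da Vx) (drho k Vx).
  rewrite (partialB l d1 d2).
  by rewrite (partialM l (db Vx) (dtau k Vx)) (partialM l (da Vx) (drho k Vx)).
have [PS QS] := codazzi_equations i0 i1 Vx.
have [TS RS] := coframe_closed i0 i1 Vx.
have gauss' l : a x * partial l a x + b x * partial l b x = 0.
  have d1 := differentiableM (da Vx) (da Vx).
  have d2 := differentiableM (db Vx) (db Vx).
  have G : forall y, V y -> a y * a y + b y * b y = c ^+ 2.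
    by move=> y Vy; rewrite -!expr2; exact: gauss_equation.
  have := eq_partial (g := fun=> c ^+ 2) l oV Vx G.
  rewrite partial_cst (partialD l d1 d2) (partialM l (da Vx) (da Vx)).
  rewrite (partialM l (db Vx) (db Vx)).
  move: (partial l a x) (partial l b x) (a x) (b x) => ? ? ? ? H.
  by lra.
have PS' := etrans (esym (partialP i0 i1)) (etrans (congr1 ( *%R c) PS) (partialP i1 i0)).
have QS' := etrans (esym (partialQ i0 i1)) (etrans QS (partialQ i1 i0)).
rewrite TS RS in PS' QS'.
have H := codazzi_algebra (af_delta AF Vx) (af_c AF) (gauss_equation Vx) (gauss' i0) (gauss' i1).
have [E0 E1 E2 E3] := H (codazzi_cancel1 PS') (codazzi_cancel2 QS').
by move: i; apply: ord2P; split; [exact: E0|exact: E2|exact: E1|exact: E3].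
Qed.

End Structure.

(** * The parameter of a surface *)

Section RotationAlgebra.
Context {R : realType}.
Variables (theta n : R).
Hypothesis theta_bounds : 0 < theta < pi / 2.
Hypothesis n_bounds : 1 <= n <= Num.sqrt (1 + cos theta ^+ 2).

Let c := cos theta.
Let s := sin theta.
Let rD := Num.sqrt (1 - n ^+ 2 * s ^+ 2).
Let rE := Num.sqrt (1 + c ^+ 2 - n ^+ 2 * s ^+ 2).
Let rq := Num.sqrt (1 + c ^+ 2 - n ^+ 2).

(** The coefficients of the second fundamental form of the model with parameter [n],
    and the angle between the frame [U, e] and the two rotating directions. *)
Definition model_a : R := c * (n ^+ 2 - 1) / rD.
Definition model_b : R := c * n * rq / rD.
Definition model_kappa : R := rq / rE.
Definition model_sigma : R := c * n / rE.

Local Notation a := model_a.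
Local Notation b := model_b.
Local Notation kap := model_kappa.
Local Notation sig := model_sigma.
Local Notation r1 := (c1 theta n).
Local Notation r2 := (c2 theta n).
Local Notation m1 := (mu1 theta n).
Local Notation m2 := (mu2 theta n).
Local Notation n2 := (nu2 theta n).

Let cs : s ^+ 2 = 1 - c ^+ 2.
Proof. by rewrite -(cos2Dsin2 theta) -/c -/s; ring. Qed.
Let cn0 : c != 0. Proof. by rewrite gt_eqF// cos_theta_gt0. Qed.
Let n_ge1 : 1 <= n. Proof. by case/andP: n_bounds. Qed.
Let q0 : 0 <= 1 + c ^+ 2 - n ^+ 2.
Proof.
have [_ nq] := andP n_bounds; rewrite subr_ge0.
have p0 : 0 <= 1 + c ^+ 2 by rewrite addr_ge0 ?sqr_ge0.
rewrite -[leRHS](sqr_sqrtr p0) ler_sqr ?nnegrE ?sqrtr_ge0//.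
exact: le_trans ler01 n_ge1.
Qed.
Let D0 : 0 < 1 - n ^+ 2 * s ^+ 2. Proof. exact: model_D_gt0. Qed.
Let E0 : 0 < 1 + c ^+ 2 - n ^+ 2 * s ^+ 2.
Proof.
have -> : 1 + c ^+ 2 - n ^+ 2 * s ^+ 2 = 1 - n ^+ 2 * s ^+ 2 + c ^+ 2 by ring.
by rewrite ltr_wpDr ?sqr_ge0.
Qed.
Let rDn0 : rD != 0. Proof. by rewrite gt_eqF// sqrtr_gt0. Qed.
Let rEn0 : rE != 0. Proof. by rewrite gt_eqF// sqrtr_gt0. Qed.
Let rD2 : rD ^+ 2 = 1 - n ^+ 2 * (1 - c ^+ 2).
Proof. by rewrite sqr_sqrtr ?(ltW D0)// cs. Qed.
Let rE2 : rE ^+ 2 = 1 + c ^+ 2 - n ^+ 2 * (1 - c ^+ 2).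
Proof. by rewrite sqr_sqrtr ?(ltW E0)// cs. Qed.
Let rq2 : rq ^+ 2 = 1 + c ^+ 2 - n ^+ 2. Proof. by rewrite sqr_sqrtr. Qed.

Let closed_forms : [/\ r1 = rD / rE, r2 = c / rE, m1 = n * c ^+ 2 / rD & m2 = rq] /\
  n2 = rq / rD.
Proof.
split; last exact: nu2E.
by split; [exact: c1E|exact: c2E|exact: mu1E|exact: mu2E].
Qed.

Lemma model_rotation_unit : kap ^+ 2 + sig ^+ 2 = 1.
Proof.
rewrite /kap /sig !expr_div_n -mulrDl rq2 rE2.
rewrite (_ : _ + _ = rE ^+ 2); last by rewrite rE2; ring.
by rewrite rE2 divff// -rE2 expf_neq0.
Qed.

(** The coefficients of [U] and [e] in the derivatives of
    [c1 N - c2 eta] and [c2 N + c1 eta]. *)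
Lemma model_rotation_tangent :
  [/\ m1 * sig = c * r1 + r2 * a / c, m1 * kap = r2 * b,
      n2 * sig = r2 * b / c & n2 * kap = r1 - r2 * a] /\
  [/\ m2 * kap = c * r2 - r1 * a / c, m2 * sig = r1 * b,
      n * kap = r1 * b / c & n * sig = r2 + r1 * a].
Proof.
have [[-> -> -> ->] ->] := closed_forms; rewrite /a /b /kap /sig.
split; split.
- transitivity (c * (rD ^+ 2 + n ^+ 2 - 1) / (rD * rE)); last by field; rewrite rDn0 rEn0 cn0.
  by rewrite rD2; field; rewrite rDn0 rEn0.
- by field; rewrite rDn0 rEn0.
- by field; rewrite rDn0 rEn0 cn0.
- transitivity ((rD ^+ 2 - c ^+ 2 * (n ^+ 2 - 1)) / (rD * rE)); last by field; rewrite rDn0 rEn0.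
  transitivity (rq ^+ 2 / (rD * rE)); first by field; rewrite rDn0 rEn0.
  by rewrite rq2 rD2; congr (_ / _); ring.
- transitivity (rq ^+ 2 / rE); first by field.
  by rewrite rq2; field; rewrite rDn0 rEn0 cn0.
- by field; rewrite rDn0 rEn0.
- by field; rewrite rDn0 rEn0 cn0.
- by field; rewrite rDn0 rEn0.
Qed.

(** The coefficients of [N] and [eta] in the derivatives of [sig U + kap e] and
    [kap U - sig e]. *)
Lemma model_rotation_normal :
  [/\ c * sig = m1 * r1, kap = n2 * r1, sig * a / c + kap * b = m1 * r2 &
      sig * b / c - kap * a = n2 * r2] /\
  [/\ c * kap = m2 * r2, sig = n * r2, kap * a / c - sig * b = - (m2 * r1) &
      kap * b / c + sig * a = n * r1].
Proof.
have [[-> -> -> ->] ->] := closed_forms; rewrite /a /b /kap /sig.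
split; split.
- by field; rewrite rDn0 rEn0.
- by field; rewrite rDn0 rEn0.
- transitivity (c * n * (n ^+ 2 - 1 + rq ^+ 2) / (rD * rE)); first by field; rewrite rDn0 rEn0 cn0.
  by rewrite rq2; field; rewrite rDn0 rEn0.
- by field; rewrite rDn0 rEn0 cn0.
- by field.
- by field.
- transitivity (rq * (n ^+ 2 - 1 - c ^+ 2 * n ^+ 2) / (rD * rE)); first by field; rewrite rDn0 rEn0 cn0.
  transitivity (- (rq * rD ^+ 2) / (rD * rE)); first by rewrite rD2; congr (_ / _); ring.
  by field; rewrite rDn0 rEn0.
- transitivity (n * (rq ^+ 2 + c ^+ 2 * n ^+ 2 - c ^+ 2) / (rD * rE)).
    by field; rewrite rDn0 rEn0 cn0.
  transitivity (n * rD ^+ 2 / (rD * rE)); first by rewrite rD2 rq2; congr (_ / _); ring.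
  by field; rewrite rDn0 rEn0.
Qed.

End RotationAlgebra.

Section ModelParameter.
Context {R : realType}.
Variable theta : R.
Hypothesis theta_bounds : 0 < theta < pi / 2.
Let c := cos theta.
Let s := sin theta.

(** The nonnegative root [w] of [c^2 w^2 + a2 s^2 w = a2 c^2], for [a2 = a^2], is
    [n^2 - 1], as one sees by squaring the formula for [model_a]. *)
Definition model_parameter (a2 : R) : R := Num.sqrt (1 +
  (Num.sqrt ((a2 * s ^+ 2) ^+ 2 + 4 * (a2 * c ^+ 4)) - a2 * s ^+ 2) / (2 * c ^+ 2)).

(** The equation for [w] gives [a^2 = model_a^2], and then
    [b^2 = c^2 - a^2 = model_b^2]; the upper bound on [n] comes from [a^2 <= c^2]. *)
Lemma model_parameterP (a b : R) : 0 <= a -> 0 <= b -> a ^+ 2 + b ^+ 2 = c ^+ 2 ->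
  [/\ 1 <= model_parameter (a ^+ 2) <= Num.sqrt (1 + c ^+ 2),
      a = model_a theta (model_parameter (a ^+ 2)) &
      b = model_b theta (model_parameter (a ^+ 2))].
Proof.
move=> a0 b0 ab.
have c0 : 0 < c by exact: cos_theta_gt0.
have cn0 : c != 0 by rewrite gt_eqF.
have c20 : 0 < c ^+ 2 by exact: exprn_gt0.
have s2 : s ^+ 2 = 1 - c ^+ 2 by rewrite -(cos2Dsin2 theta) -/c -/s; ring.
set a2 := a ^+ 2.
have a20 : 0 <= a2 by exact: sqr_ge0.
have a2c : a2 <= c ^+ 2 by rewrite -ab lerDl sqr_ge0.
rewrite /model_parameter; set Z := _ + 4 * _; set w := (_ - _) / _.
have Z0 : 0 <= Z by rewrite addr_ge0 ?sqr_ge0// mulr_ge0// mulr_ge0// exprn_ge0// ltW.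
have as0 : 0 <= a2 * s ^+ 2 by rewrite mulr_ge0 ?sqr_ge0.
have w0 : 0 <= w.
  apply: divr_ge0; last by rewrite mulr_ge0 ?sqr_ge0.
  rewrite subr_ge0 -[leLHS]ger0_norm// -sqrtr_sqr.
  by rewrite ler_wsqrtr// lerDl mulr_ge0// mulr_ge0// exprn_ge0// ltW.
have wE : c ^+ 2 * w ^+ 2 + a2 * s ^+ 2 * w = a2 * c ^+ 2.
  have rZ : Num.sqrt Z ^+ 2 = (a2 * s ^+ 2) ^+ 2 + 4 * (a2 * c ^+ 4) by rewrite sqr_sqrtr.
  rewrite /w; move: (Num.sqrt Z) rZ => r rZ.
  transitivity ((r ^+ 2 - (a2 * s ^+ 2) ^+ 2) / (4 * c ^+ 2)); first by field.
  by rewrite rZ; field.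
have wc : w <= c ^+ 2.
  rewrite leNgt; apply/negP => cw.
  have h1 : 0 < w * (c ^+ 2 * (w - c ^+ 2)).
    by rewrite mulr_gt0 ?(lt_trans c20 cw)// mulr_gt0// subr_gt0.
  have h2 : 0 <= w * (c ^+ 2 * (c ^+ 2 - a2)).
    by rewrite mulr_ge0// mulr_ge0 ?subr_ge0// ltW.
  have h3 : 0 <= a2 * (w - c ^+ 2) by rewrite mulr_ge0// subr_ge0 ltW.
  have : 0 < w * (c ^+ 2 * (w - c ^+ 2)) + w * (c ^+ 2 * (c ^+ 2 - a2)) + a2 * (w - c ^+ 2).
    by rewrite ltr_pwDl// ltr_pwDl.
  have -> : w * (c ^+ 2 * (w - c ^+ 2)) + w * (c ^+ 2 * (c ^+ 2 - a2)) + a2 * (w - c ^+ 2) =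
      c ^+ 2 * w ^+ 2 + a2 * s ^+ 2 * w - a2 * c ^+ 2 by rewrite s2; ring.
  by rewrite wE subrr ltxx.
set n := Num.sqrt _.
have w1 : 0 <= 1 + w by rewrite addr_ge0.
have n2 : n ^+ 2 = 1 + w by rewrite sqr_sqrtr.
have nb : 1 <= n <= Num.sqrt (1 + c ^+ 2).
  by rewrite -{1}sqrtr1 !ler_wsqrtr// ?lerDl// lerD2l.
have n0 : 0 <= n by exact: sqrtr_ge0.
clearbody n.
have D0 := model_D_gt0 theta_bounds nb.
have rD0 : 0 < Num.sqrt (1 - n ^+ 2 * s ^+ 2) by rewrite sqrtr_gt0.
have rD2 : Num.sqrt (1 - n ^+ 2 * s ^+ 2) ^+ 2 = c ^+ 2 - w * s ^+ 2.
  by rewrite sqr_sqrtr ?(ltW D0)// n2 s2; ring.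
have Dn0 : c ^+ 2 - w * s ^+ 2 != 0 by rewrite -rD2 expf_neq0// gt_eqF.
have q0 : 0 <= 1 + c ^+ 2 - n ^+ 2 by rewrite n2; lra.
have aE : a2 = (c * (n ^+ 2 - 1)) ^+ 2 / (c ^+ 2 - w * s ^+ 2).
  apply: (mulIf Dn0); rewrite mulfVK// n2.
  transitivity (a2 * c ^+ 2 - a2 * s ^+ 2 * w); first by ring.
  by rewrite -wE; ring.
have bE : b ^+ 2 = (c * n) ^+ 2 * (1 + c ^+ 2 - n ^+ 2) / (c ^+ 2 - w * s ^+ 2).
  have -> : b ^+ 2 = c ^+ 2 - a2 by rewrite -ab /a2; ring.
  apply: (mulIf Dn0); rewrite mulfVK// exprMn n2.
  transitivity (c ^+ 2 * (c ^+ 2 - w * s ^+ 2) - (a2 * c ^+ 2 - a2 * s ^+ 2 * w)); first by ring.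
  by rewrite -wE s2; ring.
split=> //.
- apply/eqP; rewrite -(@eqrXn2 _ 2)//; last first.
    by rewrite /model_a mulr_ge0 ?invr_ge0 ?(ltW rD0)// mulr_ge0 ?(ltW c0)// n2; lra.
  by rewrite -/a2 aE /model_a expr_div_n rD2.
- apply/eqP; rewrite -(@eqrXn2 _ 2)//; last first.
    by rewrite /model_b !mulr_ge0 ?invr_ge0 ?(ltW rD0) ?(ltW c0) ?sqrtr_ge0.
  by rewrite bE /model_b expr_div_n rD2 [(_ * Num.sqrt _) ^+ 2]exprMn (sqr_sqrtr q0).
Qed.

End ModelParameter.

(** * Rotating frames *)

Lemma rotated_frame (R : realType) (N eta U e : 'rV[R]_5) (r1 r2 k s : R) :
  orthonormal_frame N eta U e -> r1 ^+ 2 + r2 ^+ 2 = 1 -> k ^+ 2 + s ^+ 2 = 1 ->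
  orthonormal_frame (r1 *: N - r2 *: eta) (s *: U + k *: e)
    (r2 *: N + r1 *: eta) (k *: U - s *: e).
Proof.
move=> [[NN hh UU ee] [Nh NU Ne] [hU he Ue] [Nt ht Ut et]] r12 ks.
have [hN eU] : inner eta N = 0 /\ inner e U = 0 by rewrite innerC Nh innerC Ue.
have [UN eN Uh eh] : [/\ inner U N = 0, inner e N = 0, inner U eta = 0 & inner e eta = 0].
  by rewrite (innerC U) NU (innerC e) Ne (innerC U) hU (innerC e) he.
split; split; rewrite ?(innerBl, innerDl) ?(innerBr, innerDr) ?innerZl ?innerZr;
  rewrite ?NN ?hh ?UU ?ee ?Nh ?NU ?Ne ?hU ?he ?Ue ?Nt ?ht ?Ut ?et ?hN ?eU ?UN ?eN ?Uh ?eh.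
- by apply: etrans _ r12; ring.
- by apply: etrans _ ks; ring.
- by apply: etrans _ r12; ring.
- by apply: etrans _ ks; ring.
all: by ring.
Qed.

Section RotatedDerivatives.
Context {R : realType}.
Variables (N eta U e : 'rV[R]_5) (a b c t r r1 r2 m1 m2 n2 n kap sig : R).
Hypothesis cn0 : c != 0.

Let p := c^-1 * (a * t + b * r).
Let q := b * t - a * r.

Lemma rotated_V :
  [/\ m1 * sig = c * r1 + r2 * a / c, m1 * kap = r2 * b,
      n2 * sig = r2 * b / c & n2 * kap = r1 - r2 * a] ->
  r1 *: ((c * t) *: U + r *: e) - r2 *: (- p *: U + - q *: e) =
  (m1 * t + n2 * r) *: (sig *: U + kap *: e).
Proof.
move=> [H1 H2 H3 H4].
transitivity ((m1 * sig * t + n2 * sig * r) *: U + (m1 * kap * t + n2 * kap * r) *: e).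
  by rewrite H1 H2 H3 H4; rewrite /p /q; apply/rowP => j; rewrite !mxE; field.
by apply/rowP => j; rewrite !mxE; ring.
Qed.

Lemma rotated_W :
  [/\ m2 * kap = c * r2 - r1 * a / c, m2 * sig = r1 * b,
      n * kap = r1 * b / c & n * sig = r2 + r1 * a] ->
  r2 *: ((c * t) *: U + r *: e) + r1 *: (- p *: U + - q *: e) =
  (m2 * t - n * r) *: (kap *: U - sig *: e).
Proof.
move=> [H1 H2 H3 H4].
transitivity ((m2 * kap * t - n * kap * r) *: U + (n * sig * r - m2 * sig * t) *: e).
  by rewrite H1 H2 H3 H4; rewrite /p /q; apply/rowP => j; rewrite !mxE; field.
by apply/rowP => j; rewrite !mxE; ring.
Qed.

Lemma rotated_V' :
  [/\ c * sig = m1 * r1, kap = n2 * r1, sig * a / c + kap * b = m1 * r2 &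
      sig * b / c - kap * a = n2 * r2] ->
  sig *: (- (c * t) *: N + p *: eta) + kap *: (- r *: N + q *: eta) =
  - (m1 * t + n2 * r) *: (r1 *: N - r2 *: eta).
Proof.
move=> [H1 H2 H3 H4].
transitivity (- ((c * sig) * t + kap * r) *: N +
    ((sig * a / c + kap * b) * t + (sig * b / c - kap * a) * r) *: eta).
  by rewrite /p /q; apply/rowP => j; rewrite !mxE; field.
by rewrite H1 H3 H4 {1}H2; apply/rowP => j; rewrite !mxE; ring.
Qed.

Lemma rotated_W' :
  [/\ c * kap = m2 * r2, sig = n * r2, kap * a / c - sig * b = - (m2 * r1) &
      kap * b / c + sig * a = n * r1] ->
  kap *: (- (c * t) *: N + p *: eta) - sig *: (- r *: N + q *: eta) =
  - (m2 * t - n * r) *: (r2 *: N + r1 *: eta).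
Proof.
move=> [H1 H2 H3 H4].
transitivity (- ((c * kap) * t - sig * r) *: N +
    ((kap * a / c - sig * b) * t + (kap * b / c + sig * a) * r) *: eta).
  by rewrite /p /q; apply/rowP => j; rewrite !mxE; field.
by rewrite H1 H3 H4 {1}H2; apply/rowP => j; rewrite !mxE; ring.
Qed.

End RotatedDerivatives.

(** The pair [(g, h)] is a unit vector turning with speed [beta], so that its angle is
    [asin g] as long as [h] is positive. *)
Lemma rotation_angle (R : realType) (m : nat) (g h : 'rV[R]_m -> R)
    (beta : 'I_m -> 'rV[R]_m -> R) (z : 'rV[R]_m) (r : R) :
  0 < r ->
  (forall w, ball z r w -> differentiable g w) ->
  (forall w, ball z r w -> differentiable h w) ->
  (forall w i, ball z r w -> partial i g w = beta i w * h w) ->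
  (forall w i, ball z r w -> partial i h w = - beta i w * g w) ->
  g z = 0 -> h z = 1 ->
  exists (r' : R) (B : 'rV[R]_m -> R), [/\ 0 < r' <= r, B z = 0,
    (forall w, ball z r' w -> differentiable B w) &
    (forall w i, ball z r' w -> partial i B w = beta i w)].
Proof.
move=> r0 dg dh pg ph gz hz.
have zr : ball z r z by exact: ballxx.
have unit w : ball z r w -> g w ^+ 2 + h w ^+ 2 = 1.
  move=> zw; pose k y := g y * g y + h y * h y.
  have dk y : ball z r y -> differentiable k y.
    move=> zy; have [Dg Dh] := (dg y zy, dh y zy).
    exact: differentiableD (differentiableM Dg Dg) (differentiableM Dh Dh).
  have pk y i : ball z r y -> partial i k y = 0.
    move=> zy; have [Dg Dh] := (dg y zy, dh y zy).
    rewrite (partialD i (differentiableM Dg Dg) (differentiableM Dh Dh)).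
    rewrite (partialM i Dg Dg) (partialM i Dh Dh) (pg y i zy) (ph y i zy).
    by move: (g y) (h y) (beta i y) => ? ? ?; ring.
  have := constant_on_ball1 dk pk r0 zw.
  by rewrite /k gz hz -!expr2 expr1n expr0n/= add0r.
have ch : {for z, continuous h} by exact: differentiable_continuous (dh z zr).
have : \forall w \near z, 0 < h w.
  by apply: (cvgr_gt (h z) ch); rewrite hz.
move=> /nbhs_ballP[e /= e0 he].
exists (Num.min r e), (fun w => asin (g w)).
have sub w : ball z (Num.min r e) w -> ball z r w /\ 0 < h w.
  move=> zw; split; first by apply: le_ball zw; rewrite ge_min lexx.
  by apply: he; apply: le_ball zw; rewrite ge_min lexx orbT.
have root w : ball z (Num.min r e) w -> Num.sqrt (1 - g w ^+ 2) = h w /\ -1 < g w < 1.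
  move=> /sub[zw hw]; have u := unit w zw.
  have -> : 1 - g w ^+ 2 = h w ^+ 2 by rewrite -u; ring.
  split; first by rewrite sqrtr_sqr ger0_norm// ltW.
  rewrite -ltr_norml -(@ltr_pXn2r _ 2) ?nnegrE// expr1n real_normK ?num_real// -u.
  by rewrite ltrDl exprn_gt0.
have asin' w : ball z (Num.min r e) w -> is_derive (g w) 1 asin ((h w)^-1).
  move=> zw; have [<- bnd] := root w zw; exact: is_derive1_asin.
split.
- by rewrite lt_min r0 e0 ge_min lexx.
- rewrite gz -[X in asin X]sin0 sinK// in_itv/=.
  by rewrite oppr_le0 divr_ge0 ?pi_ge0.
- move=> w zw; have [zw' _] := sub w zw.
  exact: differentiable_comp1 (dg w zw') (asin' w zw).
- move=> w i zw; have [zw' hw] := sub w zw.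
  rewrite (partial_comp1 i (dg w zw') (asin' w zw)) (pg w i zw').
  by rewrite mulrCA mulVf ?mulr1// gt_eqF.
Qed.

(** * The local model *)

Section LocalModel.
Context {R : realType}.
Variables (theta n : R).
Variables (f N eta U e : 'rV[R]_2 -> 'rV[R]_5) (tau rho : 'I_2 -> 'rV[R]_2 -> R).
Variables (V : set 'rV[R]_2) (z : 'rV[R]_2).
Hypothesis theta_bounds : 0 < theta < pi / 2.
Hypothesis n_bounds : 1 <= n <= Num.sqrt (1 + cos theta ^+ 2).
Hypothesis SE : structure_equations f N eta U e tau rho
  (fun=> model_a theta n) (fun=> model_b theta n) (cos theta) (sin theta) V.
Hypothesis Vz : V z.

Let i0 : 'I_2 := ord0.
Let i1 : 'I_2 := ord_max.
Let AF := se_frame SE.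
Let oV := af_open AF.
Let cn0 := af_c AF.
Let sn0 := af_s AF.

Local Notation r1 := (c1 theta n).
Local Notation r2 := (c2 theta n).
Local Notation m1 := (mu1 theta n).
Local Notation m2 := (mu2 theta n).
Local Notation n2 := (nu2 theta n).
Local Notation kap := (model_kappa theta n).
Local Notation sig := (model_sigma theta n).

Let V1 x := r1 *: N x - r2 *: eta x.
Let V1' x := sig *: U x + kap *: e x.
Let W1 x := r2 *: N x + r1 *: eta x.
Let W1' x := kap *: U x - sig *: e x.
Let alpha i x := m1 * tau i x + n2 * rho i x.
Let beta i x := m2 * tau i x - n * rho i x.

Let dU x : V x -> differentiable U x. Proof. exact: smooth_differentiable (af_U AF). Qed.
Let de x : V x -> differentiable e x. Proof. exact: smooth_differentiable (af_e AF). Qed.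
Let dN x : V x -> differentiable N x. Proof. exact: smooth_differentiable (af_N AF). Qed.
Let deta x : V x -> differentiable eta x.
Proof. exact: smooth_differentiable (af_eta AF). Qed.
Let df x : V x -> differentiable f x. Proof. exact: smooth_differentiable (af_f AF). Qed.

Let dV1 x : V x -> differentiable V1 x.
Proof.
move=> Vx; exact: differentiableB (differentiableZ r1 (dN Vx)) (differentiableZ r2 (deta Vx)).
Qed.
Let dW1 x : V x -> differentiable W1 x.
Proof.
move=> Vx; exact: differentiableD (differentiableZ r2 (dN Vx)) (differentiableZ r1 (deta Vx)).
Qed.
Let dV1' x : V x -> differentiable V1' x.
Proof.
move=> Vx; exact: differentiableD (differentiableZ sig (dU Vx)) (differentiableZ kap (de Vx)).
Qed.
Let dW1' x : V x -> differentiable W1' x.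
Proof.
move=> Vx; exact: differentiableB (differentiableZ kap (dU Vx)) (differentiableZ sig (de Vx)).
Qed.

Let partial_V1 i x : V x -> partial i V1 x = alpha i x *: V1' x.
Proof.
move=> Vx; rewrite (partialB i (differentiableZ r1 (dN Vx)) (differentiableZ r2 (deta Vx))).
rewrite (partialZ i r1 (dN Vx)) (partialZ i r2 (deta Vx)) (partial_frame_N AF i Vx).
rewrite (se_eta SE i Vx); apply: rotated_V cn0 _.
exact: (model_rotation_tangent theta_bounds n_bounds).1.
Qed.

Let partial_W1 i x : V x -> partial i W1 x = beta i x *: W1' x.
Proof.
move=> Vx; rewrite (partialD i (differentiableZ r2 (dN Vx)) (differentiableZ r1 (deta Vx))).
rewrite (partialZ i r2 (dN Vx)) (partialZ i r1 (deta Vx)) (partial_frame_N AF i Vx).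
rewrite (se_eta SE i Vx); apply: rotated_W cn0 _.
exact: (model_rotation_tangent theta_bounds n_bounds).2.
Qed.

Let partial_V1' i x : V x -> partial i V1' x = - alpha i x *: V1 x.
Proof.
move=> Vx; rewrite (partialD i (differentiableZ sig (dU Vx)) (differentiableZ kap (de Vx))).
rewrite (partialZ i sig (dU Vx)) (partialZ i kap (de Vx)) (se_U SE i Vx) (se_e SE i Vx).
apply: rotated_V' cn0 _; exact: (model_rotation_normal theta_bounds n_bounds).1.
Qed.

Let partial_W1' i x : V x -> partial i W1' x = - beta i x *: W1 x.
Proof.
move=> Vx; rewrite (partialB i (differentiableZ kap (dU Vx)) (differentiableZ sig (de Vx))).
rewrite (partialZ i kap (dU Vx)) (partialZ i sig (de Vx)) (se_U SE i Vx) (se_e SE i Vx).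
apply: rotated_W' cn0 _; exact: (model_rotation_normal theta_bounds n_bounds).2.
Qed.

Let rotating_frame x : V x -> orthonormal_frame (V1 x) (V1' x) (W1 x) (W1' x).
Proof.
move=> Vx; apply: rotated_frame (af_frame AF Vx) _ _.
  exact: model_radii.
exact: model_rotation_unit.
Qed.

Let N_rotating x : N x = r1 *: V1 x + r2 *: W1 x.
Proof.
rewrite /V1 /W1; apply/rowP => j; rewrite !mxE.
transitivity ((r1 ^+ 2 + r2 ^+ 2) * N x 0 j); last by ring.
by rewrite model_radii// mul1r.
Qed.

Let h := f z 0 ord_max.
Let X x := (sin theta)^-1 * (f x 0 ord_max - h).

Let dX x : V x -> differentiable X x.
Proof.
move=> Vx; apply: differentiableZ; apply: differentiableB; last exact: differentiable_cst.
exact: (differentiable_rowP _ _).1 (df Vx) ord_max.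
Qed.

Let partial_X i x : V x -> partial i X x = tau i x.
Proof.
move=> Vx; have df5 : differentiable (fun y => f y 0 ord_max) x.
  exact: (differentiable_rowP _ _).1 (df Vx) ord_max.
have dh : differentiable (fun=> h) x by exact: differentiable_cst.
rewrite (partialZ i _ (differentiableB df5 dh)) (partialB i df5 dh) partial_cst subr0.
rewrite -(partial_coord i ord_max (df Vx)).
rewrite (af_partial AF i Vx) -inner_dt innerDl !innerZl innerDl !innerZl dt_dt.
have [_ _ _ [_ _ -> ->]] := af_frame AF Vx.
rewrite !mulr0 add0r addr0 mulr1 [_ * sin theta]mulrC.
exact: mulKf sn0 _.
Qed.

(** With [X] the height divided by [sin theta] and [Y] such that [dX = tau] and
    [dY = rho], the pairs [(V1, V1')] and [(W1, W1')] turn by the angles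
    [mu1 X + nu2 Y] and [mu2 X - nu1 Y]. The second angle exists by
    [rotation_angle] and defines [Y]. *)
Lemma structure_local_model : exists (r : R) (psi : 'rV[R]_2 -> 'rV[R]_2)
    (phi : 'rV[R]_5 -> 'rV[R]_5),
  [/\ 0 < r /\ ball z r `<=` V, smooth_on (ball z r) psi,
      jacobian psi z \in unitmx, isometry_S3R phi &
      forall x, ball z r x -> f x = phi (model theta n (psi x 0 0) (psi x 0 1))].
Proof.
have n0 : n != 0 by rewrite gt_eqF// (lt_le_trans ltr01)//; case/andP: n_bounds.
have [r /= r0 rV] := (nbhs_ballP z _).1 (open_nbhs_nbhs (conj oV Vz)).
(* Paired with [W1' z], the rotation of [W1] and [W1'] becomes that of a unit vector of
   the plane. *)
pose g w := inner (W1 w) (W1' z); pose k w := inner (W1' w) (W1' z).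
have dc (w : 'rV[R]_2) : differentiable (fun=> W1' z) w by exact: differentiable_cst.
have dg w : ball z r w -> differentiable g w.
  by move=> /rV Vw; exact: (differentiable_inner (dW1 Vw) (dc w)).
have dk w : ball z r w -> differentiable k w.
  by move=> /rV Vw; exact: (differentiable_inner (dW1' Vw) (dc w)).
have pg w i : ball z r w -> partial i g w = beta i w * k w.
  move=> /rV Vw; rewrite (partial_inner i (dW1 Vw) (dc w)) partial_cst inner0r addr0.
  by rewrite (partial_W1 i Vw) innerZl.
have pk w i : ball z r w -> partial i k w = - beta i w * g w.
  move=> /rV Vw; rewrite (partial_inner i (dW1' Vw) (dc w)) partial_cst inner0r addr0.
  by rewrite (partial_W1' i Vw) innerZl.
have [[F1 F2 F3 F4] [F5 F6 F7] [F8 F9 F10] F11] := rotating_frame Vz.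
have [r' [B [/andP[r'0 r'r] Bz dB pB]]] := rotation_angle r0 dg dk pg pk F10 F4.
have bV : ball z r' `<=` V by move=> w zw; apply: rV; exact: le_ball r'r _ zw.
have zz : ball z r' z by exact: ballxx.
have ob : open (ball z r') by exact: ball_open.
pose Y w := n^-1 * (m2 * X w - B w).
have dmX w : ball z r' w -> differentiable (fun y => m2 * X y) w.
  by move=> /bV Vw; exact: differentiableZ (dX Vw).
have dY w : ball z r' w -> differentiable Y w.
  by move=> zw; exact: differentiableZ (differentiableB (dmX w zw) (dB w zw)).
have pY w i : ball z r' w -> partial i Y w = rho i w.
  move=> zw; rewrite (partialZ i _ (differentiableB (dmX w zw) (dB w zw))).
  rewrite (partialB i (dmX w zw) (dB w zw)) (partialZ i m2 (dX (bV w zw))).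
  rewrite (partial_X i (bV w zw)) (pB w i zw) /beta.
  move: (tau i w) (rho i w) => t q.
  transitivity (n^-1 * (n * q)); last by rewrite mulKf.
  by congr (_ * _); rewrite -[m2 *: t]/(m2 * t); ring.
have Xz : X z = 0 by rewrite /X /h subrr mulr0.
have Yz : Y z = 0 by rewrite /Y Xz Bz mulr0 subrr mulr0.
pose A w := m1 * X w + n2 * Y w.
have dA w : ball z r' w -> differentiable A w.
  move=> zw; exact: differentiableD (differentiableZ m1 (dX (bV w zw)))
    (differentiableZ n2 (dY w zw)).
have pA w i : ball z r' w -> partial i A w = alpha i w.
  move=> zw; have d1 := differentiableZ m1 (dX (bV w zw)).
  have d2 := differentiableZ n2 (dY w zw).
  rewrite (partialD i d1 d2) (partialZ i m1 (dX (bV w zw))) (partialZ i n2 (dY w zw)).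
  by rewrite (partial_X i (bV w zw)) (pY w i zw).
have Az : A z = 0 by rewrite /A Xz Yz !mulr0 addr0.
have VE w : ball z r' w -> V1 w = cos (A w) *: V1 z + sin (A w) *: V1' z.
  move=> zw; apply: (rotation_equation (alpha := alpha) r'0 _ _ dA _ _ pA Az zw).
  - by move=> y /bV; exact: dV1.
  - by move=> y /bV; exact: dV1'.
  - by move=> y i /bV; exact: partial_V1.
  - by move=> y i /bV; exact: partial_V1'.
have WE w : ball z r' w -> W1 w = cos (B w) *: W1 z + sin (B w) *: W1' z.
  move=> zw; apply: (rotation_equation (alpha := beta) r'0 _ _ dB _ _ pB Bz zw).
  - by move=> y /bV; exact: dW1.
  - by move=> y /bV; exact: dW1'.
  - by move=> y i /bV; exact: partial_W1.
  - by move=> y i /bV; exact: partial_W1'.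
pose psi w : 'rV[R]_2 := \row_j (if j == i0 then X w else Y w).
pose L := frame_mx (V1 z) (V1' z) (W1 z) (W1' z).
exists r', psi, (fun p => p *m L + h *: dt R).
have psi0 w : psi w 0 i0 = X w by rewrite mxE.
have psi1 w : psi w 0 i1 = Y w by rewrite mxE.
have CX l : Ck l (ball z r') X.
  case: l => [|l]; first by split=> // w /bV; exact: dX.
  split=> [w /bV|i]; first exact: dX.
  apply: (eq_Ck ob) (sub_Ck bV (af_tau AF i l)) => w zw.
  exact/esym/partial_X/bV.
have CY l : Ck l (ball z r') Y.
  case: l => [|l]; first by split=> // w; exact: dY.
  split=> [w|i]; first exact: dY.
  apply: (eq_Ck ob) (sub_Ck bV (af_rho AF i l)) => w zw.
  exact/esym/pY.
have Spsi : smooth_on (ball z r') psi.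
  apply/smooth_onP => l; apply/Ck_rowP => // j; move: j; apply: ord2P.
    by apply: (eq_Ck ob) (CX l) => w _; rewrite psi0.
  by apply: (eq_Ck ob) (CY l) => w _; rewrite psi1.
split=> //.
- have dpsi := smooth_differentiable Spsi zz.
  have p0 i : partial i psi z 0 i0 = tau i z.
    rewrite (partial_coord i i0 dpsi) -(partial_X i Vz).
    exact: (eq_partial i ob zz (fun w _ => psi0 w)).
  have p1 i : partial i psi z 0 i1 = rho i z.
    rewrite (partial_coord i i1 dpsi) -(pY z i zz).
    exact: (eq_partial i ob zz (fun w _ => psi1 w)).
  have -> : jacobian psi z = \matrix_(i, j) (if j == i0 then tau i z else rho i z).
    apply/matrixP => i j; rewrite (jacobianE i j dpsi) [RHS]mxE.
    by move: j; apply: ord2P; [exact: p0|exact: p1].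
  rewrite unitmxE unitfE (expand_det_row _ i0) sum_ord2 /cofactor !det_mx11 !mxE /=.
  have -> : lift i0 (0 : 'I_1) = i1 by exact/val_inj.
  have := af_delta AF Vz; rewrite -/i0 -/i1.
  move: (tau i0 z) (tau i1 z) (rho i0 z) (rho i1 z) => t0 t1 q0 q1.
  by apply: contra_neq => H; rewrite -[RHS]H /=; ring.
- apply: affine_isometry; last exact: frame_mx_dt.
  exact/frame_orthogonal/rotating_frame.
move=> w zw; rewrite model_torus.
have LE : dt R *m L = 1 *: dt R by rewrite scale1r; exact: frame_mx_dt.
rewrite (torus_mulmx _ _ _ _ _ _ _ _ _ _ _ _ _ _ LE).
have row_L (j : nat) : (j < 5)%N ->
    delta_mx 0 (inord j) *m L = [:: V1 z; V1' z; W1 z; W1' z; dt R]`_j.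
  by move=> j5; rewrite -rowE rowK inordK.
rewrite !row_L//= mulr1 mul0r add0r /torus /rotating.
have -> : linear_form (sin theta) 0 (psi w) = f w 0 ord_max - h.
  by rewrite /linear_form psi0 mul0r addr0 /X mulVKf.
have -> : linear_form m1 n2 (psi w) = A w by rewrite /linear_form psi0 psi1.
have -> : linear_form m2 (- n) (psi w) = B w.
  by rewrite /linear_form psi0 psi1 /Y mulNr mulVKf//; ring.
rewrite [h + _]addrC subrK.
have fE : f w = N w + f w 0 ord_max *: dt R.
  by rewrite (af_normal AF (bV w zw)) sphere_partK.
rewrite {1}fE N_rotating (VE w zw) (WE w zw).
move: (f w 0 ord_max) (cos _) (sin _) (cos _) (sin _) => fw ca sa cb sb.
move: (V1 z) (V1' z) (W1 z) (W1' z) (dt R) r1 r2 => v v' u u' d k1 k2.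
by apply/rowP => j; rewrite !mxE; ring.
Qed.

End LocalModel.

(** * Constant angle minimal surfaces are locally models *)

Section StructureSymmetries.
Context {R : realType}.
Variables (f N eta U e : 'rV[R]_2 -> 'rV[R]_5) (tau rho : 'I_2 -> 'rV[R]_2 -> R).
Variables (a b : 'rV[R]_2 -> R) (c s : R) (V : set 'rV[R]_2).
Hypothesis SE : structure_equations f N eta U e tau rho a b c s V.
Let AF := se_frame SE.

Lemma sub_structure W : open W -> W `<=` V ->
  structure_equations f N eta U e tau rho a b c s W.
Proof.
move=> oW WV; split.
- case: AF => oV Sf SN Sh SU Se Ct Cr F fN pf d c0 s0 cs.
  split=> //; try exact: (sub_smooth WV).
  + by move=> i k; exact: sub_Ck WV (Ct i k).
  + by move=> i k; exact: sub_Ck WV (Cr i k).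
  + by move=> x /WV; exact: F.
  + by move=> x /WV; exact: fN.
  + by move=> x i /WV; exact: pf.
  + by move=> x /WV; exact: d.
- by move=> k; exact: sub_Ck WV (se_a SE k).
- by move=> k; exact: sub_Ck WV (se_b SE k).
- by move=> x i /WV Vx; exact: (se_U SE i Vx).
- by move=> x i /WV Vx; exact: (se_e SE i Vx).
- by move=> x i /WV Vx; exact: (se_eta SE i Vx).
Qed.

Lemma constant_structure (a0 b0 : R) : (forall x, V x -> a x = a0) ->
  (forall x, V x -> b x = b0) ->
  structure_equations f N eta U e tau rho (fun=> a0) (fun=> b0) c s V.
Proof.
move=> aE bE; split=> //.
- by move=> k; exact: Ck_cst.
- by move=> k; exact: Ck_cst.
- by move=> x i Vx; rewrite (se_U SE i Vx) (aE x Vx) (bE x Vx).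
- by move=> x i Vx; rewrite (se_e SE i Vx) (aE x Vx) (bE x Vx).
- by move=> x i Vx; rewrite (se_eta SE i Vx) (aE x Vx) (bE x Vx).
Qed.

End StructureSymmetries.

Section SignFlips.
Context {R : realType}.
Variables (f N eta U e : 'rV[R]_2 -> 'rV[R]_5) (tau rho : 'I_2 -> 'rV[R]_2 -> R).
Variables (a b c s : R) (V : set 'rV[R]_2).
Hypothesis SE : structure_equations f N eta U e tau rho (fun=> a) (fun=> b) c s V.
Let AF := se_frame SE.

Let smoothN (g : 'rV[R]_2 -> 'rV[R]_5) : smooth_on V g -> smooth_on V (fun x => - g x).
Proof.
move=> /smooth_onP Sg; apply/smooth_onP => k; apply: CkN (Sg k); exact: af_open AF.
Qed.

Lemma structure_flip_eta :
  structure_equations f N (fun x => - eta x) U e tau rho (fun=> - a) (fun=> - b) c s V.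
Proof.
split.
- case: AF => oV Sf SN Sh SU Se Ct Cr F fN pf d c0 s0 cs.
  split=> //; first exact: smoothN.
  move=> x /F [[NN hh UU ee] [Nh NU Ne] [hU he Ue] [Nt ht Ut et]].
  by do !split; rewrite ?innerNl ?innerNr ?Nh ?hU ?he ?ht ?oppr0 ?opprK.
- by move=> k; exact: Ck_cst.
- by move=> k; exact: Ck_cst.
- move=> x i Vx; rewrite (se_U SE i Vx); apply/rowP => j; rewrite !mxE; ring.
- move=> x i Vx; rewrite (se_e SE i Vx); apply/rowP => j; rewrite !mxE; ring.
- move=> x i Vx; have dh := smooth_differentiable (af_eta AF) Vx.
  rewrite (partialN i dh) (se_eta SE i Vx); apply/rowP => j; rewrite !mxE; ring.
Qed.

Lemma structure_flip_e :
  structure_equations f N eta U (fun x => - e x) tau (fun i x => - rho i x)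
    (fun=> a) (fun=> - b) c s V.
Proof.
split.
- case: AF => oV Sf SN Sh SU Se Ct Cr F fN pf d c0 s0 cs.
  split=> //.
  + exact: smoothN.
  + by move=> i k; exact: CkN.
  + move=> x /F [[NN hh UU ee] [Nh NU Ne] [hU he Ue] [Nt ht Ut et]].
    by do !split; rewrite ?innerNl ?innerNr ?Ne ?he ?Ue ?et ?oppr0 ?opprK.
  + by move=> x i Vx; rewrite (pf x i Vx) scaleNr scalerN opprK.
  + by move=> x Vx; rewrite !mulrN -opprD oppr_eq0; exact: d.
- by move=> k; exact: Ck_cst.
- by move=> k; exact: Ck_cst.
- move=> x i Vx; rewrite (se_U SE i Vx); apply/rowP => j; rewrite !mxE; ring.
- move=> x i Vx; have de := smooth_differentiable (af_e AF) Vx.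
  rewrite (partialN i de) (se_e SE i Vx); apply/rowP => j; rewrite !mxE; ring.
- move=> x i Vx; rewrite (se_eta SE i Vx); apply/rowP => j; rewrite !mxE; ring.
Qed.

End SignFlips.

(** Both coefficients can be made nonnegative by reversing [eta], then [e]. *)
Lemma structure_signs (R : realType) (f N eta U e : 'rV[R]_2 -> 'rV[R]_5)
    (tau rho : 'I_2 -> 'rV[R]_2 -> R) (a b c s : R) (V : set 'rV[R]_2) :
  structure_equations f N eta U e tau rho (fun=> a) (fun=> b) c s V ->
  exists eta' e' rho',
    structure_equations f N eta' U e' tau rho' (fun=> `|a|) (fun=> `|b|) c s V.
Proof.
wlog a0 : eta a b / 0 <= a => [H SE|].
  have [a0|a0] := leP 0 a; first exact: H SE.
  have Na : 0 <= - a by rewrite oppr_ge0 ltW.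
  by have := H _ _ _ Na (structure_flip_eta SE); rewrite !normrN.
move=> SE; rewrite (ger0_norm a0).
have [b0|b0] := leP 0 b.
  by rewrite (ger0_norm b0); exists eta, e, rho.
rewrite (ltr0_norm b0); exists eta, (fun x => - e x), (fun i x => - rho i x).
exact: structure_flip_e.
Qed.

Section ConstantAngle.
Context {R : realType}.
Variables (f : 'rV[R]_2 -> 'rV[R]_5) (V : set 'rV[R]_2) (theta : R).
Hypotheses (oV : open V) (Sf : smooth_on V f) (fS : forall x, V x -> S3R R (f x)).
Hypothesis inj_df : forall x, V x -> injective ('d f x).
Hypothesis theta_bounds : 0 < theta < pi / 2.
Hypothesis angle_f : forall x, V x -> has_angle f x theta.

Let i0 : 'I_2 := ord0.
Let i1 : 'I_2 := ord_max.
Let c := cos theta.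
Let s := sin theta.

Lemma angle_adapted_frame : adapted_frame f (frame_N f) (frame_eta f theta)
  (frame_U f theta) (frame_e f theta) (frame_tau f theta) (frame_rho f theta) c s V.
Proof.
have P x := frame_pointwise oV Sf fS inj_df theta_bounds angle_f (x := x).
split=> //.
- by apply/smooth_onP => k; exact: (Ck_frame_N oV Sf).
- apply/smooth_onP => k; exact: (Ck_frame_eta oV Sf fS inj_df theta_bounds angle_f).
- apply/smooth_onP => k; exact: (Ck_frame_U oV Sf fS inj_df theta_bounds angle_f).
- apply/smooth_onP => k; exact: (Ck_frame_e oV Sf fS inj_df theta_bounds angle_f).
- move=> i k; exact: (Ck_frame_tau theta oV Sf).
- move=> i k; exact: (Ck_frame_rho oV Sf fS inj_df theta_bounds angle_f).
- by move=> x /P[].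
- by move=> x i /P[].
- move=> x /P[E0 dE _ _]; rewrite dE; apply: lt0r_neq0.
  by rewrite sqrtr_gt0; exact: E0.
- by rewrite gt_eqF// cos_theta_gt0.
- by rewrite gt_eqF// sin_theta_gt0.
- exact: cos2Dsin2.
Qed.

Hypothesis minimal_f : forall x, V x -> mean_curvature f x = 0.
Let AF := angle_adapted_frame.

Lemma angle_structure_equations : structure_equations f (frame_N f) (frame_eta f theta)
  (frame_U f theta) (frame_e f theta) (frame_tau f theta) (frame_rho f theta)
  (frame_a (frame_eta f theta) (frame_U f theta) (frame_tau f theta) (frame_rho f theta) c)
  (frame_b (frame_eta f theta) (frame_e f theta) (frame_tau f theta) (frame_rho f theta))
  c s V.
Proof.
split.
- exact: AF.
- by move=> k; have [] := Ck_frame_ab AF k.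
- by move=> k; have [] := Ck_frame_ab AF k.
- by move=> x i Vx; exact: (structure_U AF minimal_f).
- by move=> x i Vx; exact: (structure_e AF minimal_f).
- move=> x i Vx; apply: etrans (structure_eta AF minimal_f i Vx) _.
  by rewrite -[X in _ + X]scaleNr.
Qed.

(** The unit tangent vector [frame_T f theta x], in the coordinates of [f]. *)
Definition axis x : 'rV[R]_2 := (frame_delta f theta x)^-1 *:
  (frame_rho f theta i1 x *: delta_mx 0 i0 - frame_rho f theta i0 x *: delta_mx 0 i1).

(** The squared length of the derivative of [frame_U] along that vector; unlike the
    coefficients of the structure equations it does not depend on the coordinates. *)
Definition axis_speed x : R :=
  inner ('d (frame_U f theta) x (axis x)) ('d (frame_U f theta) x (axis x)).

Let dU x : V x -> differentiable (frame_U f theta) x.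
Proof. exact: smooth_differentiable (af_U AF). Qed.

Lemma diff_axis (X : 'rV[R]_2 -> 'rV[R]_5) x : differentiable X x ->
  'd X x (axis x) = (frame_delta f theta x)^-1 *:
    (frame_rho f theta i1 x *: partial i0 X x - frame_rho f theta i0 x *: partial i1 X x).
Proof.
by move=> dX; rewrite /axis linearZ linearB !linearZ/= -!partialE.
Qed.

(** The derivative of [U] along the axis is [- c N + (a / c) eta]. *)
Lemma axis_speedE x : V x -> axis_speed x = c ^+ 2 +
  frame_a (frame_eta f theta) (frame_U f theta) (frame_tau f theta) (frame_rho f theta)
    c x ^+ 2 / c ^+ 2.
Proof.
move=> Vx; have SE := angle_structure_equations.
have [E0 dE F _] := frame_pointwise oV Sf fS inj_df theta_bounds angle_f Vx.
have d0 : frame_delta f theta x != 0 by rewrite -dE; exact: (af_delta AF Vx).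
have cn0 := af_c AF.
rewrite /axis_speed (diff_axis (dU Vx)) (se_U SE i0 Vx) (se_U SE i1 Vx).
move: (frame_a _ _ _ _ _ x) (frame_b _ _ _ _ x) => a b.
have [[NN hh _ _] [Nh _ _] _ _] := F.
move: (frame_delta f theta x) (frame_tau f theta i0 x) (frame_tau f theta i1 x)
  (frame_rho f theta i0 x) (frame_rho f theta i1 x) d0 dE => d t0 t1 q0 q1 d0 dE.
move: (frame_N f x) (frame_eta f theta x) NN hh Nh => n h NN hh Nh.
have -> : d^-1 *: (q1 *: (- (c * t0) *: n + (c^-1 * (a * t0 + b * q0)) *: h) -
     q0 *: (- (c * t1) *: n + (c^-1 * (a * t1 + b * q1)) *: h)) = (- c) *: n + (a / c) *: h.
  transitivity (d^-1 *: (- (c * (t0 * q1 - t1 * q0)) *: n +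
      (c^-1 * (a * (t0 * q1 - t1 * q0))) *: h)).
    by apply/rowP => j; rewrite !mxE; ring.
  by rewrite dE; apply/rowP => j; rewrite !mxE; field; rewrite cn0 d0.
rewrite innerDl !innerDr !innerZl !innerZr (innerC h n) NN hh Nh; field.
by rewrite cn0.
Qed.

(** [axis_speedE] solved for the square of [frame_a]. *)
Definition axis_parameter (m : R) : R := model_parameter theta (c ^+ 2 * (m - c ^+ 2)).

(** By [structure_constants] the coefficients are constant near [z]. Their signs are
    normalised before [model_parameterP] applies. *)
Lemma constant_angle_local_model z : V z -> let n := axis_parameter (axis_speed z) in
  exists (r : R) (psi : 'rV[R]_2 -> 'rV[R]_2) (phi : 'rV[R]_5 -> 'rV[R]_5),
  [/\ [/\ 0 < r, ball z r `<=` V, 1 <= n <= Num.sqrt (1 + c ^+ 2) &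
        forall x, ball z r x -> axis_speed x = axis_speed z],
      smooth_on (ball z r) psi, jacobian psi z \in unitmx, isometry_S3R phi &
      forall x, ball z r x -> f x = phi (model theta n (psi x 0 0) (psi x 0 1))].
Proof.
move=> Vz n; have SE := angle_structure_equations.
set a := frame_a _ _ _ _ _ in SE; set b := frame_b _ _ _ _ in SE.
have cn0 := af_c AF.
have [r /= r0 rV] := (nbhs_ballP z _).1 (open_nbhs_nbhs (conj oV Vz)).
have da x : ball z r x -> differentiable a x.
  by move=> /rV; exact: Ck_differentiable (se_a SE 0).
have db x : ball z r x -> differentiable b x.
  by move=> /rV; exact: Ck_differentiable (se_b SE 0).
have aE x : ball z r x -> a x = a z.
  apply: (constant_on_ball1 da) r0 => w i /rV Vw.
  by have [] := structure_constants SE i Vw.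
have bE x : ball z r x -> b x = b z.
  apply: (constant_on_ball1 db) r0 => w i /rV Vw.
  by have [] := structure_constants SE i Vw.
have ob : open (ball z r) by exact: ball_open.
have SE0 := constant_structure (sub_structure SE ob rV) aE bE.
have [eta' [e' [rho' SE1]]] := structure_signs SE0.
have ab : `|a z| ^+ 2 + `|b z| ^+ 2 = c ^+ 2.
  by rewrite !real_normK ?num_real//; exact: (gauss_equation SE Vz).
have nE : n = model_parameter theta (`|a z| ^+ 2).
  rewrite /n /axis_parameter (axis_speedE Vz) -/a real_normK ?num_real//.
  by congr (model_parameter _ _); field.
have [nb aP bP] := model_parameterP theta_bounds (normr_ge0 _) (normr_ge0 _) ab.
rewrite -nE in nb aP bP; rewrite aP bP in SE1.
have zz : ball z r z by exact: ballxx.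
have [r' [psi [phi [[r'0 r'r] Spsi Jpsi iso fE]]]] :=
  structure_local_model theta_bounds nb SE1 zz.
exists r', psi, phi; split; [split|exact: Spsi|exact: Jpsi|exact: iso|exact: fE].
- exact: r'0.
- by move=> x /r'r/rV.
- exact: nb.
- move=> x /r'r zx; rewrite (axis_speedE (rV _ zx)) (axis_speedE Vz) -/a.
  by rewrite (aE x zx).
Qed.

End ConstantAngle.

(** * The speed of the axis under reparametrization *)

Lemma eq_diff_on (R : realType) (m n : nat) (U : set 'rV[R]_m) (f g : 'rV[R]_m -> 'rV[R]_n)
    x v : open U -> U x -> (forall y, U y -> f y = g y) -> differentiable f x ->
  differentiable g x -> 'd f x v = 'd g x v.
Proof.
move=> oU Ux fg df dg; apply: etrans (diff_partial v df) _.
apply: etrans _ (esym (diff_partial v dg)); apply: eq_bigr => i _.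
exact: congr1 (eq_partial i oU Ux fg).
Qed.

Lemma inner_combination_dt (R : realType) (k l s : R) (t p q d : 'rV[R]_5) :
  s * inner t p = inner p d -> s * inner t q = inner q d ->
  s * inner t (k *: p + l *: q) = inner (k *: p + l *: q) d.
Proof.
move=> P Q; rewrite innerDr innerDl !innerZr !innerZl mulrDr.
by rewrite mulrCA P [s * (l * _)]mulrCA Q.
Qed.

Section AxisInvariance.
Context {R : realType}.
Variable theta : R.
Hypothesis theta_bounds : 0 < theta < pi / 2.

Record constant_angle_on (V : set 'rV[R]_2) (f : 'rV[R]_2 -> 'rV[R]_5) : Prop := {
  ca_open : open V;
  ca_smooth : smooth_on V f;
  ca_S3R : forall x, V x -> S3R R (f x);
  ca_immersion : forall x, V x -> injective ('d f x);
  ca_angle : forall x, V x -> has_angle f x theta }.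

(** The vector [sin theta T] is the tangential part of [dt], which characterises [T]. *)
Lemma axis_tangent V f x : constant_angle_on V f -> V x ->
  let T := frame_T f theta x in
  [/\ 'd f x (axis f theta x) = T, inner T T = 1, inner T (dt R) = sin theta &
      forall v, sin theta * inner T ('d f x v) = inner ('d f x v) (dt R)].
Proof.
move=> [oV Sf fS inj_df angle_f] Vx T.
have df := smooth_differentiable Sf Vx.
have [E0 dE F fE] := frame_pointwise oV Sf fS inj_df theta_bounds angle_f Vx.
have [[_ _ UU ee] _ [_ _ Ue] [_ _ Ut et]] := F.
have cn0 : cos theta != 0 by rewrite gt_eqF// cos_theta_gt0.
have TE : T = cos theta *: frame_U f theta x + sin theta *: dt R.
  by rewrite /frame_U scalerA divff// scale1r subrK.
have dT : 'd f x (axis f theta x) = T by exact: (diff_axis f theta df).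
move: fE; rewrite -TE; clearbody T => fE.
move: (frame_U f theta x) (frame_e f theta x) TE UU ee Ue Ut et fE.
move=> U e TE UU ee Ue Ut et fE.
have Tt : inner T (dt R) = sin theta.
  by rewrite TE innerDl !innerZl Ut dt_dt mulr0 add0r mulr1.
have TT : inner T T = 1.
  have TU : inner T U = cos theta.
    by rewrite TE innerDl !innerZl UU (innerC (dt R)) Ut mulr0 addr0 mulr1.
  by rewrite {2}TE innerDr !innerZr Tt TU -!expr2 cos2Dsin2.
have Te : inner T e = 0.
  by rewrite TE innerDl !innerZl Ue (innerC (dt R)) et !mulr0 addr0.
have P i : sin theta * inner T (partial i f x) = inner (partial i f x) (dt R).
  rewrite (fE i) innerDr innerDl !innerZr !innerZl TT Te Tt et.
  by rewrite !mulr0 !addr0 mulr1 mulrC.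
split; [exact: dT|exact: TT|exact: Tt|move=> v].
rewrite (diff_partial v df) sum_ord2; exact: inner_combination_dt (P _) (P _).
Qed.

(** The unit tangent vectors of both parametrizations agree by [axis_tangent], hence
    so do the maps [frame_U], and the vectors that they are derived along correspond
    under [kappa]. *)
Lemma axis_speed_reparametrization V W f g kappa x :
  constant_angle_on V f -> constant_angle_on W g -> smooth_on V kappa ->
  (forall y, V y -> W (kappa y) /\ f y = g (kappa y)) -> V x ->
  axis_speed f theta x = axis_speed g theta (kappa x).
Proof.
move=> Cf Cg Sk fE Vx; have oV := ca_open Cf.
have dg y : V y -> differentiable g (kappa y).
  by move=> /fE[Wy _]; exact: smooth_differentiable (ca_smooth Cg) Wy.
have dk y : V y -> differentiable kappa y by exact: smooth_differentiable Sk.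
have df y : V y -> differentiable f y by exact: smooth_differentiable (ca_smooth Cf).
have chain y v : V y -> 'd f y v = 'd g (kappa y) ('d kappa y v).
  move=> Vy; have fg u : V u -> f u = (g \o kappa) u by move=> /fE[].
  apply: etrans (eq_diff_on v oV Vy fg (df y Vy) (differentiable_comp (dk y Vy) (dg y Vy))) _.
  exact: (congr1 (fun h : 'rV[R]_2 -> 'rV[R]_5 => h v) (diff_comp (dk y Vy) (dg y Vy))).
have TE y : V y -> frame_T f theta y = frame_T g theta (kappa y).
  move=> Vy; have [Wy _] := fE y Vy.
  have [Tf Tf1 Tfs _] := axis_tangent Cf Vy; have [Tg Tg1 Tgs Tgv] := axis_tangent Cg Wy.
  have s0 : sin theta != 0 by rewrite gt_eqF// sin_theta_gt0.
  have TT : inner (frame_T f theta y) (frame_T g theta (kappa y)) = 1.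
    apply: (mulfI s0); rewrite mulr1 innerC -Tf (chain y _ Vy) Tgv -(chain y _ Vy) Tf.
    exact: Tfs.
  move: (frame_T f theta y) (frame_T g theta (kappa y)) TT Tf1 Tg1 => t u tu tt uu.
  apply/eqP; rewrite -subr_eq0; apply/eqP/inner_eq0.
  by rewrite innerBl !innerBr (innerC u t) tu tt uu; ring.
have UE y : V y -> frame_U f theta y = (frame_U g theta \o kappa) y.
  by move=> Vy; rewrite /= /frame_U (TE y Vy).
have [Wx _] := fE x Vx.
have dUf : differentiable (frame_U f theta) x.
  case: Cf => oV' Sf fS inj_df angle_f.
  exact: (Ck_differentiable (Ck_frame_U oV Sf fS inj_df theta_bounds angle_f 0) Vx).
have dUg : differentiable (frame_U g theta) (kappa x).
  case: Cg => oW Sg gS inj_dg angle_g.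
  exact: (Ck_differentiable (Ck_frame_U oW Sg gS inj_dg theta_bounds angle_g 0) Wx).
have kE : 'd kappa x (axis f theta x) = axis g theta (kappa x).
  have [Tf _ _ _] := axis_tangent Cf Vx; have [Tg _ _ _] := axis_tangent Cg Wx.
  apply: (ca_immersion Cg Wx).
  have E1 := chain x (axis f theta x) Vx.
  have E2 := etrans Tf (TE x Vx).
  have E3 := etrans E2 (esym Tg).
  have E4 := etrans (esym E1) E3.
  exact: E4.
have DE : 'd (frame_U f theta) x (axis f theta x) =
    'd (frame_U g theta) (kappa x) (axis g theta (kappa x)).
  rewrite -kE; apply: etrans
    (eq_diff_on _ oV Vx UE dUf (differentiable_comp (dk x Vx) dUg)) _.
  exact: (congr1 (fun h : 'rV[R]_2 -> 'rV[R]_5 => h _) (diff_comp (dk x Vx) dUg)).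
exact: (congr1 (fun w => inner w w) DE).
Qed.

End AxisInvariance.

(** * Local coordinates *)

Section ComposedChart.
Context {R : realType} {M : surface R}.
Variables (c : chart R M) (A B : set 'rV[R]_2) (psi th : 'rV[R]_2 -> 'rV[R]_2).
Hypotheses (oA : open A) (oB : open B) (AC : A `<=` ccod c).
Hypothesis psiK : forall x, A x -> B (psi x) /\ th (psi x) = x.
Hypothesis thK : forall y, B y -> A (th y) /\ psi (th y) = y.
Hypotheses (Spsi : smooth_on A psi) (Sth : smooth_on B th).

Let D : set M := cdom c `&` c @^-1` A.

Let cmap_at p : cdom c p -> {for p, continuous c}.
Proof.
move=> cp; have := @cmap_continuous _ _ c.
by rewrite continuous_open_subspace; [move=> /(_ p); rewrite inE; exact|exact: cdom_open].
Qed.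

Let cinv_at x : ccod c x -> {for x, continuous (cinv c)}.
Proof.
move=> cx; have := @cinv_continuous _ _ c.
by rewrite continuous_open_subspace; [move=> /(_ x); rewrite inE; exact|exact: ccod_open].
Qed.

Let oD : open D.
Proof.
rewrite openE => p [cp Ap]; apply: filterI.
  by apply: open_nbhs_nbhs; split=> //; exact: cdom_open.
by apply: (cmap_at cp); apply: open_nbhs_nbhs.
Qed.

Let k_fun p : D p -> B ((psi \o c) p).
Proof. by move=> [cp Ap]; have [] := psiK Ap. Qed.

Let kinv_fun y : B y -> D ((cinv c \o th) y).
Proof.
move=> By; have [Ay _] := thK By; have Cy := AC Ay.
by split; [exact: cinv_fun|rewrite /preimage/= cinvK].
Qed.

Let kK p : D p -> (cinv c \o th) ((psi \o c) p) = p.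
Proof. by move=> [cp Ap] /=; have [_ ->] := psiK Ap; exact: cmapK. Qed.

Let kinvK y : B y -> (psi \o c) ((cinv c \o th) y) = y.
Proof. by move=> By /=; have [Ay e] := thK By; rewrite cinvK//; exact: AC. Qed.

Let k_continuous : {within D, continuous (psi \o c)}.
Proof.
rewrite continuous_open_subspace; last exact: oD.
move=> p; rewrite inE => -[cp Ap]; apply: continuous_comp; first exact: cmap_at.
exact: differentiable_continuous (smooth_differentiable Spsi Ap).
Qed.

Let kinv_continuous : {within B, continuous (cinv c \o th)}.
Proof.
rewrite continuous_open_subspace; last exact: oB.
move=> y; rewrite inE => By; apply: continuous_comp; last first.
  by apply: cinv_at; apply: AC; have [] := thK By.
exact: differentiable_continuous (smooth_differentiable Sth By).
Qed.

Definition composed_chart : chart R M :=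
  Chart oD oB k_fun kinv_fun kK kinvK k_continuous kinv_continuous.

Lemma composed_local_coordinates : atlas c -> local_coordinates composed_chart.
Proof.
move=> ac d ad; have [Scd Sdc] := atlas_compatible ac ad.
split.
  have od := cdom_open d.
  apply: (smooth_comp (g := th) (f := d \o cinv c)
    (open_cinv_preimage (c := composed_chart) od) (open_cinv_preimage (c := c) od)) => //.
    by move=> y [By dy]; split=> //; apply: AC; have [] := thK By.
  by apply: sub_smooth Sth => y [].
apply: (smooth_comp (g := c \o cinv d) (f := psi) (open_cinv_preimage (c := d) oD) oA) => //.
  by move=> y [_ []].
by apply: sub_smooth Sdc => y [dy [cy _]].
Qed.

End ComposedChart.

Section Surface.
Context {R : realType} {M : surface R}.
Variables (F : M -> 'rV[R]_5) (theta : R).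
Hypothesis theta_bounds : 0 < theta < pi / 2.
Hypotheses (FI : immersion_S3R F) (minF : minimal F) (angF : constant_angle F theta).

Let constant_angle_chart c V : atlas c -> open V -> V `<=` ccod c ->
  constant_angle_on theta V (F \o cinv c).
Proof.
move=> ac oV VC; have [FS /(_ c ac)[SF inj_dF]] := FI; split.
- exact: oV.
- exact: sub_smooth VC SF.
- by move=> x _; exact: FS.
- by move=> x /VC; exact: inj_dF.
- by move=> x /VC; exact: angF.
Qed.

Let chart_at (p : M) := cid2 (atlas_cover p).

(** The chart at [p] is chosen arbitrarily; by [surface_axis_speedE] any other one gives
    the same value. *)
Definition surface_axis_speed p : R :=
  axis_speed (F \o cinv (sval (chart_at p))) theta (sval (chart_at p) p).

Lemma surface_axis_speedE c p : atlas c -> cdom c p ->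
  surface_axis_speed p = axis_speed (F \o cinv c) theta (c p).
Proof.
rewrite /surface_axis_speed; case: (chart_at p) => d ad dp /= ac cp.
pose V := ccod d `&` cinv d @^-1` cdom c.
have oV : open V by exact: open_cinv_preimage (cdom_open c).
have Vp : V (d p) by split; [exact: cmap_fun|rewrite /preimage/= cmapK].
have [Sdc _] := atlas_compatible ad ac.
have Cd : constant_angle_on theta V (F \o cinv d).
  by apply: constant_angle_chart => // y [].
have Cc := constant_angle_chart ac (@ccod_open _ _ c) (@subset_refl _ _).
rewrite (axis_speed_reparametrization theta_bounds Cd Cc Sdc _ Vp) /= ?cmapK//.
by move=> y [dy cy]; split; [exact: cmap_fun|rewrite /= cmapK].
Qed.

(** The speed of the axis is locally constant by [constant_angle_local_model], and it
    determines the parameter; the map [psi] becomes a chart by the inverse function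
    theorem. *)
Lemma minimal_constant_angle_locally_model : locally_model F theta.
Proof.
have local p : exists c r psi phi,
    [/\ atlas c /\ cdom c p, 0 < r /\ ball (c p) r `<=` ccod c,
      forall q, cdom c q -> ball (c p) r (c q) ->
        surface_axis_speed q = surface_axis_speed p,
      1 <= axis_parameter theta (surface_axis_speed p) <= Num.sqrt (1 + cos theta ^+ 2) &
      [/\ smooth_on (ball (c p) r) psi, jacobian psi (c p) \in unitmx, isometry_S3R phi &
        forall x, ball (c p) r x -> (F \o cinv c) x =
          phi (model theta (axis_parameter theta (surface_axis_speed p))
            (psi x 0 0) (psi x 0 1))]].
  have [c ac cp] := atlas_cover p; have Cp := cmap_fun cp.
  have Cc := constant_angle_chart ac (@ccod_open _ _ c) (@subset_refl _ _).
  have minf x : ccod c x -> mean_curvature (F \o cinv c) x = 0 by exact: minF.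
  have [r [psi [phi [[r0 rV nb speedE] Spsi Jpsi iso fE]]]] :=
    constant_angle_local_model (ca_open Cc) (ca_smooth Cc) (ca_S3R Cc) (ca_immersion Cc)
      theta_bounds (ca_angle Cc) minf Cp.
  exists c, r, psi, phi; rewrite (surface_axis_speedE ac cp); split.
  - by split; [exact: ac|exact: cp].
  - by split; [exact: r0|exact: rV].
  - move=> q cq zq; apply: etrans (surface_axis_speedE ac cq) _; exact: speedE.
  - exact: nb.
  - by split; [exact: Spsi|exact: Jpsi|exact: iso|exact: fE].
exists (fun p => axis_parameter theta (surface_axis_speed p)); split; [|split].
- move=> p; have [c [r [psi [phi [[ac cp] [r0 _] speedE _ _]]]]] := local p.
  have oc : open (cdom c `&` c @^-1` ball (c p) r).
    rewrite openE => q [cq zq]; apply: filterI.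
      by apply: open_nbhs_nbhs; split=> //; exact: cdom_open.
    have := @cmap_continuous _ _ c.
    rewrite continuous_open_subspace; last exact: cdom_open.
    move=> /(_ q); rewrite inE => /(_ cq) cc; apply: cc.
    by apply: open_nbhs_nbhs; split=> //; exact: ball_open.
  apply: filterS (open_nbhs_nbhs (conj oc (conj cp (ballxx _ r0)))) => q [cq zq].
  by rewrite (speedE q cq zq).
- by move=> p; have [c [r [psi [phi [_ _ _ nb _]]]]] := local p.
move=> p; have [c [r [psi [phi [[ac cp] [r0 rC] _ _ [Spsi Jpsi iso fE]]]]]] := local p.
have ob : open (ball (c p) r) by exact: ball_open.
have zz : ball (c p) r (c p) by exact: ballxx.
have [A [B [th [[oA oB] [Ap AR] psiK thK Sth]]]] :=
  inverse_function_theorem ob zz Spsi Jpsi.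
have AC : A `<=` ccod c by move=> x /AR/rC.
have SA : smooth_on A psi by exact: sub_smooth AR Spsi.
exists (composed_chart oA oB AC psiK thK SA Sth), phi; split.
- exact: composed_local_coordinates.
- by split; [exact: cp|exact: Ap].
- exact: iso.
- move=> q [cq Aq]; have := fE (c q) (AR _ Aq).
  by rewrite /= (cmapK cq).
Qed.

End Surface.

Theorem theorem3 (R : realType) (theta : R) (M : surface R) (F : M -> 'rV[R]_5)
    (htheta : 0 < theta < pi / 2) (hF : immersion_S3R F) :
  (minimal F /\ constant_angle F theta) <-> locally_model F theta.
Proof.
split; first by move=> [minF angF]; exact: minimal_constant_angle_locally_model.
exact: locally_model_minimal_constant_angle.
Qed.
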